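(* Let $A_1,\ldots,A_n$ be finite subsets of $\mathbb Z^n$, let $C_1,\ldots,C_n$ be positive definite diagonal matrices ($C_i$ indexed by $A_i$), and let $U$ be a measurable subset of $\mathbb R^n$ with Lebesgue volume $\lambda(U)$. Let $f$ be a real random polynomial system with supports $A_1,\ldots,A_n$ and covariance matrices $C_1,\ldots,C_n$. Then the average number of real roots of $f$ in $\exp U\subset\mathbb R^n_+$ is bounded above by $$(4\pi^2)^{-n/2}\sqrt{\lambda(U)}\ \sqrt{\int_{(p,q)\in U\times[0,2\pi)^n}(-1)^{n(n-1)/2}\,\omega_{A_1}\wedge\cdots\wedge\omega_{A_n}}.$$
   Context: $\mathcal T^n=(\mathbb R\times(\mathbb R\bmod2\pi))^n$ has coordinates $(p,q)$ and is oriented so that $dp_1\wedge\cdots\wedge dp_n\wedge dq_1\wedge\cdots\wedge dq_n$ is positive. For $p\in\mathbb R^n$, $\exp(p)=(e^{p_1},\ldots,e^{p_n})$. A real random polynomial system with data $(A_1,C_1,\ldots,A_n,C_n)$ is $f=(f^1,\ldots,f^n)$ with $f^i=\sum_{a\in A_i}c^i_ax^a$ (Laurent polynomials, $x^a=x_1^{a_1}\cdots x_n^{a_n}$), where the coefficient vectors $(c^i_a)_{a\in A_i}$, $i=1,\ldots,n$, are independent real Gaussian vectors with mean $0$ and covariance matrix $C_i$. For a finite $A\subset\mathbb Z^n$ with positive definite diagonal matrix $C$ indexed by $A$, set $g_A(p)=\frac12\log\sum_{a\in A}C_{aa}e^{2a\cdot p}$ and $$(\omega_A)_{(p,q)}=\frac12\sum_{i,j=1}^n(D^2g_A(p))_{ij}\,dp_i\wedge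 dq_j .$$ The form $\omega_{A_i}$ is formed with the matrix $C_i$. *)

(* Defs.v *)
From HB Require Import structures.
From mathcomp Require Import all_boot all_order all_algebra perm finmap.
From mathcomp Require Import all_classical all_reals all_analysis.

Set Implicit Arguments.
Unset Strict Implicit.
Unset Printing Implicit Defensive.

Import Order.TTheory GRing.Theory Num.Theory.
Import numFieldNormedType.Exports.

Local Open Scope classical_set_scope.
Local Open Scope ring_scope.

Lemma product_measure1_sigma_finite {R : realType} d1 d2
    (T1 : measurableType d1) (T2 : measurableType d2)
    (m1 : {sigma_finite_measure set T1 -> \bar R})
    (m2 : {sigma_finite_measure set T2 -> \bar R}) :
  sigma_finite setT (m1 \x m2)%E.
Proof.
have /sigma_finiteP[F [TF ndF Foo]] := sigma_finiteT m1.
have /sigma_finiteP[G [TG ndG Goo]] := sigma_finiteT m2.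
exists (fun n => F n `*` G n).
  rewrite -setXTT TF TG predeqE => -[x y]; split.
    move=> [/= [n _ Fnx] [k _ Gky]]; exists (maxn n k) => //; split.
    - by move: x Fnx; exact/subsetPset/ndF/leq_maxl.
    - by move: y Gky; exact/subsetPset/ndG/leq_maxr.
  by move=> [n _ []/= ? ?]; split; exists n.
move=> k; have [? ?] := Foo k; have [? ?] := Goo k.
split; first exact: measurableX.
by rewrite product_measure1E// lte_mul_pinfty// ge0_fin_numE.
Qed.

Section push_cons.
Context {R : realType} (n : nat).
Variable mu : {sigma_finite_measure set (n.-tuple (measurableTypeR R)) -> \bar R}.

Definition cons_pair (x : measurableTypeR R * n.-tuple (measurableTypeR R)) : n.+1.-tuple (measurableTypeR R) :=
  [tuple of x.1 :: x.2].

Lemma measurable_cons_pair : measurable_fun setT cons_pair.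
Proof. exact: measurable_cons. Qed.

Definition lebesgue_cons : set (n.+1.-tuple (measurableTypeR R)) -> \bar R :=
  pushforward (@lebesgue_measure R \x mu)%E cons_pair.

Let lebesgue_cons0 : lebesgue_cons set0 = 0%E.
Proof. by rewrite /lebesgue_cons /pushforward preimage_set0 measure0. Qed.

Let lebesgue_cons_ge0 A : (0 <= lebesgue_cons A)%E.
Proof. by rewrite /lebesgue_cons /pushforward measure_ge0. Qed.

Let lebesgue_cons_sigma_additive : semi_sigma_additive lebesgue_cons.
Proof.
move=> F mF tF mUF; rewrite /lebesgue_cons /pushforward preimage_bigcup.
have mP A : measurable A -> measurable (cons_pair @^-1` A).
  by move=> mA; rewrite -[X in measurable X]setTI; exact: measurable_cons_pair.
apply: measure_semi_sigma_additive.
- by move=> k; exact: mP.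
- apply/trivIsetP => /= i j _ _ ij; rewrite -preimage_setI.
  by move/trivIsetP : tF => /(_ _ _ _ _ ij) ->//; rewrite preimage_set0.
- by rewrite -preimage_bigcup; exact: mP.
Qed.

HB.instance Definition _ := isMeasure.Build _ _ _ lebesgue_cons
  lebesgue_cons0 lebesgue_cons_ge0 lebesgue_cons_sigma_additive.

Let lebesgue_cons_sigma_finite : sigma_finite setT lebesgue_cons.
Proof.
have [F TF Foo] := product_measure1_sigma_finite (@lebesgue_measure R) mu.
pose G (t : n.+1.-tuple (measurableTypeR R)) :
    measurableTypeR R * n.-tuple (measurableTypeR R) :=
  (thead t, [tuple of behead t]).
have mG : measurable_fun setT G.
  by apply/measurable_fun_pair; [exact: measurable_tnth|exact: measurable_behead].
have GK : cancel cons_pair G by move=> [x t]; congr pair; exact: val_inj.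
exists (fun k => G @^-1` F k).
  by rewrite -preimage_bigcup -TF preimage_setT.
move=> k; have [mFk Fkoo] := Foo k; split.
  by rewrite -[X in measurable X]setTI; exact: mG.
rewrite /lebesgue_cons /pushforward -comp_preimage.
by rewrite (_ : G \o cons_pair = id)//; apply/funext => x; exact: GK.
Qed.

HB.instance Definition _ := Measure_isSigmaFinite.Build _ _ _ lebesgue_cons
  lebesgue_cons_sigma_finite.

End push_cons.

(* R^n is [n.-tuple R]. [measurableTypeR R] is R with the Borel sigma-algebra on
   which [lebesgue_measure] is declared. *)
Fixpoint lebesgue_tuple {R : realType} (n : nat) :
    {sigma_finite_measure set (n.-tuple (measurableTypeR R)) -> \bar R} :=
  match n with
  | 0 => [the {sigma_finite_measure set (0.-tuple (measurableTypeR R)) -> \bar R} of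
           @dirac _ _ [tuple] R]
  | m.+1 => [the {sigma_finite_measure set (m.+1.-tuple (measurableTypeR R)) -> \bar R} of
              lebesgue_cons (lebesgue_tuple m)]
  end.

(* Carathéodory completions, so that Lebesgue (not only Borel) measurable sets
   are covered; the second one is Lebesgue measure on R^n x R^n. *)
Definition lebesgue_vol {R : realType} n :=
  @completed_measure_extension _ _ _ (@lebesgue_tuple R n).

Definition lebesgue_vol2 {R : realType} n :=
  @completed_measure_extension _ _ _ (@lebesgue_tuple R n \x @lebesgue_tuple R n)%E.

Arguments lebesgue_vol {R} n.
Arguments lebesgue_vol2 {R} n.

Definition lebesgue_measurable {R : realType} n (U : set (n.-tuple R)) : Prop :=
  ((@lebesgue_tuple R n)^*)%mu.-cara.-measurable U.

Section forms.
Context {R : realType} {V : Type}.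

(* k-forms as bare functions of k vectors; multilinearity and alternation hold
   for all the forms built below and are not bundled. *)
Definition altform (k : nat) := ('I_k -> V) -> R.

(* Normalised so that (dx /\ dy)(u, v) = dx(u) dy(v) - dx(v) dy(u). *)
Definition wedge k l (al : altform k) (be : altform l) : altform (k + l) := fun v =>
  (k`! * l`!)%:R^-1 * \sum_(s : 'S_(k + l)) (-1) ^+ s *
    al (fun i => v (s (lshift l i))) * be (fun j => v (s (rshift k j))).

(* [w 0 /\ ... /\ w (m-1)]; the empty product is the constant 0-form 1. *)
Fixpoint bigwedge k m : ('I_m -> altform k) -> altform (m * k) :=
  match m with
  | 0 => fun _ _ => 1
  | m'.+1 => fun w => wedge (w ord0) (bigwedge (fun i => w (lift ord0 i)))
  end.

End forms.
Arguments altform R V k : clear implicits.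

Section torus_forms.
Context {R : realType} {n : nat}.

(* Tangent vectors of (R x R/2piZ)^n at any point: (p-part, q-part). *)
Definition tangent : Type := ('rV[R]_n * 'rV[R]_n)%type.

Definition dp (i : 'I_n) : altform R tangent 1 := fun v => (v ord0).1 0 i.
Definition dq (i : 'I_n) : altform R tangent 1 := fun v => (v ord0).2 0 i.

Lemma muln2_addnn m : (m * 2 = m + m)%N.
Proof. by rewrite muln2 addnn. Qed.

(* The positive frame (d/dp_1, ..., d/dp_n, d/dq_1, ..., d/dq_n). *)
Definition pos_frame (k : 'I_(n * 2)) : tangent :=
  match fintype.split (cast_ord (muln2_addnn n) k) with
  | inl i => (delta_mx 0 i, 0)
  | inr j => (0, delta_mx 0 j)
  end.

(* Integral over D of a top-degree form, i.e. of its coefficient with respect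
   to dp_1 /\ ... /\ dp_n /\ dq_1 /\ ... /\ dq_n. *)
Definition form_integral (D : set (n.-tuple R * n.-tuple R))
    (al : n.-tuple R * n.-tuple R -> altform R tangent (n * 2)) : \bar R :=
  (\int[lebesgue_vol2 n]_(z in D) (al z pos_frame)%:E)%E.

(* Fundamental domain of (R/2piZ)^n. *)
Definition torus_box : set (n.-tuple R) :=
  [set q | forall i, 0 <= tnth q i < 2 * pi].

Definition hessian (g : 'rV[R]_n -> R) (p : 'rV[R]_n) : 'M[R]_n :=
  \matrix_(i, j) 'D_(delta_mx 0 i) (fun x => 'D_(delta_mx 0 j) g x) p.

Definition row_of (p : n.-tuple R) : 'rV[R]_n := \row_i tnth p i.

Variables (A : {fset 'rV[int]_n}) (C : 'M[R]_#|{: A}|).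

Definition log_kernel (p : 'rV[R]_n) : R :=
  2^-1 * ln (\sum_(a : A) C (enum_rank a) (enum_rank a) *
                expR (2 * \sum_j (val a 0 j)%:~R * p 0 j)).

Definition omega (z : n.-tuple R * n.-tuple R) : altform R tangent 2 := fun v =>
  2^-1 * \sum_i \sum_j
    hessian log_kernel (row_of z.1) i j * wedge (dp i) (dq j) v.

End torus_forms.

Definition posdefmx {R : realType} m (M : 'M[R]_m) : Prop :=
  M^T = M /\ forall u : 'rV[R]_m, u != 0 -> 0 < (u *m M *m u^T) 0 0.

Section random.
Context {d} {T : measurableType d} {R : realType} (P : probability T R).

(* [normal_prob m 0] is not the Dirac mass, hence the case distinction. *)
Definition gaussian_law (m s : R) (V : set R) : \bar R :=
  if s == 0 then \d_m V else normal_prob m s V.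

Definition gaussian_vector (I : finType) (X : I -> {RV P >-> R})
    (m : I -> R) (K : 'M[R]_#|I|) : Prop :=
  [/\ forall t : I -> R, exists mu s : R, forall V : set R, measurable V ->
         P ((fun w => \sum_a t a * X a w) @^-1` V) = gaussian_law mu s V,
      forall a, ('E_P[X a] = (m a)%:E)%E &
      forall a b,
        covariance P (X a) (X b) = (K (enum_rank a) (enum_rank b))%:E].

Definition sigma_generated (I : Type) (X : I -> {RV P >-> R}) :
    set (set T) :=
  <<s [set E | exists a (V : set R), measurable V /\ E = X a @^-1` V] >>.

Definition independent_sigma n (S : 'I_n -> set (set T)) : Prop :=
  forall (J : {set 'I_n}) (E : 'I_n -> set T),
    (forall i, i \in J -> S i (E i)) ->
    P (\bigcap_(i in [set` J]) E i) = (\prod_(i in J) P (E i))%E.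

Context {n : nat} (A : 'I_n -> {fset 'rV[int]_n}).

Definition random_system (C : forall i, 'M[R]_#|{: A i}|)
    (c : forall i, A i -> {RV P >-> R}) : Prop :=
  (forall i, gaussian_vector (c i) (fun=> 0) (C i)) /\
  independent_sigma (fun i => sigma_generated (c i)).

Definition laurent_monomial (a : 'rV[int]_n) (x : n.-tuple R) : R :=
  \prod_j tnth x j ^ a 0 j.

Definition system_eval (c : forall i, A i -> {RV P >-> R}) (w : T)
    (x : n.-tuple R) (i : 'I_n) : R :=
  \sum_(a : A i) c i a w * laurent_monomial (val a) x.

Definition exp_tuple (p : n.-tuple R) : n.-tuple R :=
  [tuple expR (tnth p i) | i < n].

Definition roots_in (c : forall i, A i -> {RV P >-> R}) (w : T)
    (D : set (n.-tuple R)) : set (n.-tuple R) :=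
  [set x | D x /\ forall i, system_eval c w x i = 0].

(* For a random system and Lebesgue measurable log D, the root count agrees
   P-almost everywhere with a measurable function of [w], so this integral (a
   supremum over measurable simple functions) is its expectation even when the
   count itself is not measurable for the given sigma-algebra. *)
Definition average_roots (c : forall i, A i -> {RV P >-> R})
    (D : set (n.-tuple R)) : \bar R :=
  (\int[P]_w counting (roots_in c w D))%E.

End random.

(* Main.v *)
(* The zeros x = exp p of f are counted in the logarithmic coordinate p. Fix p
   and let K_i be the variance of F_i = f^i(exp .) at p. The value
   xi_i = F_i(p) / sqrt K_i is standard normal and independent of the centred
   derivatives Lambda_ij = (d_j F_i(p) - m_ij F_i(p)) / sqrt K_i, where m_i is
   the barycenter of A_i for the weights C_aa exp(2 a.p) / K_i, so that
   E det(Lambda)^2 = e(p), the coefficient of the form in the statement: the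
   covariance matrix of Lambda_i is half the Hessian of g_{A_i}. A root in the
   cube p + h[0,1]^n forces xi = - h Lambda u + O(h^2) for some u in [0,1]^n, and
   the density of xi is at most (2 pi)^(-n/2), so the probability of a root is at
   most (2 pi)^(-n/2) h^n (E |det Lambda| + o(1)). Summing over fine grids, with
   Fatou's lemma and outer regularity, the expected number of roots is at most
   (2 pi)^(-n/2) times the integral over U of E |det Lambda|, and
   E |det Lambda| <= (t + e / t) / 2 for each t > 0. The optimal t gives the
   theorem (this replaces Cauchy-Schwarz). *)
From HB Require Import structures.
Require Import Defs.
From mathcomp Require Import all_boot all_order all_algebra perm finmap.
From mathcomp Require Import all_classical all_reals all_analysis.
From mathcomp Require Import measurable_realfun ring lra.

Set Implicit Arguments.
Unset Strict Implicit.
Unset Printing Implicit Defensive.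

Import Order.TTheory GRing.Theory Num.Theory.
Import numFieldNormedType.Exports.

Local Open Scope classical_set_scope.
Local Open Scope ring_scope.

(** * Moments and characteristic function of the normal law *)

(** Only an upper bound is wanted, so an exact root formula, with its regular values and local
    inverses, gives way to a necessary condition for a root in a small cube. Four obstacles shape
    the rest. [gaussian_vector] speaks of single linear forms only, so the independence of xi and
    Lambda is derived from cosine transforms and a uniqueness theorem for them. The remainder O(h^2)
    must be uniform in p and in the coefficients: centring at the barycenter frees the constants of
    p, and the coefficients are truncated, a restriction that Fatou's lemma lifts at the end. The
    volume of a neighbourhood of Lambda [0,1]^n must be close to |det Lambda| uniformly in Lambda,
    singular matrices included; this is a compactness argument. Riemann sums must be compared with
    integrals over unbounded sets: e(p) varies by at most a factor exp(rate h) over a distance h,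
    because it is a positive combination of products of weights. The root count is not assumed
    measurable, hence the estimates by measurable majorants. *)

Lemma dominated_convergence_real d (T : measurableType d) (R : realType)
    (mu : {measure set T -> \bar R}) (f_ : nat -> T -> R) (f g : T -> R) :
  (forall n, measurable_fun setT (f_ n)) -> measurable_fun setT f ->
  (forall x, f_ n x @[n --> \oo] --> f x) ->
  mu.-integrable setT (EFin \o g) -> (forall n x, `|f_ n x| <= g x) ->
  (\int[mu]_x (f_ n x)%:E)%E @[n --> \oo] --> (\int[mu]_x (f x)%:E)%E.
Proof.
move=> mf_ mf ff ig fg.
have [] := @dominated_convergence _ _ _ mu setT measurableT
  (fun n => EFin \o f_ n) (EFin \o f) (EFin \o g) => //.
- by move=> n; exact/measurable_EFinP.
- exact/measurable_EFinP.
- by apply: aeW => x _; apply: cvg_EFin; [exact: nearW|exact: ff].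
- by apply: aeW => x n _; rewrite lee_fin.
Qed.

Section normal_moments.
Context {R : realType}.
Notation leb := (@lebesgue_measure R).

(** Integration by parts without boundary terms: every Gaussian identity below applies it to a
    multiple of the density. The fundamental theorem of calculus on intervals of radius k+1 around m
    leaves boundary values of order 1/k, and dominated convergence passes to the line. *)
Lemma integral_of_derivative0 (F f : R -> R) (m C : R) :
  (forall x, is_derive x (1:R) F (f x)) -> continuous f ->
  leb.-integrable setT (EFin \o f) ->
  (forall k, 0 < k -> `|F (m + k)| <= C / k /\ `|F (m - k)| <= C / k) ->
  (\int[leb]_x (f x)%:E = 0)%E.
Proof.
move=> dF cf intf Fb.
pose D (k : nat) : set R := `[m - k.+1%:R, m + k.+1%:R]%classic.
have mf : measurable_fun setT f by apply: continuous_measurable_fun.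
have ckN k : m - k.+1%:R < m + k.+1%:R :> R.
  by rewrite ltrD2l (lt_trans (y := 0)) ?oppr_lt0 ?ltr0n.
have IFk k : (\int[leb]_x (((EFin \o f) \_ (D k)) x) =
              (F (m + k.+1%:R) - F (m - k.+1%:R))%:E)%E.
  rewrite -integral_mkcond EFinB -(@continuous_FTC2 _ f F) //.
  - exact: continuous_subspaceT.
  - have cF x : {for x, continuous F}.
      exact/differentiable_continuous/derivable1_diffP/(@ex_derive _ _ _ _ _ _ _ (dF x)).
    split; last 2 first.
    + exact: (cvg_at_right_filter (cF _)).
    + exact: (cvg_at_left_filter (cF _)).
    + by move=> x _; exact: ex_derive.
  - by move=> x _; rewrite derive1E; exact: derive_val.
have cv1 : (fun k => \int[leb]_x (((EFin \o f) \_ (D k)) x))%E @ \oo -->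
           (\int[leb]_x (f x)%:E)%E.
  have -> : (fun k => \int[leb]_x (((EFin \o f) \_ (D k)) x))%E =
      (fun k => \int[leb]_x (f x * \1_(D k) x)%:E)%E.
    apply/funext => k; apply: eq_integral => x _.
    by rewrite patchE indicE; case: ifP; rewrite ?mulr1 ?mulr0.
  apply: (@dominated_convergence_real _ _ _ leb _ _ (Num.norm \o f)) => //.
  - move=> k; apply: measurable_funM => //; apply: measurable_indic.
    exact: measurable_itv.
  - move=> x; apply: cvg_near_cst.
    exists (Num.truncn `|x - m|) => // k /= kx.
    rewrite indicE mem_set ?mulr1// /D /= in_itv /= -ler_distl.
    apply/ltW; apply: lt_le_trans (truncnS_gt _) _.
    by rewrite ler_nat ltnS.
  - exact: (integrable_abse intf).
  - move=> k x /=; rewrite normrM ler_piMr// indicE.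
    by case: (_ \in _); rewrite ?normr1 ?normr0.
have cv2 : (fun k => \int[leb]_x (((EFin \o f) \_ (D k)) x))%E @ \oo --> 0%E.
  under eq_fun do rewrite IFk.
  apply: cvg_EFin; first exact: nearW.
  have h : (fun k : nat => (C *+ 2) * k.+1%:R^-1 : R) @ \oo --> (0 : R).
    rewrite -[0](mulr0 (C *+ 2)); apply: cvgM; first exact: cvg_cst.
    exact: cvg_harmonic.
  apply/norm_cvg0P; apply: (squeeze_cvgr _ (cvg_cst 0) h).
  apply: nearW => k /=; rewrite normr_ge0 /= (le_trans (ler_normB _ _))//.
  have [h1 h2] := Fb k.+1%:R (ltr0Sn _ _).
  by rewrite mulrnAl mulr2n lerD.
exact: (cvg_unique _ cv1 cv2).
Qed.

Variables (m s : R).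
Hypothesis s0 : s != 0.
Notation phi := (normal_pdf m s).

Let s2_gt0 : 0 < s ^+ 2. Proof. by rewrite exprn_even_gt0. Qed.

(** A larger standard deviation absorbs the quadratic factor: with y = (x - m)^2 / (4 s^2) the two
    densities are multiples of exp(-2y) and exp(-y), and y exp(-y) <= 1. Integrability under
    quadratic growth thus reduces to that of a density. *)
Lemma normal_pdf_sqr_le : exists2 C : R, 0 <= C &
  forall x, (x - m) ^+ 2 * phi x <= C * normal_pdf m (Num.sqrt 2 * s) x.
Proof.
have s20 : Num.sqrt 2 * s != 0 by rewrite mulf_neq0// sqrtr_eq0 -ltNge.
exists (4 * s ^+ 2 * normal_peak s / normal_peak (Num.sqrt 2 * s)).
  by rewrite divr_ge0 ?normal_peak_ge0// mulr_ge0 ?normal_peak_ge0// mulr_ge0// ltW.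
move=> x; rewrite !normal_pdfE// /normal_fun.
rewrite [leRHS]mulrA divfK ?gt_eqF ?normal_peak_gt0//.
rewrite [leRHS]mulrAC [leLHS]mulrCA [leRHS]mulrC.
rewrite ler_wpM2l ?normal_peak_ge0//.
set y := (x - m) ^+ 2 / (4 * s ^+ 2).
have -> : - (x - m) ^+ 2 / (s ^+ 2 *+ 2) = - y - y by rewrite /y; field.
have -> : - (x - m) ^+ 2 / ((Num.sqrt 2 * s) ^+ 2 *+ 2) = - y.
  by rewrite exprMn sqr_sqrtr// /y; field.
have -> : (x - m) ^+ 2 = y * (4 * s ^+ 2) by rewrite /y; field.
have s4 : 0 <= 4 * s ^+ 2 by rewrite mulr_ge0// ltW.
rewrite mulrAC [leRHS]mulrC ler_wpM2r//.
rewrite expRD mulrA ler_piMl ?expR_ge0// expRN ler_pdivrMr ?expR_gt0// mul1r.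
by rewrite (le_trans _ (expR_ge1Dx y))// lerDr.
Qed.

Let intphi' : leb.-integrable setT (EFin \o normal_pdf m (Num.sqrt 2 * s)).
Proof. exact: integrable_normal_pdf. Qed.

Lemma integrable_poly2_normal_pdf (f : R -> R) (a b : R) :
  measurable_fun setT f -> (forall x, `|f x| <= a + b * (x - m) ^+ 2) ->
  0 <= b -> leb.-integrable setT (fun x => (f x * phi x)%:E).
Proof.
move=> mf fb b0; have [C C0 CP] := normal_pdf_sqr_le.
have mphi : measurable_fun setT phi by exact: measurable_normal_pdf.
apply: (@le_integrable _ _ _ leb setT measurableT _ (fun x => (a%:E * (phi x)%:E +
    (b * C)%:E * (normal_pdf m (Num.sqrt 2 * s) x)%:E)%E)) => //.
- by apply/measurable_EFinP; apply: measurable_funM.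
- move=> x _; rewrite -!EFinM -EFinD !abse_EFin lee_fin.
  apply: le_trans (ler_norm _).
  rewrite normrM (ger0_norm (normal_pdf_ge0 _ _ _)).
  apply: le_trans (ler_wpM2r (normal_pdf_ge0 _ _ _) (fb x)) _.
  by rewrite mulrDl lerD2l -[leLHS]mulrA -[leRHS]mulrA ler_wpM2l ?CP.
- apply: integrableD => //; apply: integrableZl => //.
  exact: integrable_normal_pdf.
Qed.

Lemma is_derive_normal_pdf (x : R) :
  is_derive x 1 phi (- ((x - m) / s ^+ 2) * phi x).
Proof.
rewrite normal_pdfE// /normal_fun.
have -> : (fun x => normal_peak s * expR (- (x - m) ^+ 2 / (s ^+ 2 *+ 2))) =
  (normal_peak s \*: (expR \o (fun x => (- (s ^+ 2 *+ 2)^-1) *: ((x - m) ^+ 2)))).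
  apply/funext => y /=; congr (_ * expR _); rewrite /GRing.scale /=; ring.
apply: is_derive_eq; rewrite /GRing.scale /=.
have -> : - (s ^+ 2 *+ 2)^-1 * (x - m) ^+ 2 = - (x - m) ^+ 2 / (s ^+ 2 *+ 2).
  by rewrite mulrC mulNr mulrN.
by field.
Qed.

(** The decay demanded by [integral_of_derivative0], for the primitives that occur: multiples of the
    density for the first moment and of (x - m) times the density for the second. *)
Lemma normal_pdf_tail : exists C : R,
  (forall k, 0 < k -> `|phi (m + k)| <= C / k /\ `|phi (m - k)| <= C / k) /\
  (forall k, 0 < k -> `|k * phi (m + k)| <= C / k /\
                      `|k * phi (m - k)| <= C / k).
Proof.
have [C C0 CP] := normal_pdf_sqr_le.
have s20 : Num.sqrt 2 * s != 0 by rewrite mulf_neq0// sqrtr_eq0 -ltNge.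
pose D := C * normal_peak (Num.sqrt 2 * s).
have D0 : 0 <= D by rewrite mulr_ge0// normal_peak_ge0.
have DP x : (x - m) ^+ 2 * phi x <= D.
  by apply: le_trans (CP x) _; rewrite ler_wpM2l// normal_pdf_ub.
pose p := normal_peak s.
have p0 : 0 <= p by exact: normal_peak_ge0.
have aux k x : 0 < k -> (x - m) ^+ 2 = k ^+ 2 ->
    `|phi x| <= (p + D) / k /\ `|k * phi x| <= (p + D) / k.
  move=> k0 xk.
  rewrite !ger0_norm ?mulr_ge0 ?normal_pdf_ge0 ?(ltW k0)//.
  rewrite !ler_pdivlMr//; split; last first.
    rewrite mulrAC -expr2 -xk; apply: le_trans (DP x) _.
    by rewrite lerDr.
  have kk : k <= 1 + k ^+ 2 by nra.
  apply: (le_trans (ler_wpM2l (normal_pdf_ge0 _ _ _) kk)).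
  rewrite mulrDr mulr1 lerD// ?normal_pdf_ub//.
  by rewrite mulrC -xk DP.
exists (p + D); split=> k k0.
  by split; apply: (aux _ _ k0 _).1; ring.
by split; apply: (aux _ _ k0 _).2; ring.
Qed.

Lemma continuous_normal_pdf_mul (f : R -> R) :
  continuous f -> continuous (fun x => f x * phi x).
Proof.
move=> cf x; apply: cvgM; first exact: cf.
exact: continuous_normal_pdf.
Qed.

Lemma normal_pdf_moment1 : (\int[leb]_x ((x - m) * phi x)%:E = 0)%E.
Proof.
have [C [Ct _]] := normal_pdf_tail.
have int : leb.-integrable setT (fun x => ((x - m) * phi x)%:E).
  apply: (@integrable_poly2_normal_pdf _ 1 1) => //.
  - exact: measurable_funB.
  - move=> x; rewrite mul1r -real_normK ?num_real//; nra.
have := @integral_of_derivative0 (fun x => - (s ^+ 2) * phi x)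
  (fun x => (x - m) * phi x) m (s ^+ 2 * C).
apply.
- move=> x; have h := is_derive_normal_pdf x.
  apply: is_derive_eq; rewrite /GRing.scale /=; field.
  exact: s0.
- apply: continuous_normal_pdf_mul => x.
  by apply: cvgB; [exact: cvg_id|exact: cvg_cst].
- exact: int.
- move=> k k0; rewrite !normrM !normrN (ger0_norm (ltW s2_gt0)).
  by have [h1 h2] := Ct k k0; rewrite -mulrA; split; rewrite ler_wpM2l// ltW.
Qed.

(** The function ((x - m)^2 - s^2) phi is the derivative of - s^2 (x - m) phi, so its integral
    vanishes. *)
Lemma normal_pdf_moment2 :
  (\int[leb]_x ((x - m) ^+ 2 * phi x)%:E = (s ^+ 2)%:E)%E.
Proof.
have [C [_ Ct]] := normal_pdf_tail.
have int2 : leb.-integrable setT (fun x => ((x - m) ^+ 2 * phi x)%:E).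
  apply: (@integrable_poly2_normal_pdf _ 0 1) => //.
  - by apply: measurable_funX; exact: measurable_funB.
  - by move=> x; rewrite mul1r add0r ger0_norm// sqr_ge0.
have int1 : leb.-integrable setT (fun x => (s ^+ 2 * phi x)%:E).
  apply: (@integrable_poly2_normal_pdf _ (s ^+ 2) 0) => //.
  by move=> x; rewrite mul0r addr0 ger0_norm// ltW.
have : (\int[leb]_x ((x - m) ^+ 2 * phi x - s ^+ 2 * phi x)%:E = 0)%E.
  have := @integral_of_derivative0 (fun x => - (s ^+ 2) * ((x - m) * phi x))
    (fun x => (x - m) ^+ 2 * phi x - s ^+ 2 * phi x) m (s ^+ 2 * C).
  apply.
  - move=> x; have h := is_derive_normal_pdf x.
    apply: is_derive_eq; rewrite /GRing.scale /=; field.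
    exact: s0.
  - under eq_fun do rewrite -mulrBl.
    apply: continuous_normal_pdf_mul => x.
    apply: cvgB; last exact: cvg_cst.
    apply: (cvg_comp (fun x => x - m) (fun x => x ^+ 2)).
      by apply: cvgB; [exact: cvg_id|exact: cvg_cst].
    exact: exprn_continuous.
  - exact: (integrableB measurableT int2 int1).
  - move=> k k0; have [h1 h2] := Ct k k0.
    have -> : m + k - m = k by ring.
    have -> : m - k - m = - k by ring.
    by split; rewrite normrM normrN (ger0_norm (ltW s2_gt0)) -[leRHS]mulrA
      ler_wpM2l ?(ltW s2_gt0)// mulNr normrN.
under eq_integral do rewrite EFinB.
rewrite integralB//= => /eqP.
under [X in (_ - X)%E]eq_integral do rewrite EFinM.
rewrite integralZl//; last exact: integrable_normal_pdf.
rewrite integral_normal_pdf mule1 sube_eq ?add0e; first by move/eqP.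
  exact: integrable_fin_num.
by rewrite fin_num_adde_defl.
Qed.

(** Integrals against [normal_prob] are turned into Lebesgue integrals through its Radon-Nikodym
    derivative, which agrees almost everywhere with the density since both integrate to the same
    value on every measurable set. *)
Let rn := Radon_Nikodym_SigmaFinite.f (normal_prob m s) leb.

Let mrn : measurable_fun setT rn.
Proof.
apply: (measurable_int leb).
exact: (Radon_Nikodym_SigmaFinite.f_integrable (normal_prob_dominates m s)).
Qed.

Let rnE : ae_eq leb setT rn (fun x => (phi x)%:E).
Proof.
apply: integral_ae_eq => //.
- exact: (Radon_Nikodym_SigmaFinite.f_integrable (normal_prob_dominates m s)).
- by apply/measurable_EFinP; exact: measurable_normal_pdf.
- move=> E _ mE.
  by rewrite -(Radon_Nikodym_SigmaFinite.f_integral (normal_prob_dominates m s)).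
Qed.

Lemma ge0_integral_normal_prob (f : R -> \bar R) :
  measurable_fun setT f -> (forall x, 0 <= f x)%E ->
  (\int[normal_prob m s]_x f x = \int[leb]_x (f x * (phi x)%:E))%E.
Proof.
move=> mf f0.
rewrite -(Radon_Nikodym_SigmaFinite.change_of_variables
  (normal_prob_dominates m s))//.
apply: ae_eq_integral => //.
- exact: emeasurable_funM.
- apply: emeasurable_funM => //.
  by apply/measurable_EFinP; exact: measurable_normal_pdf.
- exact: ae_eqe_mul2l.
Qed.

Lemma integral_normal_prob (f : R -> R) (a b : R) :
  measurable_fun setT f -> (forall x, `|f x| <= a + b * (x - m) ^+ 2) ->
  0 <= b ->
  (normal_prob m s).-integrable setT (EFin \o f) /\
  (\int[normal_prob m s]_x (f x)%:E = \int[leb]_x (f x * phi x)%:E)%E.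
Proof.
move=> mf fb b0; have int := integrable_poly2_normal_pdf mf fb b0.
have finf : (normal_prob m s).-integrable setT (EFin \o f).
  apply/integrableP; split; first exact/measurable_EFinP.
  rewrite ge0_integral_normal_prob//; last first.
    by apply: measurableT_comp => //; exact/measurable_EFinP.
  have /integrableP[_] := int; apply: le_lt_trans.
  rewrite le_eqVlt; apply/orP; left; apply/eqP; apply: eq_integral => x _.
  by rewrite EFinM abseM [X in (_ = _ * X)%E]gee0_abs// lee_fin normal_pdf_ge0.
split => //.
rewrite [LHS]integralE [RHS]integralE !ge0_integral_normal_prob//; last 2 first.
- by apply: measurable_funeneg; exact/measurable_EFinP.
- by apply: measurable_funepos; exact/measurable_EFinP.
congr (_ - _)%E; apply: eq_integral => x _.
  by rewrite !funeposE -!EFin_max -EFinM maxr_pMl ?normal_pdf_ge0// mul0r.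
by rewrite !funenegE -!EFinN -!EFin_max -EFinM maxr_pMl ?normal_pdf_ge0// mul0r mulNr.
Qed.

End normal_moments.

(** * The characteristic function of the centred normal law *)

Section normal_charfun.
Context {R : realType} (s : R).
Hypothesis s0 : s != 0.
Notation leb := (@lebesgue_measure R).
Notation phi := (normal_pdf 0 s).

Let mcos (t : R) : measurable_fun setT (fun x : R => cos (t * x)).
Proof.
apply: continuous_measurable_fun => x.
apply: (cvg_comp (fun x => t * x) cos); last exact: continuous_cos.
by apply: cvgM; [exact: cvg_cst|exact: cvg_id].
Qed.

Let msin (t : R) : measurable_fun setT (fun x : R => sin (t * x)).
Proof.
apply: continuous_measurable_fun => x.
apply: (cvg_comp (fun x => t * x) sin); last exact: continuous_sin.
by apply: cvgM; [exact: cvg_cst|exact: cvg_id].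
Qed.

Let icos t : leb.-integrable setT (fun x => (cos (t * x) * phi x)%:E).
Proof.
apply: (@integrable_poly2_normal_pdf _ 0 s s0 _ 1 0) => // x.
by rewrite mul0r addr0 ler_norml cos_geN1 cos_le1.
Qed.

Let ixsin t : leb.-integrable setT (fun x => (x * sin (t * x) * phi x)%:E).
Proof.
apply: (@integrable_poly2_normal_pdf _ 0 s s0 _ 1 1) => //.
  exact: measurable_funM.
move=> x; rewrite subr0 mul1r normrM.
have h1 : `|sin (t * x)| <= 1 by rewrite ler_norml sin_geN1 sin_le1.
have h2 := normr_ge0 x.
rewrite -(@real_normK _ x) ?num_real//.
by have := normr_ge0 (sin (t * x)); nra.
Qed.

(** The two sides differ by the integral of the derivative of s^2 sin(t x) phi(x). This is what
    closes the differential equation F' = - t s^2 F for the cosine transform F. *)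
Lemma normal_sin_by_parts (t : R) :
  \int[leb]_x (x * sin (t * x) * phi x) =
  t * s ^+ 2 * \int[leb]_x (cos (t * x) * phi x).
Proof.
have [C [Ct _]] := @normal_pdf_tail _ 0 s s0.
have i1 : leb.-integrable setT (fun x => (t * s ^+ 2 * (cos (t * x) * phi x))%:E).
  by under eq_fun do rewrite EFinM; exact: integrableZl.
have : (\int[leb]_x (t * s ^+ 2 * (cos (t * x) * phi x) -
                     x * sin (t * x) * phi x)%:E = 0)%E.
  have := @integral_of_derivative0 _ (fun x => s ^+ 2 * (sin (t * x) * phi x))
    (fun x => t * s ^+ 2 * (cos (t * x) * phi x) - x * sin (t * x) * phi x)
    0 (s ^+ 2 * C).
  apply.
  - move=> x; have h := @is_derive_normal_pdf _ 0 s s0 x.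
    have h' : is_derive x 1 (fun x => sin (t * x)) (cos (t * x) * t).
      have -> : (fun x => sin (t * x)) = sin \o (t \*: (@id R)) by [].
      by apply: is_derive_eq; rewrite /GRing.scale /= mulr1 mulrC.
    apply: is_derive_eq; rewrite /GRing.scale /= subr0; field.
    exact: s0.
  - have -> : (fun x => t * s ^+ 2 * (cos (t * x) * phi x) -
        x * sin (t * x) * phi x) =
        (fun x => (t * s ^+ 2 * cos (t * x) - x * sin (t * x)) * phi x).
      by apply/funext => x; ring.
    apply: continuous_normal_pdf_mul => // x.
    have ct : {for x, continuous (fun x : R => t * x)}.
      by apply: cvgM; [exact: cvg_cst|exact: cvg_id].
    apply: cvgB; apply: cvgM; [exact: cvg_cst| |exact: cvg_id|].
      by apply: (cvg_comp _ cos ct); exact: continuous_cos.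
    by apply: (cvg_comp _ sin ct); exact: continuous_sin.
  - exact: (integrableB measurableT i1 (ixsin t)).
  - move=> k k0; have [h1 h2] := Ct k k0.
    have aux y : `|phi y| <= C / k -> `|s ^+ 2 * (sin (t * y) * phi y)| <= s ^+ 2 * C / k.
      move=> h; rewrite normrM ger0_norm ?sqr_ge0// -mulrA ler_wpM2l ?sqr_ge0//.
      rewrite normrM; apply: le_trans h; rewrite ler_piMl//.
      by rewrite ler_norml sin_geN1 sin_le1.
    by split; exact: aux.
move=> h0.
have := RintegralB measurableT i1 (ixsin t).
rewrite {1}/Rintegral h0 /= (RintegralZl _ measurableT (icos t)) => /eqP.
by rewrite eq_sym subr_eq0 => /eqP ->.
Qed.

Let F t : R := \int[leb]_x (cos (t * x) * phi x).

Let derF (t : R) : is_derive t 1 F (- (t * s ^+ 2) * F t).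
Proof.
pose f (t x : R) := cos (t * x) * phi x.
have der u y : is_derive u (1:R) (f ^~ y) (- (y * sin (u * y) * phi y)).
  have -> : f ^~ y = (cos \o (y \*: (@id R))) * cst (phi y).
    by apply/funext => v; rewrite /f !fctE /GRing.scale /= [v * y]mulrC.
  apply: is_derive_eq; rewrite /GRing.scale /= [u * y]mulrC; ring.
(* Dominating function for the derivative in u, since |y sin(u y)| <= |y| <= 1 + y^2 for every u. *)
pose G (x : R) : R := (1 + x ^+ 2) * phi x.
have iG : leb.-integrable setT (EFin \o G).
  apply: (@integrable_poly2_normal_pdf _ 0 s s0 _ 1 1) => //.
    by apply: measurable_funD => //; exact: measurable_funX.
  by move=> x; rewrite subr0 mul1r ger0_norm// addr_ge0// sqr_ge0.
have G0 x : 0 <= G x by rewrite mulr_ge0 ?normal_pdf_ge0// addr_ge0// sqr_ge0.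
have d1 u y : partial1of2 f u y = - (y * sin (u * y) * phi y).
  by rewrite partial1of2E; exact: derive_val.
have Gub u y : `|partial1of2 f u y| <= G y.
  rewrite d1 normrN normrM (ger0_norm (normal_pdf_ge0 _ _ _)).
  rewrite ler_wpM2r ?normal_pdf_ge0// normrM.
  have h1 : `|sin (u * y)| <= 1 by rewrite ler_norml sin_geN1 sin_le1.
  have h2 := normr_ge0 y.
  rewrite -(@real_normK _ y) ?num_real//.
  by have := normr_ge0 (sin (u * y)); nra.
have tI : `]t - 1, t + 1[%classic t.
  by rewrite /= in_itv /=; apply/andP; split; lra.
have intf u : `]t - 1, t + 1[%classic u -> leb.-integrable setT (EFin \o f u).
  by move=> _; exact: icos.
have dd u y : `]t - 1, t + 1[%classic u -> [set: R] y -> derivable (f ^~ y) u 1.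
  by move=> _ _; exact: ex_derive.
have e1 := @differentiation_under_integral R _ _ leb f setT measurableT t
  (t - 1) (t + 1) tI intf dd G G0 iG (fun u y _ _ => Gub u y).
have e2 := @derivable_under_integral R _ _ leb f setT measurableT t
  (t - 1) (t + 1) tI intf dd G G0 iG (fun u y _ _ => Gub u y).
apply: (DeriveDef (e2 : derivable F t 1)).
rewrite -derive1E e1 /=.
under eq_Rintegral do rewrite d1.
have -> : \int[leb]_y - (y * sin (t * y) * phi y) = - \int[leb]_y (y * sin (t * y) * phi y).
  under eq_Rintegral do rewrite -mulN1r.
  by rewrite (RintegralZl _ measurableT (ixsin t)) mulN1r.
by rewrite normal_sin_by_parts mulNr.
Qed.

(** The product exp(s^2 t^2 / 2) F(t) has zero derivative, and F(0) = 1. *)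
Lemma normal_charfun (t : R) :
  \int[leb]_x (cos (t * x) * phi x) = expR (- (s ^+ 2 * t ^+ 2 / 2)).
Proof.
pose h (t : R) := expR (s ^+ 2 * t ^+ 2 / 2) * F t.
have dh u : is_derive u (1:R) h 0.
  have d1 := derF u.
  have -> : h = (expR \o ((s ^+ 2 / 2) \*: (fun t => t ^+ 2))) * F.
    by apply/funext => v; rewrite /h /= mulrAC.
  apply: is_derive_eq; rewrite /GRing.scale /= ?mulr1; by field.
have h0 : h t = h 0 by exact: (@is_derive_0_is_cst _ h t 0 dh).
have F0 : F 0 = 1.
  rewrite /F; under eq_Rintegral do rewrite mul0r cos0 mul1r.
  by rewrite /Rintegral integral_normal_pdf.
move: h0; rewrite /h F0 expr0n mulr0 mul0r expR0 mul1r => h0.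
rewrite -/(F t) expRN.
apply: (mulfI (lt0r_neq0 (expR_gt0 (s ^+ 2 * t ^+ 2 / 2)))).
by rewrite h0 mulfV// gt_eqF ?expR_gt0.
Qed.

End normal_charfun.

(** * Gaussian linear forms *)

Section integral_law.
Context d1 d2 (T1 : measurableType d1) (T2 : measurableType d2) (R : realType).
Variables (P : {measure set T1 -> \bar R}) (nu : {measure set T2 -> \bar R}).
Variable (Y : T1 -> T2).
Hypothesis mY : measurable_fun setT Y.
Hypothesis nuE : forall A, measurable A -> P (Y @^-1` A) = nu A.

Let Yf : {mfun T1 >-> T2} := HB.pack Y (isMeasurableFun.Build _ _ _ _ Y mY).

(** The measure [nu] only has to agree with the law of [Y] on measurable sets, so it may be a Dirac
    mass, a normal law, a product measure or a Lebesgue measure. *)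
Lemma ge0_integral_law (g : T2 -> \bar R) :
  measurable_fun setT g -> (forall x, 0 <= g x)%E ->
  (\int[P]_w g (Y w) = \int[nu]_x g x)%E.
Proof.
move=> mg g0; rewrite -(@eq_measure_integral _ _ _ setT nu (pushforward P Yf)).
  by rewrite [RHS]ge0_integral_pushforward// => y _; exact: g0.
by move=> A mA _; exact: nuE.
Qed.

Lemma integral_law (g : T2 -> R) :
  measurable_fun setT g -> P.-integrable setT (fun w => (g (Y w))%:E) ->
  (\int[P]_w (g (Y w))%:E = \int[nu]_x (g x)%:E)%E.
Proof.
move=> mg ig; rewrite -(@eq_measure_integral _ _ _ setT nu (pushforward P Yf)).
  by rewrite (integral_pushforward mY)//; exact/measurable_EFinP.
by move=> A mA _; exact: nuE.
Qed.

Lemma integrable_law (g : T2 -> R) :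
  measurable_fun setT g -> P.-integrable setT (fun w => (g (Y w))%:E) <->
  nu.-integrable setT (EFin \o g).
Proof.
move=> mg; have mEg : measurable_fun setT (EFin \o g) by exact/measurable_EFinP.
have E := @ge0_integral_law (fun x => `|(g x)%:E|%E)
  (measurableT_comp (@abse_measurable _ _) mEg) (fun x => abse_ge0 _).
split=> /integrableP[_ h]; apply/integrableP; split => //.
- by rewrite -[ltLHS]E.
- exact: (measurableT_comp mEg).
- by rewrite [ltLHS]E.
Qed.

End integral_law.

Section gaussian_law_facts.
Context d (T : measurableType d) (R : realType) (P : probability T R).
Notation leb := (@lebesgue_measure R).

Section one_variable.
Variables (Y : T -> R) (m s : R).
Hypothesis mY : measurable_fun setT Y.
Hypothesis lawY : forall V : set R, measurable V -> P (Y @^-1` V) = gaussian_law m s V.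

(** A single statement for degenerate and nondegenerate laws: each of them is a measure [nu] to
    which the transfer by law applies. Quadratic growth is allowed so that means and variances are
    covered. *)
Lemma gaussian_law_integral (f : R -> R) (a b : R) :
  measurable_fun setT f -> (forall x, `|f x| <= a + b * (x - m) ^+ 2) ->
  0 <= b ->
  P.-integrable setT (fun w => (f (Y w))%:E) /\
  (\int[P]_w (f (Y w))%:E =
    if (s == 0)%R then (f m)%:E else \int[leb]_x (f x * normal_pdf m s x)%:E)%E.
Proof.
move=> mf fb b0.
have mEf : measurable_fun setT (EFin \o f) by exact/measurable_EFinP.
have [nu [nuE [intnu nuI]]] : exists nu : {measure set (measurableTypeR R) -> \bar R},
    [/\ forall A, measurable A -> P (Y @^-1` A) = nu A,
     nu.-integrable setT (EFin \o f) &
     (\int[nu]_x (f x)%:E = if (s == 0)%R then (f m)%:E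
      else \int[leb]_x (f x * normal_pdf m s x)%:E)%E].
  have [s0|s0] := eqVneq s 0; last first.
    exists [the measure _ _ of normal_prob m s]; split.
    - by move=> A mA; rewrite lawY// /gaussian_law (negbTE s0).
    - by have [] := integral_normal_prob s0 mf fb b0.
    - by have [] := integral_normal_prob s0 mf fb b0.
  exists [the measure _ _ of @dirac _ (measurableTypeR R) m R]; split.
  - by move=> A mA; rewrite lawY// /gaussian_law s0 eqxx.
  - apply/integrableP; split => //.
    rewrite integral_dirac//; last exact: measurableT_comp.
    by rewrite diracT mul1e /= ltry.
  - by rewrite integral_dirac// diracT mul1e.
have intP : P.-integrable setT (fun w => (f (Y w))%:E).
  exact: ((@integrable_law _ _ _ _ _ P nu Y mY nuE f mf).2 intnu).
by split => //; rewrite (@integral_law _ _ _ _ _ P nu Y mY nuE f mf intP).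
Qed.

Lemma gaussian_law_mean :
  P.-integrable setT (fun w => (Y w)%:E) /\ (\int[P]_w (Y w)%:E = m%:E)%E.
Proof.
have hb x : `|x| <= (`|m| + 1) + 1 * (x - m) ^+ 2.
  rewrite mul1r; have := ler_normD (x - m) m; rewrite subrK => h.
  have h2 : `|x - m| <= 1 + (x - m) ^+ 2.
    rewrite -(@real_normK _ (x - m)) ?num_real//.
    by have := normr_ge0 (x - m); nra.
  lra.
have [i ->] := @gaussian_law_integral id _ _ (@measurable_id _ _ _) hb ler01.
split => //; case: ifPn => // s0.
have i1 : leb.-integrable setT (fun x => ((x - m) * normal_pdf m s x)%:E).
  apply: (@integrable_poly2_normal_pdf _ m s s0 _ 1 1) => //.
  - exact: measurable_funB.
  - move=> x; rewrite mul1r -real_normK ?num_real//; nra.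
have i2 : leb.-integrable setT (fun x => (m%:E * (normal_pdf m s x)%:E)%E).
  by apply: integrableZl => //; exact: integrable_normal_pdf.
transitivity (\int[leb]_x (((x - m) * normal_pdf m s x)%:E +
    m%:E * (normal_pdf m s x)%:E))%E.
  by apply: eq_integral => x _; rewrite -EFinM -EFinD; congr (_%:E); rewrite -mulrDl subrK.
rewrite integralD// normal_pdf_moment1// add0e integralZl//; last first.
  exact: integrable_normal_pdf.
by rewrite integral_normal_pdf mule1.
Qed.

Lemma gaussian_law_var :
  P.-integrable setT (fun w => ((Y w - m) ^+ 2)%:E) /\
  (\int[P]_w ((Y w - m) ^+ 2)%:E = (s ^+ 2)%:E)%E.
Proof.
have hb x : `|(x - m) ^+ 2| <= 0 + 1 * (x - m) ^+ 2.
  by rewrite add0r mul1r ger0_norm// sqr_ge0.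
have mf : measurable_fun setT (fun x : R => (x - m) ^+ 2).
  by apply: measurable_funX; exact: measurable_funB.
have [i ->] := gaussian_law_integral mf hb ler01.
split => //; case: ifPn => [/eqP ->|s0]; last exact: normal_pdf_moment2.
by rewrite subrr expr0n.
Qed.

End one_variable.

Lemma gaussian_law_cos (Y : T -> R) (s t : R) :
  measurable_fun setT Y ->
  (forall V, measurable V -> P (Y @^-1` V) = gaussian_law 0 s V) ->
  (\int[P]_w (cos (t * Y w))%:E = (expR (- (s ^+ 2 * t ^+ 2 / 2)))%:E)%E.
Proof.
move=> mY lawY.
have hb x : `|cos (t * x)| <= 1 + 0 * (x - 0) ^+ 2 :> R.
  by rewrite mul0r addr0 ler_norml cos_geN1 cos_le1.
have mf : measurable_fun setT (fun x : R => cos (t * x)).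
  apply: continuous_measurable_fun => x.
  apply: (cvg_comp (fun x => t * x) cos); last exact: continuous_cos.
  by apply: cvgM; [exact: cvg_cst|exact: cvg_id].
have [i ->] := gaussian_law_integral mY lawY mf hb (lexx 0).
case: ifPn => [/eqP ->|s0].
  by rewrite mulr0 cos0 expr0n !mul0r oppr0 expR0.
rewrite -normal_charfun// /Rintegral fineK//.
apply: integrable_fin_num => //.
exact: (@integrable_poly2_normal_pdf _ 0 s s0 _ 1 0).
Qed.

End gaussian_law_facts.

Section gaussian_linear_forms.
Context d (T : measurableType d) (R : realType) (P : probability T R).
Variables (I : finType) (X : I -> {RV P >-> R}) (K : 'M[R]_#|I|).
Hypothesis gX : gaussian_vector X (fun=> 0) K.
Hypothesis dK : is_diag_mx K.

Definition linear_form (t : I -> R) (w : T) : R := \sum_a t a * X a w.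
(** For diagonal [K] this is the covariance of the two linear forms, by [linear_form_mul];
    off-diagonal terms would vanish. *)
Definition form_cov (t u : I -> R) : R :=
  \sum_a t a * u a * K (enum_rank a) (enum_rank a).

Lemma measurable_linear_form t : measurable_fun setT (linear_form t).
Proof.
rewrite /linear_form; apply: measurable_sum => a.
by apply: measurable_funM => //; exact: measurable_cst.
Qed.

Let deltaE a : linear_form (fun b => (b == a)%:R) = X a.
Proof.
apply/funext => w; rewrite /linear_form (bigD1 a)//= eqxx mul1r big1 ?addr0//.
by move=> b /negbTE ->; rewrite mul0r.
Qed.

Let lawX a : exists mu s : R, forall V : set R, measurable V ->
  P (X a @^-1` V) = gaussian_law mu s V.
Proof. by have [+ _ _] := gX => /(_ (fun b => (b == a)%:R)); rewrite -deltaE. Qed.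

Lemma integrable_gaussian a : P.-integrable setT (EFin \o X a).
Proof.
have [mu [s h]] := lawX a.
by have [] := gaussian_law_mean (measurable_funPT (X a)) h.
Qed.

Lemma mean_gaussian a : (\int[P]_w (X a w)%:E = 0)%E.
Proof. by have [_ + _] := gX => /(_ a); rewrite unlock. Qed.

Let integrable_sqr a : P.-integrable setT (fun w => ((X a w) ^+ 2)%:E).
Proof.
have [mu [s h]] := lawX a.
have [_ hm] := gaussian_law_mean (measurable_funPT (X a)) h.
have [i _] := gaussian_law_var (measurable_funPT (X a)) h.
have [m0] : mu = 0 by apply/eqP; rewrite -eqe -hm mean_gaussian.
by move: i; rewrite m0; under eq_fun do rewrite subr0.
Qed.

Lemma integrable_gaussian_mul a b : P.-integrable setT (fun w => (X a w * X b w)%:E).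
Proof.
apply: (@le_integrable _ _ _ P setT measurableT _
   (fun w => ((X a w) ^+ 2)%:E + ((X b w) ^+ 2)%:E)%E).
- by apply/measurable_EFinP; exact: measurable_funM.
- move=> w _; rewrite -EFinD !abse_EFin lee_fin normrM.
  apply: le_trans (ler_norm _).
  rewrite -(@real_normK _ (X a w)) ?num_real// -(@real_normK _ (X b w)) ?num_real//.
  have := normr_ge0 (X a w); have := normr_ge0 (X b w); nra.
- exact: integrableD.
Qed.

Lemma integral_gaussian_mul a b : (\int[P]_w (X a w * X b w)%:E =
  (K (enum_rank a) (enum_rank b))%:E)%E.
Proof.
have [_ hm /(_ a b) <-] := gX.
rewrite unlock !hm unlock /=; apply: eq_integral => w _ /=.
by rewrite !fctE /= !subr0.
Qed.

Lemma linear_form_mul t u :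
  P.-integrable setT (fun w => (linear_form t w * linear_form u w)%:E) /\
  (\int[P]_w (linear_form t w * linear_form u w)%:E = (form_cov t u)%:E)%E.
Proof.
have E w : ((linear_form t w * linear_form u w)%:E =
    \sum_a \sum_b (t a * u b)%:E * (X a w * X b w)%:E)%E.
  rewrite /linear_form mulr_suml -sumEFin; apply: eq_bigr => a _.
  rewrite mulr_sumr -sumEFin; apply: eq_bigr => b _.
  by rewrite -EFinM; congr (_%:E); ring.
have iab a b : P.-integrable setT (fun w => (t a * u b)%:E * (X a w * X b w)%:E)%E.
  by apply: integrableZl => //; exact: integrable_gaussian_mul.
have ia a : P.-integrable setT (fun w => \sum_b (t a * u b)%:E * (X a w * X b w)%:E)%E.
  by apply: integrable_sum => // b _; exact: iab.
under eq_fun do rewrite E.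
split; first by apply: integrable_sum => // a _; exact: ia.
rewrite integral_sum//= /form_cov -sumEFin; apply: eq_bigr => a _.
rewrite integral_sum//= (bigD1 a)//= big1 ?adde0.
  by rewrite integralZl ?integral_gaussian_mul//; exact: integrable_gaussian_mul.
move=> b ba; rewrite integralZl ?integral_gaussian_mul//; last first.
  exact: integrable_gaussian_mul.
move/is_diag_mxP : dK => ->; first by rewrite mule0.
by rewrite (inj_eq val_inj) (inj_eq enum_rank_inj) eq_sym.
Qed.

(** [gaussian_vector] merely asserts that some normal law exists. Its mean and variance are
    recovered by computing the first two moments; they determine s only up to sign, hence the
    conclusion on [s ^+ 2]. *)
Lemma linear_form_law t : exists2 s : R, s ^+ 2 = form_cov t t &
  forall V : set R, measurable V ->
    P (linear_form t @^-1` V) = gaussian_law 0 s V.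
Proof.
have [+ _ _] := gX => /(_ t) [mu [s h]].
have mt := measurable_linear_form t.
have [i hm] := gaussian_law_mean mt h.
have [_ hv] := gaussian_law_var mt h.
have mu0 : mu = 0.
  apply/eqP; rewrite -eqe -hm /linear_form.
  under eq_integral do rewrite -sumEFin.
  rewrite integral_sum//=; last first.
    by move=> a; under eq_fun do rewrite EFinM; apply: integrableZl => //;
      exact: integrable_gaussian.
  rewrite big1// => a _; under eq_integral do rewrite EFinM.
  by rewrite integralZl ?mean_gaussian ?mule0//; exact: integrable_gaussian.
rewrite mu0 in h hv; exists s => //.
have [_] := linear_form_mul t t.
under eq_integral do rewrite -[linear_form t _]subr0 -expr2.
by rewrite hv => -[].
Qed.

(** The free phase [th] makes real cosines carry the information of the complex characteristic
    function: sines are cosines with a shifted phase. *)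
Lemma linear_form_cos t th : (\int[P]_w (cos (linear_form t w + th))%:E =
  (cos th * expR (- (form_cov t t / 2)))%:E)%E.
Proof.
have [s sE h] := linear_form_law t.
have mt := measurable_linear_form t.
have bdd_int (f : R -> R) : continuous f -> (forall x, `|f x| <= 1) ->
    P.-integrable setT (fun w => (f (linear_form t w))%:E).
  move=> cf f1.
  have hb x : `|f x| <= 1 + 0 * (x - 0) ^+ 2 by rewrite mul0r addr0.
  by have [] := gaussian_law_integral mt h (continuous_measurable_fun cf) hb (lexx 0).
have csin := @continuous_sin R; have ccos := @continuous_cos R.
have sin1 x : `|sin x| <= 1 :> R by rewrite ler_norml sin_geN1 sin_le1.
have cos1 x : `|cos x| <= 1 :> R by rewrite ler_norml cos_geN1 cos_le1.
(* [- linear_form t] has the same law, so the sine transform vanishes. *)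
have sin0 : (\int[P]_w (sin (linear_form t w))%:E = 0)%E.
  pose u a := - t a.
  have uE w : linear_form u w = - linear_form t w.
    by rewrite /linear_form -sumrN; apply: eq_bigr => a _; rewrite mulNr.
  have [s' sE' h'] := linear_form_law u.
  have ss : s' ^+ 2 = s ^+ 2.
    by rewrite sE sE'; apply: eq_bigr => a _; rewrite mulrNN.
  have s0 : (s' == 0) = (s == 0) by rewrite -(sqrf_eq0 s') -(sqrf_eq0 s) ss.
  have hb x : `|sin x| <= 1 + 0 * (x - 0) ^+ 2 :> R by rewrite mul0r addr0.
  have [i1 e1] := gaussian_law_integral mt h (continuous_measurable_fun csin) hb (lexx 0).
  have [i2 e2] := gaussian_law_integral (measurable_linear_form u) h'
    (continuous_measurable_fun csin) hb (lexx 0).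
  have pdfE : normal_pdf 0 s' = normal_pdf 0 s.
    by rewrite /normal_pdf s0 /normal_peak /normal_fun ss.
  have e12 : (\int[P]_w (sin (linear_form u w))%:E =
              \int[P]_w (sin (linear_form t w))%:E)%E.
    by apply: (etrans e2); apply: (etrans _ (esym e1)); rewrite s0 pdfE.
  move: e12; under eq_integral do rewrite uE sinN EFinN.
  rewrite integralN; last exact: integrable_add_def.
  have /fin_numPlt := integrable_fin_num measurableT i1.
  case: (\int[P]_w (sin (linear_form t w))%:E)%E => //= r _ [] rr.
  by congr (_%:E); lra.
transitivity (\int[P]_w ((cos th)%:E * (cos (linear_form t w))%:E -
                        (sin th)%:E * (sin (linear_form t w))%:E))%E.
  by apply: eq_integral => w _; rewrite -!EFinM -EFinB cosD mulrC [sin _ * _]mulrC.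
rewrite integralB//=; last 2 first.
- by apply: integrableZl => //; exact: bdd_int.
- by apply: integrableZl => //; exact: bdd_int.
rewrite !integralZl//; [|exact: bdd_int|exact: bdd_int].
rewrite sin0 mule0 sube0 EFinM; congr (_ * _)%E.
have := gaussian_law_cos 1 mt h.
under [X in X = _ -> _]eq_integral do rewrite mul1r.
by rewrite expr1n mulr1 sE.
Qed.

Lemma linear_form_std t : form_cov t t = 1 ->
  forall V : set R, measurable V ->
    P (linear_form t @^-1` V) = normal_prob 0 1 V.
Proof.
move=> t1 V mV; have [s sE h] := linear_form_law t.
have s0 : s == 0 = false.
  by rewrite -(sqrf_eq0 s) sE t1 oner_eq0.
rewrite h// /gaussian_law s0 /normal_prob; apply: eq_integral => x _.
by rewrite /normal_pdf s0 oner_eq0 /normal_peak /normal_fun sE t1 expr1n.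
Qed.

End gaussian_linear_forms.

(** * Uncorrelated Gaussian linear forms are independent *)

Section sign_iteration.
Context {R : realType}.

(** An odd polynomial with attracting fixed points 1 and -1 and repelling fixed point 0. Its
    iterates are polynomials that converge to the sign on [-1, 1] and stay bounded by 1 there;
    applied to a sine, they lead from trigonometric functions to indicators. *)
Let q (y : R) := (3 * y - y ^+ 3) / 2.

Lemma iter_sign_poly (k : nat) :
  exists p : {poly R}, forall y, p.[y] = iter k q y.
Proof.
elim: k => [|k [p pE]]; first by exists 'X => y; rewrite hornerX.
exists (2^-1 *: (3 *: p - p ^+ 3)) => y.
by rewrite !hornerE pE /= /q; field.
Qed.

(** Since 1 - q z = (1 - z) (1 - z (1 + z) / 2), and the iterates z stay in [y, 1], each step
    shrinks the distance to 1 by a factor of at most 1 - y / 2. *)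
Lemma iter_sign_pos (k : nat) (y : R) : 0 < y <= 1 ->
  y <= iter k q y <= 1 /\ 1 - iter k q y <= (1 - y / 2) ^+ k.
Proof.
move=> /andP[y0 y1]; elim: k => [|k [/andP[h1 h2] h3]] /=.
  by rewrite expr0 lexx y1; split => //; lra.
set z := iter k q y in h1 h2 h3 *.
have z0 : 0 < z by lra.
have a1 : z <= q z.
  have -> : q z = z + z * ((1 - z) * (1 + z)) / 2 by rewrite /q; field.
  have : 0 <= z * ((1 - z) * (1 + z)) by rewrite !mulr_ge0//; lra.
  lra.
have e : 1 - q z = (1 - z) * (1 - z * (1 + z) / 2) by rewrite /q; field.
have a2 : q z <= 1.
  by rewrite -subr_ge0 e; apply: mulr_ge0; nra.
split; first by apply/andP; split => //; lra.
rewrite e exprSr ler_pM//; nra.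
Qed.

Lemma iter_sign_odd (k : nat) (y : R) : iter k q (- y) = - iter k q y.
Proof. by elim: k => //= k ->; rewrite /q; field. Qed.

Lemma iter_sign_le1 (k : nat) (y : R) : `|y| <= 1 -> `|iter k q y| <= 1.
Proof.
move=> hy; have [y0|y0|->] := ltgtP y 0.
- rewrite -[y]opprK iter_sign_odd normrN.
  have [|/andP[h1 h2] _] := @iter_sign_pos k (- y).
    by rewrite oppr_gt0 y0 -(ltr0_norm y0).
  by rewrite ger0_norm//; lra.
- have [|/andP[h1 h2] _] := @iter_sign_pos k y.
    by rewrite y0 -(gtr0_norm y0).
  by rewrite ger0_norm//; lra.
- suff -> : iter k q 0 = 0 by rewrite normr0.
  by elim: k => //= k ->; rewrite /q expr0n mulr0 subr0 mul0r.
Qed.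

Lemma iter_sign_cvg (y : R) : `|y| <= 1 -> iter k q y @[k --> \oo] --> Num.sg y.
Proof.
have pos z : 0 < z <= 1 -> iter k q z @[k --> \oo] --> (1 : R).
  move=> hz; have h k := iter_sign_pos k hz.
  have cv : (fun k => (1 - z / 2) ^+ k) @ \oo --> (0 : R).
    apply: cvg_expr; have /andP[? ?] := hz.
    by rewrite ger0_norm; lra.
  apply/subr_cvg0; apply: norm_cvg0.
  apply: (squeeze_cvgr _ (cvg_cst 0) cv).
  apply: nearW => k; rewrite normr_ge0 /= distrC ger0_norm.
    exact: (h k).2.
  by have [/andP[]] := h k; lra.
move=> hy; have [y0|y0|->] := ltgtP y 0.
- rewrite ltr0_sg//.
  rewrite (_ : (fun k => iter k q y) = (fun k => - iter k q (- y))); last first.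
    by apply/funext => k; rewrite -iter_sign_odd opprK.
  apply: cvgN; apply: pos.
  by rewrite oppr_gt0 y0 -(ltr0_norm y0).
- by rewrite gtr0_sg//; apply: pos; rewrite y0 -(gtr0_norm y0).
- rewrite sgr0; apply: cvg_near_cst; apply: nearW => k.
  by elim: k => //= k ->; rewrite /q expr0n mulr0 subr0 mul0r.
Qed.

End sign_iteration.

Lemma indic_bigsetU_trivIset (T : Type) (R : realType) (F : (set T)^nat) k x :
  trivIset setT F ->
  \1_(\big[setU/set0]_(i < k) F i) x = \sum_(i < k) \1_(F i) x :> R.
Proof.
move=> tF; elim: k => [|k IH]; first by rewrite !big_ord0 indic0.
rewrite !big_ord_recr /= -IH !indicE in_setU.
have [/set_mem Fk|_] := boolP (x \in F k); last by rewrite orbF addr0.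
rewrite orbT memNset ?add0r// -bigcup_mkord => -[i /= ik Fi].
have eik : i != k by rewrite ltn_eqF.
move/trivIsetP : tF => /(_ i k Logic.I Logic.I eik) /seteqP[/(_ x)] h _.
exact: h.
Qed.

(** * Uniqueness of trigonometric transforms of signed measures *)

Section trigonometric_uniqueness.
Context d (T : measurableType d) (R : realType) (P : probability T R).
Variables (G W : T -> R) (M : R).
Hypothesis mG : measurable_fun setT G.
Hypothesis GM : forall w, `|G w| <= M.
Hypothesis mW : measurable_fun setT W.

Let bint (f : T -> R) (K : R) : measurable_fun setT f -> (forall w, `|f w| <= K) ->
  P.-integrable setT (fun w => (f w)%:E).
Proof.
move=> mf fK; apply: (@le_integrable _ _ _ P setT measurableT _ (cst K%:E)).
- exact/measurable_EFinP.
- by move=> w _; rewrite /= lee_fin (le_trans (fK w))// ler_norm.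
- exact: finite_measure_integrable_cst.
Qed.

(** The class of bounded f for which G f(W) is still orthogonal to every cosine of W. Keeping the
    cosines in the condition, and not only the integral of G f(W), is what makes the class stable
    under multiplication by sines, hence under polynomials in a sine. *)
Let V (f : R -> R) : Prop := [/\ measurable_fun setT f,
  exists K : R, forall x, `|f x| <= K &
  forall s th, (\int[P]_w (G w * f (W w) * cos (s * W w + th))%:E = 0)%E].

Let mcosW s th : measurable_fun setT (fun w => cos (s * W w + th)).
Proof.
apply: (measurableT_comp (continuous_measurable_fun (@continuous_cos R))).
by apply: measurable_funD => //; apply: measurable_funM => //; exact: measurable_cst.
Qed.

Let cos1 (x : R) : `|cos x| <= 1. Proof. by rewrite ler_norml cos_geN1 cos_le1. Qed.
Let sin1 (x : R) : `|sin x| <= 1. Proof. by rewrite ler_norml sin_geN1 sin_le1. Qed.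

Let Vint f s th : V f ->
  P.-integrable setT (fun w => (G w * f (W w) * cos (s * W w + th))%:E).
Proof.
move=> [mf [K fK] _]; apply: (@bint _ (M * K)).
  apply: measurable_funM => //; apply: measurable_funM => //.
  exact: measurableT_comp.
move=> w; rewrite !normrM -[leRHS]mulr1.
by rewrite !ler_pM ?mulr_ge0.
Qed.

Let Vlin f g c : V f -> V g -> V (fun x => c * f x + g x).
Proof.
move=> Vf Vg; have [mf [K fK] f0] := Vf; have [mg [L gL] g0] := Vg; split.
- by apply: measurable_funD => //; apply: measurable_funM => //; exact: measurable_cst.
- exists (`|c| * K + L) => x; rewrite (le_trans (ler_normD _ _))// lerD// normrM.
  by rewrite ler_wpM2l.
- move=> s th.
  transitivity (\int[P]_w (c%:E * (G w * f (W w) * cos (s * W w + th))%:E +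
    (G w * g (W w) * cos (s * W w + th))%:E))%E.
    by apply: eq_integral => w _; rewrite -EFinM -EFinD; congr (_%:E); ring.
  rewrite integralD//=; [|by apply: integrableZl => //; exact: Vint|exact: Vint].
  by rewrite integralZl//; [rewrite f0 g0 mule0 adde0|exact: Vint].
Qed.

Let Vsin f l b : V f -> V (fun x => f x * sin ((x - b) * l)).
Proof.
move=> Vf; have [mf [K fK] f0] := Vf; split.
- apply: measurable_funM => //.
  apply: (measurableT_comp (continuous_measurable_fun (@continuous_sin R))).
  by apply: measurable_funM => //; exact: measurable_funB.
- exists K => x; rewrite normrM -[leRHS]mulr1 ler_pM//.
- move=> s th.
  (* Product to sum; the phase - pi / 2 turns the resulting sines back into cosines, to which the
     hypothesis on f applies. *)
  transitivity (\int[P]_w ((2^-1)%:E *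
      ((G w * f (W w) * cos ((l + s) * W w + (th - b * l - pi / 2)))%:E +
       (G w * f (W w) * cos ((l - s) * W w + (- th - b * l - pi / 2)))%:E)))%E.
    apply: eq_integral => w _; rewrite -EFinD -EFinM; congr (_%:E).
    have e1 : cos ((l + s) * W w + (th - b * l - pi / 2)) =
              sin ((W w - b) * l + (s * W w + th)).
      have -> : (l + s) * W w + (th - b * l - pi / 2) =
          (W w - b) * l + (s * W w + th) - pi / 2 by ring.
      by rewrite cosB cos_pihalf sin_pihalf mulr0 add0r mulr1.
    have e2 : cos ((l - s) * W w + (- th - b * l - pi / 2)) =
              sin ((W w - b) * l - (s * W w + th)).
      have -> : (l - s) * W w + (- th - b * l - pi / 2) =
          (W w - b) * l - (s * W w + th) - pi / 2 by ring.
      by rewrite cosB cos_pihalf sin_pihalf mulr0 add0r mulr1.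
    by rewrite e1 e2 sinD sinB; field.
  rewrite integralZl//; last by apply: integrableD => //; exact: Vint.
  by rewrite integralD//=; [rewrite !f0 adde0 mule0|exact: Vint|exact: Vint].
Qed.

Hypothesis G0 : forall s th, (\int[P]_w (G w * cos (s * W w + th))%:E = 0)%E.

Let Vcst c : V (fun=> c).
Proof.
split.
- exact: measurable_cst.
- by exists `|c|.
- move=> s th; transitivity (\int[P]_w (c%:E * (G w * cos (s * W w + th))%:E))%E.
    by apply: eq_integral => w _; rewrite -EFinM; congr (_%:E); ring.
  rewrite integralZl ?G0 ?mule0//.
  apply: (@bint _ M); first exact: measurable_funM.
  by move=> w; rewrite normrM -[leRHS]mulr1 ler_pM.
Qed.

Let Vpoly (p : {poly R}) l b : V (fun x => p.[sin ((x - b) * l)]).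
Proof.
elim/poly_ind: p => [|p c IH].
  by under eq_fun do rewrite horner0; exact: Vcst.
under eq_fun do rewrite !hornerE.
have := Vlin 1 (Vsin l b IH) (Vcst c).
by under eq_fun do rewrite mul1r.
Qed.

Let V0 f : V f -> (\int[P]_w (G w * f (W w))%:E = 0)%E.
Proof.
move=> [_ _ /(_ 0 0)] <-; apply: eq_integral => w _.
by rewrite mul0r addr0 cos0 mulr1.
Qed.

Let dct (f_ : nat -> R -> R) (f : R -> R) : (forall k, measurable_fun setT (f_ k)) ->
  measurable_fun setT f ->
  (forall k x, `|f_ k x| <= 1) -> (forall x, f_ k x @[k --> \oo] --> f x) ->
  (forall k, \int[P]_w (G w * f_ k (W w))%:E = 0)%E ->
  (\int[P]_w (G w * f (W w))%:E = 0)%E.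
Proof.
move=> mf_ mf f1 ff f0.
have h : (\int[P]_w (G w * f_ k (W w))%:E)%E @[k --> \oo] -->
    (\int[P]_w (G w * f (W w))%:E)%E.
  apply: (@dominated_convergence_real _ _ _ P _ _ (fun=> M)).
  - move=> k; apply: measurable_funM => //; exact: measurableT_comp.
  - by apply: measurable_funM => //; exact: measurableT_comp.
  - by move=> w; apply: cvgM; [exact: cvg_cst|exact: ff].
  - exact: finite_measure_integrable_cst.
  - by move=> k w; rewrite normrM -[leRHS]mulr1 ler_pM.
have h' : (\int[P]_w (G w * f_ k (W w))%:E)%E @[k --> \oo] --> 0%E.
  by under eq_fun do rewrite f0; exact: cvg_cst.
exact: (cvg_unique _ h h').
Qed.

Let msg : measurable_fun setT (@Num.sg R).
Proof.
rewrite (_ : Num.sg = fun x => \1_(`]0, +oo[%classic) x - \1_(`]-oo, 0[%classic) x).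
  apply: measurable_funB; apply: measurable_indic; exact: measurable_itv.
apply/funext => x; rewrite !indicE !mem_setE !in_itv /= andbT.
by have [h|h|->] := ltgtP x 0; rewrite ?(ltr0_sg h) ?(gtr0_sg h) ?sgr0 /= ?subrr ?subr0 ?sub0r.
Qed.

Let mc (f g : R -> R) : measurable_fun setT f -> measurable_fun setT g ->
  measurable_fun setT (fun x => f (g x)).
Proof. exact: measurableT_comp. Qed.

Let msin : measurable_fun setT (@sin R).
Proof. by apply: continuous_measurable_fun; exact: continuous_sin. Qed.

Let maff (b l : R) : measurable_fun setT (fun x : R => (x - b) * l).
Proof. by apply: measurable_funM => //; exact: measurable_funB. Qed.

Let msgsin b l : measurable_fun setT (fun x : R => Num.sg (sin ((x - b) * l))).
Proof. by apply: (@mc Num.sg) => //; apply: (@mc sin). Qed.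

Let msgaff b : measurable_fun setT (fun x : R => Num.sg (x - b)).
Proof. by apply: (@mc Num.sg) => //; exact: measurable_funB. Qed.

(** The iterates of [q] at a sine are polynomials in that sine, so they lie in the class [V]; their
    limit is the sign. *)
Let sgn_sin l b : (\int[P]_w (G w * Num.sg (sin ((W w - b) * l)))%:E = 0)%E.
Proof.
pose q (y : R) := (3 * y - y ^+ 3) / 2.
have mpk k : measurable_fun setT (fun x : R => iter k q (sin ((x - b) * l))).
  have [p pE] := @iter_sign_poly R k.
  have [mp _ _] := Vpoly p l b; move: mp.
  by under eq_fun do rewrite pE.
apply: (@dct (fun k x => iter k q (sin ((x - b) * l)))
  (fun x => Num.sg (sin ((x - b) * l)))) => //.
- by move=> k x; exact: iter_sign_le1.
- by move=> x; exact: iter_sign_cvg.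
- move=> k; have [p pE] := @iter_sign_poly R k.
  have := V0 (Vpoly p l b).
  by under eq_integral do rewrite pE.
Qed.

Let normsg (x : R) : `|Num.sg x| <= 1.
Proof. by rewrite normr_sg; case: (x != 0); rewrite ?ler01. Qed.

(** Slowing the square wave down: the sign of sin((x - b) / (k + 1)) equals that of x - b as soon as
    |x - b| < (k + 1) pi. *)
Let sgn_lin b : (\int[P]_w (G w * Num.sg (W w - b))%:E = 0)%E.
Proof.
apply: (@dct (fun k x => Num.sg (sin ((x - b) * k.+1%:R^-1)))
  (fun x => Num.sg (x - b))) => //.
- move=> x; apply: cvg_near_cst.
  exists (Num.truncn (`|x - b| / pi)) => // k /= hk.
  have pp := pi_gt0 R.
  have k0 : 0 < k.+1%:R :> R by rewrite ltr0n.
  have hx : `|x - b| < k.+1%:R * pi.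
    rewrite -ltr_pdivrMr//; apply: lt_le_trans (truncnS_gt _) _.
    by rewrite ler_nat ltnS.
  have pos z : 0 < z -> z < k.+1%:R * pi -> Num.sg (sin (z / k.+1%:R)) = 1.
    move=> z0 zp; rewrite gtr0_sg// sin_gt0_pi// divr_gt0//.
    by rewrite ltr_pdivrMr// mulrC.
  have [h|h|->] := ltgtP (x - b) 0.
  + rewrite [RHS]ltr0_sg// -[x - b]opprK mulNr sinN sgrN pos ?oppr_gt0//.
    by rewrite -(ltr0_norm h).
  + by rewrite [RHS]gtr0_sg// pos// -(gtr0_norm h).
  + by rewrite mul0r sin0.
Qed.

Let int_itv b : (\int[P]_w (G w * \1_(`]-oo, b[%classic) (W w))%:E = 0)%E.
Proof.
have h : (\int[P]_w (G w * (1 - 2 * \1_(`]-oo, b[%classic) (W w)))%:E = 0)%E.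
  (* Approaching b from the left gives the value 1 at x = b, so the limit is exactly 1 - 2 times the
     indicator of the open half-line. *)
  apply: (@dct (fun k x => Num.sg (x - (b - k.+1%:R^-1)))
    (fun x => 1 - 2 * \1_(`]-oo, b[%classic) x)) => //.
  - by apply: measurable_funB => //; exact: measurable_funM.
  - move=> x; rewrite indicE mem_setE in_itv /=.
    have [xb|xb] := ltP x b; last first.
      rewrite mulr0 subr0; apply: cvg_near_cst; apply: nearW => k; rewrite gtr0_sg//.
      by rewrite subr_gt0 (lt_le_trans _ xb)// ltrBlDr ltrDl invr_gt0 ltr0n.
    rewrite mulr1; have -> : 1 - 2 = -1 :> R by lra.
    apply: cvg_near_cst.
    exists (Num.truncn (b - x)^-1) => // k /= hk.
    rewrite ltr0_sg// subr_lt0 ltrBrDr -ltrBrDl.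
    rewrite invf_plt ?posrE ?subr_gt0 ?ltr0n//.
    by apply: lt_le_trans (truncnS_gt _) _; rewrite ler_nat ltnS.
have iG : P.-integrable setT (fun w => (G w)%:E) by exact: bint GM.
have i1 : P.-integrable setT (fun w => (G w * \1_(`]-oo, b[%classic) (W w))%:E).
  apply: (@bint _ M).
    by apply: measurable_funM => //; apply: measurableT_comp.
  by move=> w; rewrite normrM -[leRHS]mulr1 ler_pM// indicE; case: (_ \in _);
    rewrite ?normr1 ?normr0.
have IG : (\int[P]_w (G w)%:E = 0)%E.
  rewrite -[RHS](G0 0 0); apply: eq_integral => w _.
  by rewrite mul0r addr0 cos0 mulr1.
move: h; have -> : (\int[P]_w (G w * (1 - 2 * \1_(`]-oo, b[%classic) (W w)))%:E =
    \int[P]_w ((G w)%:E - 2%:E * (G w * \1_(`]-oo, b[%classic) (W w))%:E))%E.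
  by apply: eq_integral => w _; rewrite -EFinM -EFinB; congr (_%:E); ring.
rewrite integralB//=; last exact: integrableZl.
rewrite integralZl// IG sub0e => /eqP; rewrite eqe_oppLR oppe0.
have /fin_numPlt := integrable_fin_num measurableT i1.
case: (\int[P]_w _)%E => //= r _; rewrite -EFinM eqe mulf_eq0.
by rewrite pnatr_eq0 /= => /eqP ->.
Qed.

(** Injectivity of the Fourier transform for the image under W of the signed measure with density G.
    The half-lines generate the Borel sets and are stable under intersection, so Dynkin's lemma
    extends the result for half-lines. *)
Lemma trig_integral_eq0 (B : set R) : measurable B ->
  (\int[P]_w (G w * \1_B (W w))%:E = 0)%E.
Proof.
pose Q (B : set R) := (\int[P]_w (G w * \1_B (W w))%:E = 0)%E.
have m1 A : measurable A -> measurable_fun setT (fun w => \1_A (W w) : R).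
  by move=> mA; apply: (@measurableT_comp _ _ _ _ _ _ (\1_A : R -> R)).
have n1 (A : set R) w : `|G w * \1_A (W w)| <= M.
  by rewrite normrM -[leRHS]mulr1 ler_pM// indicE; case: (_ \in _);
    rewrite ?normr1 ?normr0.
have i1 A : measurable A -> P.-integrable setT (fun w => (G w * \1_A (W w))%:E).
  by move=> mA; apply: (@bint _ M) => //; apply: measurable_funM => //; exact: m1.
have iG : P.-integrable setT (fun w => (G w)%:E) by exact: bint GM.
have IG : (\int[P]_w (G w)%:E = 0)%E.
  rewrite -[RHS](G0 0 0); apply: eq_integral => w _.
  by rewrite mul0r addr0 cos0 mulr1.
have E : @measurable _ (measurableTypeR R) =
  <<s [set A | exists x : R, A = `]-oo, x[%classic] >> := RGenInftyO.measurableE R.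
move=> mB; apply: (@dynkin_induction _ (measurableTypeR R)
  [set A | exists x : R, A = `]-oo, x[%classic] Q); last by rewrite -E.
- exact: E.
- move=> _ _ [x ->] [y ->]; exists (Num.min x y).
  by apply/seteqP; split => z /=; rewrite !in_itv /= lt_min => /andP.
- by rewrite /Q -[RHS]IG; apply: eq_integral => w _; rewrite indicE in_setT mulr1.
- by move=> _ [x ->]; exact: int_itv.
- move=> A mA QA; rewrite /Q.
  transitivity (\int[P]_w ((G w)%:E - (G w * \1_A (W w))%:E))%E.
    apply: eq_integral => w _; rewrite -EFinB; congr (_%:E).
    by rewrite !indicE in_setC; case: (_ \in A) => /=; ring.
  by rewrite integralB//=; [rewrite IG QA sube0|exact: i1].
- move=> F mF tF QF; rewrite /Q.
  have h : (\int[P]_w (G w * \1_(\big[setU/set0]_(i < k) F i) (W w))%:E)%E @[k --> \oo] -->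
      (\int[P]_w (G w * \1_(\bigcup_k F k) (W w))%:E)%E.
    apply: (@dominated_convergence_real _ _ _ P _ _ (fun=> M)) => //.
    + move=> k; apply: measurable_funM => //; apply: m1.
      by apply: bigsetU_measurable => i _; exact: mF.
    + apply: measurable_funM => //; apply: m1; apply: bigcup_measurable => i _; exact: mF.
    + move=> w; apply: cvgM; first exact: cvg_cst.
      apply: cvg_near_cst.
      have [[i _ Fi]|nF] := pselect ((\bigcup_k F k) (W w)).
        exists i.+1 => // k /= ik; rewrite !indicE !mem_set//; first by exists i.
        by rewrite -bigcup_mkord; exists i.
      apply: nearW => k; rewrite !indicE !memNset//.
      by rewrite -bigcup_mkord => -[i _ Fi]; apply: nF; exists i.
    + exact: finite_measure_integrable_cst.
  have h' : (\int[P]_w (G w * \1_(\big[setU/set0]_(i < k) F i) (W w))%:E)%E @[k --> \oo] --> 0%E.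
    rewrite (_ : (fun k => _) = fun=> 0%E); first exact: cvg_cst.
    apply/funext => k.
    transitivity (\int[P]_w (\sum_(i < k) (G w * \1_(F i) (W w))%:E))%E.
      apply: eq_integral => w _; rewrite sumEFin -mulr_sumr; congr (_ * _)%:E.
      by rewrite indic_bigsetU_trivIset.
    rewrite integral_sum//=; last by move=> i; exact: (i1 _ (mF i)).
    by rewrite big1// => i _; exact: QF.
  exact: (cvg_unique _ h h').
Qed.

End trigonometric_uniqueness.

Lemma bounded_integrable d (T : measurableType d) (R : realType)
    (P : probability T R) (f : T -> R) (K : R) :
  measurable_fun setT f -> (forall w, `|f w| <= K) ->
  P.-integrable setT (fun w => (f w)%:E).
Proof.
move=> mf fK; apply: (@le_integrable _ _ _ P setT measurableT _ (cst K%:E)).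
- exact/measurable_EFinP.
- by move=> w _; rewrite /= lee_fin (le_trans (fK w))// ler_norm.
- exact: finite_measure_integrable_cst.
Qed.

Lemma normr_cos_le1 (R : realType) (x : R) : `|cos x| <= 1.
Proof. by rewrite ler_norml cos_geN1 cos_le1. Qed.

Lemma normr_indic_le1 (T : Type) (R : realType) (A : set T) x : `|\1_A x : R| <= 1.
Proof. by rewrite indicE; case: (_ \in _); rewrite ?normr1 ?normr0. Qed.

Lemma measurable_cos_comp d (T : measurableType d) (R : realType) (f : T -> R) :
  measurable_fun setT f -> measurable_fun setT (fun w => cos (f w)).
Proof.
apply: (measurableT_comp (continuous_measurable_fun (@continuous_cos R))).
Qed.

Lemma measurable_indic_comp d d' (T : measurableType d) (T' : measurableType d')
    (R : realType) (f : T -> T') (A : set T') :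
  measurable A -> measurable_fun setT f ->
  measurable_fun setT (fun w => \1_A (f w) : R).
Proof. by move=> mA; apply: (@measurableT_comp _ _ _ _ _ _ (\1_A : T' -> R)). Qed.

(** Induction on the number of variables, absorbing the indicator of the first one into G. For fixed
    frequencies of the others, G times their cosine is a new bounded weight, to which the
    one-variable theorem for [W ord0] applies. *)
Lemma trig_integral_prod_eq0 d (T : measurableType d) (R : realType)
    (P : probability T R) m (W : 'I_m -> T -> R) (G : T -> R) (M : R) :
  measurable_fun setT G -> (forall w, `|G w| <= M) ->
  (forall j, measurable_fun setT (W j)) ->
  (forall (t : 'I_m -> R) th,
     \int[P]_w (G w * cos (\sum_j t j * W j w + th))%:E = 0)%E ->
  forall B : 'I_m -> set R, (forall j, measurable (B j)) ->
  (\int[P]_w (G w * \prod_j \1_(B j) (W j w))%:E = 0)%E.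
Proof.
elim: m W G => [|m IH] W G mG GM mW G0 B mB.
  rewrite -[RHS](G0 (fun=> 0) 0); apply: eq_integral => w _.
  by rewrite !big_ord0 addr0 cos0.
pose G1 w := G w * \1_(B ord0) (W ord0 w).
have mW' t (th : R) : measurable_fun setT
    (fun w => \sum_(j < m) t j * W (lift ord0 j) w + th).
  apply: measurable_funD => //; apply: measurable_sum => j.
  by apply: measurable_funM => //; exact: measurable_cst.
have := IH (fun j => W (lift ord0 j)) G1 _ _ _ _ (fun j => B (lift ord0 j)).
under eq_integral do rewrite /G1 -mulrA -(big_ord_recl _ (fun j => \1_(B j) (W j _))).
apply=> //.
- apply: measurable_funM => //; exact: measurable_indic_comp.
- by move=> w; rewrite normrM -[leRHS]mulr1 ler_pM// normr_indic_le1.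
- move=> t th.
  pose G' w := G w * cos (\sum_(j < m) t j * W (lift ord0 j) w + th).
  have mG' : measurable_fun setT G'.
    by apply: measurable_funM => //; exact: measurable_cos_comp.
  have G'M w : `|G' w| <= M.
    by rewrite normrM -[leRHS]mulr1 ler_pM// normr_cos_le1.
  rewrite -[RHS](@trig_integral_eq0 _ _ _ P G' (W ord0) M mG' G'M (mW ord0) _ (B ord0))//.
    by apply: eq_integral => w _; rewrite /G1 /G'; congr (_%:E); ring.
  move=> s th'.
  (* The product of the two cosines is the half sum of cosines of the sum and of the difference;
     these carry frequency s and - s in the first variable. *)
  pose tp j := if unlift ord0 j is Some k then t k else s.
  pose tm j := if unlift ord0 j is Some k then t k else - s.
  have tE u w : \sum_j (if unlift ord0 j is Some k then t k else u) * W j w =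
      u * W ord0 w + \sum_(j < m) t j * W (lift ord0 j) w.
    by rewrite big_ord_recl unlift_none; congr (_ + _); apply: eq_bigr => j _;
      rewrite liftK.
  have ii u a : P.-integrable setT (fun w => (G w *
      cos (\sum_j (if unlift ord0 j is Some k then t k else u) * W j w + a))%:E).
    apply: (@bounded_integrable _ _ _ _ _ M).
      apply: measurable_funM => //; apply: measurable_cos_comp.
      apply: measurable_funD => //; apply: measurable_sum => j.
      by apply: measurable_funM => //; exact: measurable_cst.
    by move=> w; rewrite normrM -[leRHS]mulr1 ler_pM// normr_cos_le1.
  transitivity (\int[P]_w ((2^-1)%:E *
      ((G w * cos (\sum_j tp j * W j w + (th + th')))%:E +
       (G w * cos (\sum_j tm j * W j w + (th - th')))%:E)))%E.
    apply: eq_integral => w _; rewrite -EFinD -EFinM; congr (_%:E).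
    rewrite /G' !tE -mulrDr.
    set S := \sum_(j < m) _.
    have -> : s * W ord0 w + S + (th + th') = (S + th) + (s * W ord0 w + th') by ring.
    have -> : - s * W ord0 w + S + (th - th') = (S + th) - (s * W ord0 w + th') by ring.
    by rewrite (cosD (S + th)) (cosB (S + th)); field.
  rewrite integralZl//; last by apply: integrableD => //; exact: ii.
  by rewrite integralD//=; [rewrite !G0 adde0 mule0|exact: ii|exact: ii].
Qed.

Lemma prod_indic_bigcap (R : realType) (T : Type) m (E : 'I_m -> set T) w :
  \prod_j \1_(E j) w = \1_(\bigcap_j E j) w :> R.
Proof.
have [h|h] := boolP [forall j, w \in E j].
  rewrite [RHS]indicE mem_set ?big1// => [j _|j _].
    by rewrite indicE (forallP h j).
  exact/set_mem/(forallP h j).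
move/forallPn: h => [j jE]; rewrite (bigD1 j)//= indicE (negbTE jE) mul0r.
by rewrite indicE memNset// => /(_ j Logic.I) /mem_set; apply/negP.
Qed.

Section gaussian_conditioning.
Context d (T : measurableType d) (R : realType) (P : probability T R).
Variables (I : finType) (X : I -> {RV P >-> R}) (K : 'M[R]_#|I|).
Hypothesis gX : gaussian_vector X (fun=> 0) K.
Hypothesis dK : is_diag_mx K.

Let form_covD t u x : form_cov K (fun a => t a + u a) x = form_cov K t x + form_cov K u x.
Proof. by rewrite /form_cov -big_split; apply: eq_bigr => a _ /=; ring. Qed.
Let form_covZ s u x : form_cov K (fun a => s * u a) x = s * form_cov K u x.
Proof. by rewrite /form_cov mulr_sumr; apply: eq_bigr => a _ /=; ring. Qed.
Let form_covC t u : form_cov K t u = form_cov K u t.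
Proof. by apply: eq_bigr => a _ /=; ring. Qed.

(** The indicator of the event for x is centred by its probability, which makes independence the
    vanishing of an integral. The multivariate uniqueness theorem reduces the forms l_j to a cosine
    of one combination [la]; the one-variable theorem then reduces the event for x to a cosine as
    well, where the exponentials factor because x and [la] are uncorrelated. *)
Lemma gaussian_uncorrelated_indep m (x : I -> R) (l : 'I_m -> I -> R)
    (B : set R) (B' : 'I_m -> set R) :
  form_cov K x x = 1 -> (forall j, form_cov K x (l j) = 0) ->
  measurable B -> (forall j, measurable (B' j)) ->
  P (linear_form X x @^-1` B `&` \bigcap_j (linear_form X (l j) @^-1` B' j)) =
  (normal_prob 0 1 B * P (\bigcap_j (linear_form X (l j) @^-1` B' j)))%E.
Proof.
move=> xx xl mB mB'.
have mx := measurable_linear_form X x.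
have ml j := measurable_linear_form X (l j).
pose g := fine (P (linear_form X x @^-1` B)).
have mpre (f : T -> R) A : measurable_fun setT f -> measurable A -> measurable (f @^-1` A).
  by move=> mf mA; rewrite -[X in measurable X]setTI; exact: mf.
have mxB := mpre _ _ mx mB.
have gE : g%:E = P (linear_form X x @^-1` B).
  by rewrite /g fineK// fin_num_measure.
have g01 : `|g| <= 1.
  rewrite ger0_norm -?lee_fin gE ?measure_ge0//.
  exact: probability_le1.
have mindB := @measurable_indic_comp _ _ _ _ R _ _ mB mx.
have IB : (\int[P]_w (\1_B (linear_form X x w))%:E = g%:E)%E.
  by rewrite gE -(setIT (linear_form X x @^-1` B)) -integral_indic.
have h : (\int[P]_w ((\1_B (linear_form X x w) - g) *
    \prod_j \1_(B' j) (linear_form X (l j) w))%:E = 0)%E.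
  apply: (@trig_integral_prod_eq0 _ _ _ P _ (fun j => linear_form X (l j)) _ (1 + 1)) => //.
  - exact: measurable_funB.
  - by move=> w; rewrite (le_trans (ler_normB _ _))// lerD// normr_indic_le1.
  move=> t th.
  pose la a := \sum_j t j * l j a.
  have laE w : \sum_j t j * linear_form X (l j) w = linear_form X la w.
    rewrite /linear_form /la; under eq_bigr do rewrite mulr_sumr.
    rewrite exchange_big; apply: eq_bigr => a _ /=.
    by rewrite mulr_suml; apply: eq_bigr => j _; rewrite mulrA.
  have mla := measurable_linear_form X la.
  have xla : form_cov K x la = 0.
    rewrite form_covC /form_cov.
    transitivity (\sum_j t j * form_cov K (l j) x); last first.
      by rewrite big1// => j _; rewrite form_covC xl mulr0.
    rewrite /form_cov /la; under [RHS]eq_bigr do rewrite mulr_sumr.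
    rewrite exchange_big; apply: eq_bigr => a _ /=.
    by rewrite !mulr_suml; apply: eq_bigr => j _; ring.
  pose v := form_cov K la la.
  pose k := cos th * expR (- (v / 2)).
  have mcl a : measurable_fun setT (fun w => cos (linear_form X la w + a)).
    by apply: measurable_cos_comp; exact: measurable_funD.
  have icl u a : P.-integrable setT (fun w => (cos (linear_form X u w + a))%:E).
    apply: (@bounded_integrable _ _ _ _ _ 1) => [|w]; last exact: normr_cos_le1.
    by apply: measurable_cos_comp; apply: measurable_funD => //; exact: measurable_linear_form.
  (* The roles are exchanged: the weight is now the cosine of [la], centred by its mean [k], and the
     transform is taken in the form x. *)
  have main : (\int[P]_w ((cos (linear_form X la w + th) - k) *
      \1_B (linear_form X x w))%:E = 0)%E.
    apply: (@trig_integral_eq0 _ _ _ P _ _ (1 + `|k|)) => //.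
    - exact: measurable_funB.
    - by move=> w; rewrite (le_trans (ler_normB _ _))// lerD// normr_cos_le1.
    move=> s th'.
    transitivity (\int[P]_w ((2^-1)%:E *
      ((cos (linear_form X (fun a => s * x a + la a) w + (th' + th)))%:E +
       (cos (linear_form X (fun a => s * x a + -1 * la a) w + (th' - th)))%:E) -
      k%:E * (cos (linear_form X (fun a => s * x a) w + th'))%:E))%E.
      apply: eq_integral => w _; rewrite -EFinD; congr (_%:E).
      have linD u1 u2 : linear_form X (fun a => u1 a + u2 a) w =
          linear_form X u1 w + linear_form X u2 w.
        by rewrite /linear_form -big_split; apply: eq_bigr => a _ /=; rewrite mulrDl.
      have linZ c u1 : linear_form X (fun a => c * u1 a) w = c * linear_form X u1 w.
        by rewrite /linear_form mulr_sumr; apply: eq_bigr => a _ /=; rewrite mulrA.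
      rewrite !linD !linZ.
      set S := linear_form X la w; set Z := linear_form X x w.
      have -> : s * Z + S + (th' + th) = (s * Z + th') + (S + th) by ring.
      have -> : s * Z + -1 * S + (th' - th) = (s * Z + th') - (S + th) by ring.
      by rewrite (cosD (s * Z + th')) (cosB (s * Z + th')); field.
    rewrite integralB//=; last 2 first.
    - by apply: integrableZl => //; apply: integrableD => //; exact: icl.
    - by apply: integrableZl => //; exact: icl.
    rewrite !integralZl//; do ?[exact: icl|by apply: integrableD => //; exact: icl].
    rewrite integralD//=; do ?[exact: icl].
    rewrite !(linear_form_cos gX dK) -EFinD; congr (_%:E).
    have cov1 c : form_cov K (fun a => s * x a + c * la a) (fun a => s * x a + c * la a)
        = s ^+ 2 + c ^+ 2 * v.
      rewrite form_covD !form_covZ ![form_cov K _ (fun a => _ + _)]form_covC.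
      rewrite !form_covD !form_covZ xx xla form_covC xla -/v; ring.
    have cov2 : form_cov K (fun a => s * x a + la a) (fun a => s * x a + la a) = s ^+ 2 + v.
      have := cov1 1; rewrite expr1n mul1r => <-.
      by apply: eq_bigr => a _; rewrite !mul1r.
    have cov3 : form_cov K (fun a => s * x a) (fun a => s * x a) = s ^+ 2.
      by rewrite form_covZ form_covC form_covZ xx; ring.
    rewrite cov1 cov2 cov3 /k.
    have -> : - ((s ^+ 2 + v) / 2) = - (s ^+ 2 / 2) + - (v / 2) by field.
    have -> : - ((s ^+ 2 + (-1) ^+ 2 * v) / 2) = - (s ^+ 2 / 2) + - (v / 2) by field.
    by rewrite expRD cosD cosB; field.
  have iclB : P.-integrable setT (fun w =>
      (cos (linear_form X la w + th) * \1_B (linear_form X x w))%:E).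
    apply: (@bounded_integrable _ _ _ _ _ 1); first exact: measurable_funM.
    by move=> w; rewrite normrM -[leRHS]mulr1 ler_pM// ?normr_cos_le1// normr_indic_le1.
  have iB : P.-integrable setT (fun w => (\1_B (linear_form X x w))%:E).
    by apply: (@bounded_integrable _ _ _ _ _ 1) => // w; exact: normr_indic_le1.
  have E1 : (\int[P]_w (cos (linear_form X la w + th) * \1_B (linear_form X x w))%:E =
      (k * g)%:E)%E.
    move: main; under eq_integral do rewrite mulrBl EFinB.
    rewrite integralB//=; last by under eq_fun do rewrite EFinM; exact: integrableZl.
    under [X in (_ - X)%E = _ -> _]eq_integral do rewrite EFinM.
    rewrite integralZl// IB => /eqP; rewrite sube_eq ?add0e ?EFinM; first by move/eqP.
      exact: integrable_fin_num.
    by rewrite fin_num_adde_defl.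
  under eq_integral do rewrite laE mulrBl EFinB mulrC.
  rewrite integralB//=; last by under eq_fun do rewrite EFinM; apply: integrableZl => //;
    exact: icl.
  under [X in (_ - X)%E = _]eq_integral do rewrite EFinM.
  rewrite integralZl//; do ?[exact: icl].
  by rewrite E1 (linear_form_cos gX dK) -EFinM -EFinB; congr (_%:E); rewrite /k; ring.
set C := \bigcap_j _ in h *.
have mC : measurable C.
  by apply: fin_bigcap_measurable => [|j _]; [exact: finite_finset|exact: mpre].
have h' : (\int[P]_w ((\1_(linear_form X x @^-1` B `&` C) w)%:E - g%:E * (\1_C w)%:E) = 0)%E.
  rewrite -[RHS]h; apply: eq_integral => w _; rewrite -EFinM -EFinB; congr (_%:E).
  have -> : \prod_j \1_(B' j) (linear_form X (l j) w) = \1_C w :> R.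
    by rewrite -prod_indic_bigcap.
  by rewrite mulrBl indicI.
move: h'; rewrite integralB//=; last 2 first.
- by apply: (@bounded_integrable _ _ _ _ _ 1) => [|w]; [|exact: normr_indic_le1];
    apply: measurable_indic; exact: measurableI.
- apply: integrableZl => //; apply: (@bounded_integrable _ _ _ _ _ 1) => [|w].
    exact: measurable_indic.
  exact: normr_indic_le1.
rewrite integralZl//; last first.
  apply: (@bounded_integrable _ _ _ _ _ 1) => [|w]; last exact: normr_indic_le1.
  exact: measurable_indic.
rewrite !integral_indic// ?setIT//; last exact: measurableI.
move=> /eqP; rewrite sube_eq ?add0e; last 2 first.
- by rewrite fin_num_measure//; exact: measurableI.
- by rewrite fin_num_adde_defl// fin_numM// fin_num_measure.
by move/eqP => ->; rewrite gE (linear_form_std gX dK).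
Qed.

End gaussian_conditioning.

(** * Independence and densities on tuples *)

Section independent_events.
Context d (T : measurableType d) (R : realType) (P : probability T R).

Lemma measurable_preimage d' (M : measurableType d') (Z : T -> M) D :
  measurable_fun setT Z -> measurable D -> measurable (Z @^-1` D).
Proof. by move=> mZ mD; rewrite -[X in measurable X]setTI; exact: mZ. Qed.

Lemma indep_event_ext d' (M : measurableType d') (Z : T -> M) (E : set T)
    (G : set (set M)) :
  measurable E -> measurable_fun setT Z ->
  @measurable _ M = <<s G >> -> setI_closed G ->
  (forall D, G D -> P (E `&` Z @^-1` D) = P E * P (Z @^-1` D))%E ->
  forall D, measurable D -> (P (E `&` Z @^-1` D) = P E * P (Z @^-1` D))%E.
Proof.
move=> mE mZ MG GI GE D mD.
pose Q D := (P (E `&` Z @^-1` D) = P E * P (Z @^-1` D))%E.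
have mpre B : measurable B -> measurable (Z @^-1` B) by exact: measurable_preimage.
apply: (@dynkin_induction _ M G Q) => //; last by rewrite -MG.
- by rewrite /Q preimage_setT setIT probability_setT mule1.
- move=> A mA QA; rewrite /Q (_ : Z @^-1` (~` A) = ~` (Z @^-1` A))// -setDE.
  have mZA := mpre _ mA.
  have fE : P E \is a fin_num by exact: fin_num_measure.
  have fA : P (Z @^-1` A) \is a fin_num by exact: fin_num_measure.
  rewrite measureD// ?ltey_eq ?fE// -[X in (_ - X)%E]/(P (E `&` Z @^-1` A)) QA probability_setC//.
  by rewrite muleBr// ?mule1.
- move=> F mF tF QF; rewrite /Q preimage_bigcup setI_bigcupr.
  have tZ i j : i != j -> Z @^-1` F i `&` Z @^-1` F j = set0.
    move=> ij; apply/seteqP; split => // w [/= Fi Fj].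
    move/trivIsetP : tF => /(_ i j Logic.I Logic.I ij) /seteqP[/(_ (Z w)) h _].
    exact: h.
  rewrite measure_bigcup//; last 2 first.
  + by move=> k _; apply: measurableI => //; exact: mpre.
  + apply/trivIsetP => i j _ _ ij; rewrite setIACA setIid.
    by rewrite tZ// setI0.
  rewrite measure_bigcup//; last 2 first.
  + by move=> k _; exact: mpre.
  + apply/trivIsetP => i j _ _ ij.
    exact: tZ.
  rewrite -(fineK (fin_num_measure P E mE)) -nneseriesZl//.
  by apply: eq_eseriesr => k _; rewrite fineK ?fin_num_measure//; exact: QF.
Qed.

Lemma measurable_prodE d1 d2 (M1 : measurableType d1) (M2 : measurableType d2) :
  @measurable _ (M1 * M2)%type =
  <<s [set C | exists A B, [/\ measurable A, measurable B & C = A `*` B]] >>.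
Proof.
rewrite measurable_prod_measurableType; congr (<<s _ >>).
apply/seteqP; split => [C [A mA [B mB <-]]|C [A [B [mA mB ->]]]].
  by exists A, B.
by exists A => //; exists B.
Qed.

Lemma measurable_tupleE d1 (M : measurableType d1) n :
  @measurable _ (n.-tuple M) =
  <<s [set C | exists B : 'I_n -> set M, (forall i, measurable (B i)) /\
     C = [set t | forall i, B i (tnth t i)]] >>.
Proof.
apply/seteqP; split.
  apply: smallest_sub; first exact: smallest_sigma_algebra.
  rewrite -bigcup_seq => C [i /= _ [A mA <-]].
  apply: sub_sigma_algebra; exists (fun j => if j == i then A else setT); split.
    by move=> j; case: ifP.
  apply/seteqP; split => t /=.
    by move=> [_ Ai] j; case: eqP => [->|].
  by move=> /(_ i); rewrite eqxx.
apply: smallest_sub; first exact: sigma_algebra_measurable.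
move=> C [B [mB ->]].
rewrite (_ : [set t | _] = \bigcap_i ((fun t => tnth t i) @^-1` B i)); last first.
  by apply/seteqP; split => [t h i _|t h i]; [exact: h|exact: (h i Logic.I)].
apply: fin_bigcap_measurable => [|i _]; first exact: finite_finset.
rewrite -[X in measurable X]setTI; apply: (measurable_tnth i) => //.
Qed.

Lemma setI_closed_rect d1 d2 (M1 : measurableType d1) (M2 : measurableType d2) :
  setI_closed [set C : set (M1 * M2) |
    exists A B, [/\ measurable A, measurable B & C = A `*` B]].
Proof.
move=> _ _ [A [B [mA mB ->]]] [A' [B' [mA' mB' ->]]].
exists (A `&` A'), (B `&` B'); split; [exact: measurableI..|].
by rewrite setXI.
Qed.

Lemma setI_closed_box d1 (M : measurableType d1) n :
  setI_closed [set C : set (n.-tuple M) | exists B : 'I_n -> set M,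
    (forall i, measurable (B i)) /\ C = [set t | forall i, B i (tnth t i)]].
Proof.
move=> _ _ [B [mB ->]] [B' [mB' ->]].
exists (fun i => B i `&` B' i); split; first by move=> i; exact: measurableI.
by apply/seteqP; split => t /= => [[h h'] i|h]; [split|split=> i; have [] := h i].
Qed.

(* Some of the [B i] and [D] may be the whole space, so this is mutual
   independence of X_0, ..., X_(n-1) and Z. *)
Definition indep_with n (X : 'I_n -> T -> R) d' (M : measurableType d') (Z : T -> M) :=
  forall (B : 'I_n -> set R) (D : set M),
    (forall i, measurable (B i)) -> measurable D ->
    P ((\bigcap_i (X i @^-1` B i)) `&` Z @^-1` D) =
    (\prod_i P (X i @^-1` B i) * P (Z @^-1` D))%E.

Section absorb.
Variables (n : nat) (X : 'I_n.+1 -> T -> R).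
Context d' (M : measurableType d') (Z : T -> M).
Hypothesis mX : forall i, measurable_fun setT (X i).
Hypothesis mZ : measurable_fun setT Z.
Hypothesis iXZ : indep_with X Z.

Let X' i := X (lift ord0 i).
Let Z' w : R * M := (X ord0 w, Z w).

Lemma measurable_absorb : measurable_fun setT Z'.
Proof. exact: measurable_fun_pair. Qed.

Lemma indep_with_head A D : measurable A -> measurable D ->
  (P (X ord0 @^-1` A `&` Z @^-1` D) = P (X ord0 @^-1` A) * P (Z @^-1` D))%E.
Proof.
move=> mA mD.
have := iXZ (B := fun j => if j == ord0 then A else setT) _ mD.
rewrite big_ord_recl eqxx big1 ?mule1; last first.
  by move=> i _; rewrite /= preimage_setT probability_setT.
move=> <-; last by move=> i; case: ifP.
congr (P (_ `&` _)); apply/seteqP; split => [w Aw j _|w /(_ ord0 Logic.I)].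
  by case: eqP => [->|].
by rewrite eqxx.
Qed.

(** Moves the first variable of the family into the companion Z, which is the induction step of
    every argument on n independent variables below. Rectangles suffice, as they generate the
    product sigma-algebra. *)
Lemma indep_with_absorb : indep_with X' Z'.
Proof.
move=> B D mB mD.
have mE : measurable (\bigcap_i (X' i @^-1` B i)).
  apply: fin_bigcap_measurable => [|i _]; first exact: finite_finset.
  by apply: measurable_preimage; [exact: mX|exact: mB].
have split_ A D2 : measurable A -> measurable D2 ->
    (P ((\bigcap_i (X' i @^-1` B i)) `&` Z' @^-1` (A `*` D2)) =
     \prod_i P (X' i @^-1` B i) * P (Z' @^-1` (A `*` D2)))%E.
  move=> mA mD2.
  have -> : Z' @^-1` (A `*` D2) = X ord0 @^-1` A `&` Z @^-1` D2 by [].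
  rewrite indep_with_head// muleA [X in (X * _)%E]muleC.
  have := iXZ (B := fun j => if unlift ord0 j is Some k then B k else A) _ mD2.
  rewrite big_ord_recl unlift_none; under eq_bigr do rewrite liftK.
  move=> <-; last by move=> j; case: unliftP.
  rewrite setIA; congr (P (_ `&` _)); apply/seteqP; split => [w [h Aw] j _|w h].
    by case: unliftP => [k ->|->] //; exact: h.
  split => [j _|]; last by have := h ord0 Logic.I; rewrite /= unlift_none.
  by have := h (lift ord0 j) Logic.I; rewrite /= liftK.
have PE : P (\bigcap_i (X' i @^-1` B i)) = (\prod_i P (X' i @^-1` B i))%E.
  have := split_ setT setT measurableT measurableT.
  by rewrite setXTT preimage_setT setIT probability_setT mule1.
rewrite -PE; apply: (indep_event_ext mE measurable_absorb (measurable_prodE _ _)) => //.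
  exact: setI_closed_rect.
by move=> _ [A [D2 [mA mD2 ->]]]; rewrite PE; exact: split_.
Qed.

End absorb.

Lemma eq_indep_with_tuple n (X : 'I_n -> T -> R) m (W : 'I_m -> T -> R) :
  (forall i, measurable_fun setT (X i)) ->
  (forall j, measurable_fun setT (W j)) ->
  (forall B B', (forall i, measurable (B i)) -> (forall j, measurable (B' j)) ->
    P ((\bigcap_i (X i @^-1` B i)) `&` (\bigcap_j (W j @^-1` B' j))) =
    (\prod_i P (X i @^-1` B i) * P (\bigcap_j (W j @^-1` B' j)))%E) ->
  indep_with X (fun w => [tuple W j w | j < m] : m.-tuple (measurableTypeR R)).
Proof.
move=> mX mW h B D mB mD.
have mE : measurable (\bigcap_i (X i @^-1` B i)).
  apply: fin_bigcap_measurable => [|i _]; first exact: finite_finset.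
  exact: measurable_preimage.
have rect (B' : 'I_m -> set R) :
    (fun w => [tuple W j w | j < m]) @^-1` [set t | forall i, B' i (tnth t i)] =
    \bigcap_j (W j @^-1` B' j).
  apply/seteqP; split => w /= hw j => [_|]; first by have := hw j; rewrite tnth_mktuple.
  by rewrite tnth_mktuple; exact: hw.
have PE : P (\bigcap_i (X i @^-1` B i)) = (\prod_i P (X i @^-1` B i))%E.
  have := h B (fun=> setT) mB (fun=> measurableT).
  rewrite (_ : \bigcap_j (W j @^-1` setT) = setT); last first.
    by apply/seteqP; split.
  by rewrite setIT probability_setT mule1.
rewrite -PE; apply: (indep_event_ext mE _ (measurable_tupleE _ _)) => //.
- apply/measurable_fun_tnthP => j.
  rewrite (_ : _ \o _ = W j); first exact: mW.
  by apply/funext => w /=; rewrite tnth_mktuple.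
- exact: setI_closed_box.
- by move=> _ [B' [mB' ->]]; rewrite rect PE; exact: h.
Qed.

End independent_events.

(** * Fubini and boxes for Lebesgue measure on tuples *)

Section lebesgue_tuple_facts.
Context {R : realType}.
Notation leb := (@lebesgue_measure R).

Lemma ge0_integral_lebesgue_tupleS n (g : n.+1.-tuple (measurableTypeR R) -> \bar R) :
  measurable_fun setT g -> (forall x, 0 <= g x)%E ->
  (\int[lebesgue_tuple n.+1]_x g x =
   \int[leb]_x \int[lebesgue_tuple n]_y g (cons_pair (x, y)))%E /\
  (\int[lebesgue_tuple n.+1]_x g x =
   \int[lebesgue_tuple n]_y \int[leb]_x g (cons_pair (x, y)))%E.
Proof.
move=> mg g0.
have -> : (\int[lebesgue_tuple n.+1]_x g x =
   \int[leb \x lebesgue_tuple n]_z g (cons_pair z))%E.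
  apply/esym; apply: (@ge0_integral_law _ _ _ _ _ [the measure _ _ of leb \x lebesgue_tuple
    n]%E) => //.
  exact: measurable_cons_pair.
have mgc : measurable_fun setT (g \o @cons_pair R n).
  by apply: measurableT_comp => //; exact: measurable_cons_pair.
split; first by rewrite fubini_tonelli1.
by rewrite fubini_tonelli2.
Qed.

Lemma lebesgue_tuple_cons n (A : set (measurableTypeR R)) (B : set (n.-tuple (measurableTypeR R))) :
  measurable A -> measurable B ->
  lebesgue_tuple n.+1 [set t | A (thead t) /\ B [tuple of behead t]] =
  (leb A * lebesgue_tuple n B)%E.
Proof.
move=> mA mB; rewrite -product_measure1E//.
change ((leb \x lebesgue_tuple n)%E (@cons_pair R n @^-1` [set t | A
  (thead t) /\ B [tuple of behead t]]) =
  (leb \x lebesgue_tuple n)%E (A `*` B)).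
congr (product_measure1 _ _ _); apply/seteqP; split => -[x y] /=.
- by move=> [Ax By]; split => //; move: By; congr (B _); exact: val_inj.
- by move=> [Ax By]; split => //; move: By; congr (B _); exact: val_inj.
Qed.

Lemma lebesgue_tuple_box n (B : 'I_n -> set (measurableTypeR R)) :
  (forall i, measurable (B i)) ->
  lebesgue_tuple n [set t | forall i, B i (tnth t i)] = (\prod_i leb (B i))%E.
Proof.
elim: n B => [|n IH] B mB.
  rewrite big_ord0 /= diracE mem_set//.
  by case.
rewrite big_ord_recl -IH; last by move=> i; exact: mB.
rewrite -lebesgue_tuple_cons//; last first.
  rewrite measurable_tupleE; apply: sub_sigma_algebra.
  by exists (fun i => B (lift ord0 i)); split.
congr (_ _); apply/seteqP; split => t /=.
- move=> h; split; first exact: (h ord0).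
  by move=> i; have := h (lift ord0 i); rewrite [t in tnth t _]tuple_eta tnthS.
- move=> [h0 h] i; rewrite [t]tuple_eta.
  by case: (unliftP ord0 i) => [j ->|->] //; rewrite tnthS; exact: h.
Qed.

End lebesgue_tuple_facts.

Section density_bound.
Context d (T : measurableType d) (R : realType) (P : probability T R).
Notation leb := (@lebesgue_measure R).
Variable (c : R).
Hypothesis c0 : 0 <= c.

Lemma measurable_fun_section d1 (M1 : measurableType d1) d' (M : measurableType d')
    (Z : T -> M) (S : set (M1 * M)) :
  measurable_fun setT Z -> measurable S ->
  measurable_fun setT (fun x => P [set w | S (x, Z w)]).
Proof.
move=> mZ mS.
pose Zf : {mfun T >-> M} := HB.pack Z (isMeasurableFun.Build _ _ _ _ Z mZ).
rewrite (_ : (fun x => _) = distribution P Zf \o xsection S).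
  exact: measurable_fun_xsection.
apply/funext => x; congr (P _); apply/seteqP; split => w /=;
  by rewrite /xsection /= inE.
Qed.

(** By independence the joint law is a product. For each fixed value of Z the bound on the law of X
    applies to the section of E, and exchanging the order of integration gives the right-hand
    side. *)
Lemma pair_density_bound (X : T -> R) d' (M : measurableType d') (Z : T -> M)
    (E : set (measurableTypeR R * M)) :
  measurable_fun setT X -> measurable_fun setT Z ->
  (forall A D, measurable A -> measurable D ->
    P (X @^-1` A `&` Z @^-1` D) = P (X @^-1` A) * P (Z @^-1` D))%E ->
  (forall A, measurable A -> P (X @^-1` A) <= c%:E * leb A)%E ->
  measurable E ->
  (P [set w | E (X w, Z w)] <= c%:E * \int[leb]_x P [set w | E (x, Z w)])%E.
Proof.
move=> mX mZ XZ Xc mE.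
have mX' : measurable_fun setT (X : T -> measurableTypeR R) := mX.
pose Xf : {mfun T >-> measurableTypeR R} := HB.pack (X : T
  -> measurableTypeR R) (isMeasurableFun.Build _ _ _ _ _ mX').
pose Zf : {mfun T >-> M} := HB.pack Z (isMeasurableFun.Build _ _ _ _ Z mZ).
have mXZ : measurable_fun setT (fun w => (X w, Z w) : measurableTypeR R * M).
  exact: measurable_fun_pair.
pose XZf : {mfun T >-> (measurableTypeR R * M)%type} :=
  HB.pack (fun w => (X w, Z w) : measurableTypeR R * M) (isMeasurableFun.Build _ _ _ _ _ mXZ).
pose m1 := distribution P Xf; pose m2 := distribution P Zf.
have e1 : (m1 \x m2)%E E = P [set w | E (X w, Z w)].
  rewrite (@product_measure_unique _ _ _ _ _ m1 m2 (distribution P XZf))//.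
have swap (m : {sigma_finite_measure set (measurableTypeR R) -> \bar R}) :
    (m \x m2)%E E = (m \x^ m2)%E E.
  rewrite (@product_measure_unique _ _ _ _ _ m m2 [the measure _ _ of (m \x^ m2)%E])//.
  by move=> A B mA mB; rewrite /= product_measure2E.
rewrite -e1 swap.
have -> : (\int[leb]_x P [set w | E (x, Z w)] = (leb \x m2) E)%E.
  by apply: eq_integral => x _; congr (P _); apply/seteqP; split => w /=;
    rewrite /xsection /= inE.
rewrite swap /product_measure2 -ge0_integralZl//; last first.
  exact: measurable_fun_ysection.
apply: ge0_le_integral => //.
- exact: measurable_fun_ysection.
- by apply: emeasurable_funM => //; exact: measurable_fun_ysection.
- by move=> z _; apply: Xc; exact: measurable_ysection.
Qed.

Lemma tuple_density_bound n (X : 'I_n -> T -> R) d' (M : measurableType d') (Z : T -> M)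
    (S : set (n.-tuple (measurableTypeR R) * M)) :
  (forall i, measurable_fun setT (X i)) -> measurable_fun setT Z ->
  indep_with P X Z ->
  (forall i A, measurable A -> P (X i @^-1` A) <= c%:E * leb A)%E ->
  measurable S ->
  (P [set w | S ([tuple X i w | i < n], Z w)] <=
    (c ^+ n)%:E * \int[lebesgue_tuple n]_x P [set w | S (x, Z w)])%E.
Proof.
elim: n X d' M Z S => [|n IH] X d' M Z S mX mZ iXZ Xc mS.
  rewrite expr0 mul1e /= integral_dirac//; last exact: measurable_fun_section.
  rewrite diracT mul1e le_eqVlt; apply/orP; left; apply/eqP; congr (P _).
  by apply/seteqP; split => w; rewrite /= (tuple0 [tuple X i w | i < 0]).
pose X' i := X (lift ord0 i).
pose Z' w : measurableTypeR R * M := (X ord0 w, Z w).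
(* Rearranges the arguments after absorption: the head coordinate, now part of the companion, is put
   back at the front of the tuple. *)
pose phi (u : n.-tuple (measurableTypeR R) * (measurableTypeR R * M)) :=
  (cons_pair (u.2.1, u.1), u.2.2).
have mphi : measurable_fun setT phi.
  apply: measurable_fun_pair => /=; last by apply: measurableT_comp.
  apply: measurableT_comp; first exact: measurable_cons_pair.
  by apply: measurable_fun_pair => //=; apply: measurableT_comp.
have mS' : measurable (phi @^-1` S) by exact: measurable_preimage.
have := IH X' _ _ Z' (phi @^-1` S) (fun i => mX _) (measurable_absorb mX mZ)
  (indep_with_absorb mX mZ iXZ) (fun i => Xc _) mS'.
have -> : [set w | (phi @^-1` S) ([tuple X' i w | i < n], Z' w)] =
    [set w | S ([tuple X i w | i < n.+1], Z w)].
  apply/seteqP; split => w /=; congr (S (_, _)); apply: eq_from_tnth => i;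
    by case: (unliftP ord0 i) => [j|] ->; rewrite ?tnthS ?tnth_mktuple.
move=> h; apply: (le_trans h); rewrite exprSr EFinM -muleA.
apply: lee_wpmul2l; first by rewrite lee_fin exprn_ge0.
pose F (x : n.+1.-tuple (measurableTypeR R)) := P [set w | S (x, Z w)].
have mF : measurable_fun setT F by exact: measurable_fun_section.
have [_ ->] := @ge0_integral_lebesgue_tupleS _ n F mF (fun x => measure_ge0 _ _).
have mF2 : measurable_fun setT (fun y => \int[leb]_x F (cons_pair (x, y)))%E.
  apply: (@measurable_fun_fubini_tonelli_G _ _ _ _ _ leb (F \o @cons_pair R n)) => //.
  by apply: measurableT_comp => //; exact: measurable_cons_pair.
rewrite -ge0_integralZl//; last by move=> y _; apply: integral_ge0.
apply: ge0_le_integral => //.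
- by apply: measurable_fun_section => //; exact: measurable_absorb.
- by apply: emeasurable_funM.
- move=> y _.
  have := @pair_density_bound (X ord0) _ _ Z [set u | S (cons_pair (u.1, y), u.2)]
    (mX _) mZ (indep_with_head iXZ) (Xc _).
  apply; pose psi (u : measurableTypeR R * M) := (cons_pair (u.1, y), u.2).
  rewrite (_ : [set u | _] = psi @^-1` S)//; apply: measurable_preimage => //.
  apply: measurable_fun_pair => //=.
  apply: measurableT_comp; first exact: measurable_cons_pair.
  by apply: measurable_fun_pair.
Qed.

End density_bound.

Section integral_of_independent_product.
Context d (T : measurableType d) (R : realType) (P : probability T R).

Lemma integral_mul_indep (X Z : T -> R) :
  measurable_fun setT X -> measurable_fun setT Z ->
  (forall A D, measurable A -> measurable D ->
    P (X @^-1` A `&` Z @^-1` D) = P (X @^-1` A) * P (Z @^-1` D))%E ->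
  P.-integrable setT (EFin \o X) -> P.-integrable setT (EFin \o Z) ->
  P.-integrable setT (fun w => (X w * Z w)%:E) /\
  (\int[P]_w (X w * Z w)%:E = (\int[P]_w (X w)%:E) * (\int[P]_w (Z w)%:E))%E.
Proof.
move=> mX mZ XZ iX iZ.
pose Xf : {mfun T >-> R} := HB.pack X (isMeasurableFun.Build _ _ _ _ X mX).
pose Zf : {mfun T >-> R} := HB.pack Z (isMeasurableFun.Build _ _ _ _ Z mZ).
have mXZ : measurable_fun setT (fun w => (X w, Z w)) by exact: measurable_fun_pair.
pose XZf : {mfun T >-> (R * R)%type} :=
  HB.pack (fun w => (X w, Z w)) (isMeasurableFun.Build _ _ _ _ _ mXZ).
pose m1 := distribution P Xf; pose m2 := distribution P Zf.
pose m12 := [the measure _ _ of (m1 \x m2)%E].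
have lawXZ A : measurable A -> P ((fun w => (X w, Z w)) @^-1` A) = m12 A.
  move=> mA; rewrite /m12 /=.
  rewrite (@product_measure_unique _ _ _ _ _ m1 m2 (distribution P XZf))//.
pose f (u : R * R) : R := u.1 * u.2.
have mf : measurable_fun setT f by exact: measurable_funM.
have intX : m1.-integrable setT (EFin \o id).
  apply: (iffLR (@integrable_law _ _ _ _ _ P m1 X mX _ id _)) => //.
have intZ : m2.-integrable setT (EFin \o id).
  apply: (iffLR (@integrable_law _ _ _ _ _ P m2 Z mZ _ id _)) => //.
have eX : (\int[P]_w (X w)%:E = \int[m1]_x x%:E)%E.
  exact: (@integral_law _ _ _ _ _ P m1 X mX _ id).
have eZ : (\int[P]_w (Z w)%:E = \int[m2]_x x%:E)%E.
  exact: (@integral_law _ _ _ _ _ P m2 Z mZ _ id).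
have mEf : measurable_fun setT (EFin \o f) by exact/measurable_EFinP.
have intf : m12.-integrable setT (EFin \o f).
  apply/(integrable12ltyP m1 m2 mEf).
  have k2 : (\int[m2]_z `|z%:E| < +oo)%E by case/integrableP : intZ.
  have k1 : (\int[m1]_z `|z%:E| < +oo)%E by case/integrableP : intX.
  have f2 : (\int[m2]_z `|z%:E|)%E \is a fin_num by rewrite ge0_fin_numE// integral_ge0.
  rewrite (_ : (\int[m1]_x _)%E = (\int[m1]_x `|x%:E| * \int[m2]_z `|z%:E|)%E).
    by rewrite lte_mul_pinfty// ?integral_ge0// ge0_fin_numE// integral_ge0.
  rewrite -(fineK f2) -ge0_integralZr//; last first.
  - by rewrite lee_fin fine_ge0// integral_ge0.
  - exact: measurableT_comp.
  apply: eq_integral => x _; rewrite fineK// -ge0_integralZl//; last exact: measurableT_comp.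
  by apply: eq_integral => z _; rewrite /= normrM EFinM.
have iXZ : P.-integrable setT (fun w => (X w * Z w)%:E).
  exact: (iffRL (@integrable_law _ _ _ _ _ P m12 _ mXZ lawXZ f mf) intf).
split => //.
rewrite (@integral_law _ _ _ _ _ P m12 _ mXZ lawXZ f mf iXZ).
rewrite -(integral12_prod_meas1 intf) eX eZ.
have f2 : (\int[m2]_z z%:E)%E \is a fin_num by exact: integrable_fin_num intZ.
rewrite -(fineK f2) -integralZr//.
by apply: eq_integral => x _; rewrite fineK// /fubini_F -integralZl//.
Qed.

(** The extra factor [Z] accumulates the variables that the induction removes from the family; it is
    the constant 1 where the lemma is applied. *)
Lemma integral_prod_indep n (Y : 'I_n -> T -> R) (Z : T -> R) :
  (forall i, measurable_fun setT (Y i)) -> measurable_fun setT Z ->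
  indep_with P Y Z ->
  (forall i, P.-integrable setT (EFin \o Y i)) -> P.-integrable setT (EFin \o Z) ->
  P.-integrable setT (fun w => (Z w * \prod_i Y i w)%:E) /\
  (\int[P]_w (Z w * \prod_i Y i w)%:E =
    (\int[P]_w (Z w)%:E) * \prod_i (\int[P]_w (Y i w)%:E))%E.
Proof.
elim: n Y Z => [|n IH] Y Z mY mZ iYZ iY iZ.
  under eq_fun do rewrite big_ord0 mulr1; rewrite big_ord0 mule1.
  by split => //; apply: eq_integral => w _; rewrite big_ord0 mulr1.
have [iYZ0 eYZ0] := integral_mul_indep (mY _) mZ (indep_with_head iYZ) (iY _) iZ.
have iYZ' := indep_with_absorb mY mZ iYZ.
have mYZ0 : measurable_fun setT (fun w => Y ord0 w * Z w) by exact: measurable_funM.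
have iYZ'' : indep_with P (fun i => Y (lift ord0 i)) (fun w => Y ord0 w * Z w).
  move=> B D mB mD.
  have mD' : measurable ((fun u : R * R => u.1 * u.2) @^-1` D).
    by apply: measurable_preimage => //; exact: measurable_funM.
  exact: (iYZ' B _ mB mD').
have [iA eA] := IH _ _ (fun i => mY _) mYZ0 iYZ'' (fun i => iY _) iYZ0.
have E w : Z w * \prod_i Y i w = Y ord0 w * Z w * \prod_(i < n) Y (lift ord0 i) w.
  by rewrite big_ord_recl mulrA [Z w * _]mulrC.
under eq_fun do rewrite E.
split => //.
by rewrite eA eYZ0 big_ord_recl muleAC muleC muleA -muleA muleC.
Qed.

End integral_of_independent_product.

(** * Linear changes of variables *)

Definition image_measure d1 d2 (T1 : measurableType d1) (T2 : measurableType d2)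
    (R : realType) (mu : {measure set T1 -> \bar R}) (f : T1 -> T2)
    (mf : measurable_fun setT f) : {measure set T2 -> \bar R} :=
  measure_function_pushforward__canonical__measure_function_Measure mu mf.

Section linear_change_of_variables.
Context {R : realType}.
Notation leb := (@lebesgue_measure R).

Lemma lebesgue_measure_affine (a v : R) (A : set (measurableTypeR R)) :
  a != 0 -> measurable A ->
  (`|a|%:E * leb [set x | A (a * x + v)%R] = leb A)%E.
Proof.
move=> a0 mA.
pose f (x : measurableTypeR R) : measurableTypeR R := a * x + v.
have mf : measurable_fun setT f.
  have : measurable_fun setT (fun x : R => a * x + v).
    by apply: measurable_funD => //; exact: measurable_funM.
  by [].
pose m := mscale (NngNum (normr_ge0 a)) (image_measure leb mf).
rewrite [RHS](@lebesgue_measure_unique R [the measure _ _ of m] _ A mA)//.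
move=> _ [[l r] _ <-].
rewrite /= /m /mscale /= /pushforward.
have /= := a0; rewrite neq_lt => /orP[an|ap].
(* A negative slope reverses the interval, so the preimage is closed on the left and open on the
   right; its length is unaffected. *)
- have -> : f @^-1` `]l, r]%classic = `[(r - v) / a, (l - v) / a[%classic.
    apply/seteqP; split => x; rewrite /= /f !in_itv /= ler_ndivrMr// ltr_ndivlMr//;
      rewrite [x * a]mulrC; lra.
  rewrite !lebesgue_measure_itv /= !lte_fin ltr_nM2r ?invr_lt0//.
  rewrite ltrD2r; case: ifP => lr; last by rewrite mule0.
  rewrite -!EFinD -EFinM ltr0_norm//; congr (_%:E); field.
  by rewrite lt_eqF.
- have -> : f @^-1` `]l, r]%classic = `](l - v) / a, (r - v) / a]%classic.
    apply/seteqP; split => x; rewrite /= /f !in_itv /= ltr_pdivrMr// ler_pdivlMr//;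
      rewrite [x * a]mulrC; lra.
  rewrite !lebesgue_measure_itv /= !lte_fin ltr_pM2r ?invr_gt0//.
  rewrite ltrD2r; case: ifP => lr; last by rewrite mule0.
  rewrite -!EFinD -EFinM gtr0_norm//; congr (_%:E); field.
  by rewrite gt_eqF.
Qed.

Definition affine_tuple n (M : 'M[R]_n) (v : 'rV[R]_n) (t : n.-tuple (measurableTypeR R)) :
    n.-tuple (measurableTypeR R) :=
  [tuple (row_of t *m M + v) 0 j | j < n].

Lemma measurable_affine_tuple n (M : 'M[R]_n) v : measurable_fun setT (affine_tuple M v).
Proof.
apply/measurable_fun_tnthP => j.
rewrite (_ : _ \o _ = fun t : n.-tuple (measurableTypeR R) =>
    \sum_i tnth t i * M i j + v 0 j); last first.
  apply/funext => t; rewrite /= tnth_mktuple !mxE; congr (_ + _).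
  by apply: eq_bigr => i _; rewrite mxE.
suff : measurable_fun setT (fun t : n.-tuple (measurableTypeR R) =>
    (\sum_i tnth t i * M i j + v 0 j) : R) by [].
apply: measurable_funD => //; apply: measurable_sum => i.
apply: measurable_funM => //.
have : measurable_fun setT (fun t : n.-tuple (measurableTypeR R) => tnth t i).
  exact: measurable_tnth.
by [].
Qed.

Lemma affine_tupleK n (A B : 'M[R]_n) (v : 'rV[R]_n) t :
  affine_tuple B v (affine_tuple A 0 t) = affine_tuple (A *m B) v t.
Proof.
apply: eq_from_tnth => j; rewrite !tnth_mktuple.
suff -> : row_of (affine_tuple A 0 t) = row_of t *m A by rewrite mulmxA.
by apply/rowP => i; rewrite mxE tnth_mktuple addr0.
Qed.

(** The translation [v] is quantified because Fubini sections of a linear map are affine, with an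
    offset that depends on the section. *)
Definition scales_volume n (M : 'M[R]_n) := forall (v : 'rV[R]_n) S, measurable S ->
  (`|\det M|%:E * lebesgue_tuple n (affine_tuple M v @^-1` S) = lebesgue_tuple n S)%E.

Lemma scales_volumeM n (A B : 'M[R]_n) :
  scales_volume A -> scales_volume B -> scales_volume (A *m B).
Proof.
move=> hA hB v S mS; rewrite -(hB v S mS).
have mB : measurable (affine_tuple B v @^-1` S).
  by apply: measurable_preimage => //; exact: measurable_affine_tuple.
rewrite -(hA 0 _ mB) det_mulmx normrM (mulrC `|\det A|) EFinM -muleA.
congr (_ * (_ * lebesgue_tuple n _))%E.
by apply/seteqP; split => t; rewrite /= affine_tupleK.
Qed.

Lemma scales_volume0 (M : 'M[R]_0) : scales_volume M.
Proof.
move=> v S mS; rewrite det_mx00 normr1 mul1e; congr (lebesgue_tuple 0 _).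
by apply/seteqP; split => t /=; rewrite (tuple0 (affine_tuple _ _ _)) (tuple0 t).
Qed.

Lemma row_of_cons n (x : R) (y : n.-tuple (measurableTypeR R)) :
  (row_of (cons_pair (x, y)) : 'rV[R]_(1 + n)) = row_mx (x%:M : 'M[R]_1) (row_of y).
Proof.
apply/rowP => i; rewrite !mxE.
case: (splitP i) => j ij; rewrite !mxE.
  rewrite (ord1 j) eqxx mulr1n.
  have -> : i = ord0 by apply: val_inj; rewrite /= ij (ord1 j).
  by rewrite /cons_pair /= tnth0.
have -> : i = lift ord0 j by apply: val_inj; rewrite /= ij.
by rewrite tnthS.
Qed.

Lemma lebesgue_tupleS_fst n (S : set (n.+1.-tuple (measurableTypeR R))) : measurable S ->
  lebesgue_tuple n.+1 S =
  (\int[leb]_x lebesgue_tuple n [set y | S (cons_pair (x, y))])%E.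
Proof.
move=> mS; transitivity ((leb \x lebesgue_tuple n)%E (@cons_pair R n @^-1` S)); first by [].
apply: eq_integral => x _; congr (lebesgue_tuple n _).
by apply/seteqP; split => y; rewrite /xsection /= inE.
Qed.

Lemma lebesgue_tupleS_snd n (S : set (n.+1.-tuple (measurableTypeR R))) : measurable S ->
  lebesgue_tuple n.+1 S =
  (\int[lebesgue_tuple n]_y leb [set x | S (cons_pair (x, y))])%E.
Proof.
move=> mS; transitivity ((leb \x lebesgue_tuple n)%E (@cons_pair R n @^-1` S)); first by [].
have mS' : measurable (@cons_pair R n @^-1` S).
  by apply: measurable_preimage => //; exact: measurable_cons_pair.
rewrite (@product_measure_unique _ _ _ _ _ leb (lebesgue_tuple n)
  [the measure _ _ of (leb \x^ lebesgue_tuple n)%E])//=; last first.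
  by move=> A B mA mB; rewrite product_measure2E.
apply: eq_integral => y _; congr (leb _).
by apply/seteqP; split => x; rewrite /ysection /= inE.
Qed.

Lemma measurable_cons_section n (S : set (n.+1.-tuple (measurableTypeR R))) x :
  measurable S -> measurable [set y : n.-tuple (measurableTypeR R) | S (cons_pair (x, y))].
Proof.
move=> mS; apply: (@measurable_preimage _ _ _ _ (fun y => cons_pair (x, y)) S) => //.
apply: measurableT_comp; first exact: measurable_cons_pair.
exact: measurable_fun_pair.
Qed.

Lemma measurable_cons_ysection n (S : set (n.+1.-tuple (measurableTypeR R))) y :
  measurable S -> measurable [set x : measurableTypeR R | S (cons_pair (x, y))].
Proof.
move=> mS; apply: (@measurable_preimage _ _ _ _ (fun x => cons_pair (x, y)) S) => //.
apply: measurableT_comp; first exact: measurable_cons_pair.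
exact: measurable_fun_pair.
Qed.

Lemma measurable_lebesgue_section n (S : set (n.+1.-tuple (measurableTypeR R))) :
  measurable S -> measurable_fun setT
    (fun x => lebesgue_tuple n [set y | S (cons_pair (x, y))]).
Proof.
move=> mS; have mS' : measurable (@cons_pair R n @^-1` S).
  by apply: measurable_preimage => //; exact: measurable_cons_pair.
rewrite (_ : (fun x => _) = lebesgue_tuple n \o xsection (@cons_pair R n @^-1` S)).
  exact: measurable_fun_xsection.
by apply/funext => x; congr (lebesgue_tuple n _); apply/seteqP; split => y;
  rewrite /xsection /= inE.
Qed.

Lemma measurable_lebesgue_ysection n (S : set (n.+1.-tuple (measurableTypeR R))) :
  measurable S -> measurable_fun setT
    (fun y => leb [set x | S (cons_pair (x, y))]).
Proof.
move=> mS; have mS' : measurable (@cons_pair R n @^-1` S).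
  by apply: measurable_preimage => //; exact: measurable_cons_pair.
rewrite (_ : (fun y => _) = leb \o ysection (@cons_pair R n @^-1` S)).
  exact: measurable_fun_ysection.
by apply/funext => y; congr (leb _); apply/seteqP; split => x;
  rewrite /ysection /= inE.
Qed.

Lemma affine_tuple_cons n (M : 'M[R]_n.+1) (v : 'rV[R]_n.+1) (x : R)
    (y : n.-tuple (measurableTypeR R)) (r : R) (w : 'rV[R]_n) :
  (row_of (cons_pair (x, y)) : 'rV[R]_(1 + n)) *m (M : 'M[R]_(1 + n)) + v =
    row_mx (r%:M : 'M[R]_1) w ->
  affine_tuple M v (cons_pair (x, y)) = cons_pair (r, [tuple w 0 j | j < n]).
Proof.
move=> h; apply: eq_from_tnth => j; rewrite tnth_mktuple h.
have := row_of_cons r [tuple w 0 j | j < n].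
have -> : row_of [tuple w 0 j | j < n] = w by apply/rowP => k; rewrite mxE tnth_mktuple.
by move=> <-; rewrite mxE.
Qed.

(* (x, y) |-> (a x, x b + y D): Fubini with y integrated first. *)
Lemma scales_volume_upper n (a : R) (b : 'rV[R]_n) (D : 'M[R]_n) :
  a != 0 -> scales_volume D ->
  scales_volume (block_mx a%:M b 0 D : 'M[R]_(1 + n)).
Proof.
move=> a0 hD v S mS; set M := block_mx _ _ _ _.
have mA : measurable (affine_tuple (M : 'M[R]_n.+1) v @^-1` S).
  by apply: measurable_preimage => //; exact: measurable_affine_tuple.
pose v0 := v 0 0; pose v' : 'rV[R]_n := rsubmx (v : 'rV[R]_(1 + n)).
have vE : (v : 'rV[R]_(1 + n)) = row_mx (v0%:M : 'M[R]_1) v'.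
  rewrite -[LHS](@hsubmxK _ 1 1 n) /v'; congr row_mx; apply/rowP => i.
  by rewrite !mxE [i]ord1 eqxx mulr1n /v0; congr (v _ _); apply: val_inj.
have E x y : affine_tuple (M : 'M[R]_n.+1) v (cons_pair (x, y)) =
    cons_pair (a * x + v0, affine_tuple D (x *: b + v') y).
  rewrite (@affine_tuple_cons _ _ _ _ _ (a * x + v0) (row_of y *m D + (x *: b + v')))//.
  rewrite row_of_cons mul_row_block vE add_row_mx mulmx0 addr0; congr row_mx.
    by rewrite -scalar_mxM mulrC -raddfD.
  by rewrite mul_scalar_mx addrA; congr (_ + _); rewrite addrC.
have detM : \det M = a * \det D by rewrite det_ublock det_scalar1.
rewrite detM normrM EFinM -muleA lebesgue_tupleS_fst// -ge0_integralZl//; last first.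
  exact: measurable_lebesgue_section.
have -> : (\int[leb]_x (`|\det D|%:E * lebesgue_tuple n
      [set y | (affine_tuple (M : 'M[R]_n.+1) v @^-1` S) (cons_pair (x, y))]) =
    \int[leb]_x lebesgue_tuple n [set y | S (cons_pair (a * x + v0, y)%R)])%E.
  apply: eq_integral => x _.
  have mSx := @measurable_cons_section n S (a * x + v0) mS.
  rewrite -(hD (x *: b + v') _ mSx); congr (_ * lebesgue_tuple n _)%E.
  by apply/seteqP; split => y; rewrite /= E.
rewrite lebesgue_tupleS_fst//.
pose g (x : measurableTypeR R) := lebesgue_tuple n [set y | S (cons_pair (x, y))].
have mg : measurable_fun setT g by exact: measurable_lebesgue_section.
pose f (x : measurableTypeR R) : measurableTypeR R := a * x + v0.
have mf : measurable_fun setT f.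
  have : measurable_fun setT (fun x : R => a * x + v0).
    by apply: measurable_funD => //; exact: measurable_funM.
  by [].
pose m := [the measure _ _ of mscale (NngNum (normr_ge0 a)) (image_measure leb mf)].
have lawf A : measurable A -> leb A = m A.
  by move=> mB; rewrite /m /= /mscale /= (lebesgue_measure_affine v0 a0).
transitivity (\int[m]_x g x)%E; last first.
  by apply: eq_measure_integral => A mB _; rewrite -lawf.
rewrite ge0_integral_mscale//=; congr (_ * _)%E.
exact: (@ge0_integral_law _ _ _ _ _ leb (image_measure leb mf) f mf).
Qed.

(* (x, y) |-> (x + y c, y): Fubini with x integrated first. *)
Lemma scales_volume_lower n (c : 'cV[R]_n) : scales_volume (1%:M : 'M[R]_n) ->
  scales_volume (block_mx 1%:M 0 c 1%:M : 'M[R]_(1 + n)).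
Proof.
move=> h1 v S mS; set M := block_mx _ _ _ _.
have mA : measurable (affine_tuple (M : 'M[R]_n.+1) v @^-1` S).
  by apply: measurable_preimage => //; exact: measurable_affine_tuple.
rewrite det_lblock !det1 mulr1 normr1 mul1e lebesgue_tupleS_snd//.
pose v0 := v 0 0; pose v' : 'rV[R]_n := rsubmx (v : 'rV[R]_(1 + n)).
have vE : (v : 'rV[R]_(1 + n)) = row_mx (v0%:M : 'M[R]_1) v'.
  rewrite -[LHS](@hsubmxK _ 1 1 n) /v'; congr row_mx; apply/rowP => i.
  by rewrite !mxE [i]ord1 eqxx mulr1n /v0; congr (v _ _); apply: val_inj.
pose s (y : n.-tuple (measurableTypeR R)) := (row_of y *m c) 0 0 + v0.
have E x y : affine_tuple (M : 'M[R]_n.+1) v (cons_pair (x, y)) =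
    cons_pair (x + s y, affine_tuple 1%:M v' y).
  rewrite (@affine_tuple_cons _ _ _ _ _ (x + s y) (row_of y *m 1%:M + v'))//.
  rewrite row_of_cons mul_row_block vE add_row_mx !mulmx1 mulmx0 add0r; congr row_mx.
  by rewrite [row_of y *m c]mx11_scalar -!raddfD /s addrA.
pose g (y : n.-tuple (measurableTypeR R)) := leb [set x | S (cons_pair (x, y))].
have mg : measurable_fun setT g by exact: measurable_lebesgue_ysection.
transitivity (\int[lebesgue_tuple n]_y g (affine_tuple 1%:M v' y))%E.
  apply: eq_integral => y _.
  have mSy := measurable_cons_ysection (affine_tuple 1%:M v' y) mS.
  rewrite /g -(lebesgue_measure_affine (s y) (oner_neq0 _) mSy) normr1 mul1e.
  by congr (leb _); apply/seteqP; split => x; rewrite /= E mul1r.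
rewrite (lebesgue_tupleS_snd mS).
apply: (@ge0_integral_law _ _ _ _ _ (lebesgue_tuple n) (lebesgue_tuple n)) => //.
  exact: measurable_affine_tuple.
by move=> A mB; have := h1 v' A mB; rewrite det1 normr1 mul1e.
Qed.

(** Induction on n by one step of Gaussian elimination: a matrix with nonzero corner entry is a
    lower unipotent block matrix times an upper block triangular one whose lower block is again
    invertible. *)
Lemma unitmx_scales_volume n (M : 'M[R]_n) : M \in unitmx -> scales_volume M.
Proof.
elim: n M => [|n IH] M uM; first exact: scales_volume0.
have h1 : scales_volume (1%:M : 'M[R]_n) by apply: IH; exact: unitmx1.
have pivot (N : 'M[R]_(1 + n)) : N \in unitmx -> N 0 0 != 0 ->
    scales_volume (N : 'M[R]_n.+1).
  move=> uN a0; pose a := N 0 0.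
  pose b := ursubmx N; pose c := dlsubmx N; pose D := drsubmx N - a^-1 *: (c *m b).
  have NE : N = block_mx 1%:M 0 (a^-1 *: c) 1%:M *m block_mx a%:M b 0 D.
    rewrite mulmx_block !mul1mx !mul0mx !addr0 -scalemxAl mul_mx_scalar scalerA.
    rewrite mulVf// scale1r -scalemxAl addrC subrK -[LHS]submxK; congr block_mx.
    by apply/matrixP => i j; rewrite !mxE !ord1 eqxx mulr1n /a; congr (N _ _); apply: val_inj.
  rewrite NE; apply: scales_volumeM; first exact: scales_volume_lower.
  apply: scales_volume_upper => //; apply: IH.
  move: uN; rewrite NE unitmx_mul => /andP[_].
  by rewrite !unitmxE det_ublock unitrM => /andP[].
have [a0|] := eqVneq (M 0 0) 0; last exact: pivot.
have [k ck] : exists k : 'I_n, M (lift ord0 k) 0 != 0.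
  apply/existsP; rewrite -negb_forall; apply/negP => /forallP h.
  move: uM; rewrite unitmxE (expand_det_col _ 0) big1 ?unitr0// => i _.
  case: (unliftP ord0 i) => [j ->|->]; last by rewrite a0 mul0r.
  by have /eqP -> := h j; rewrite mul0r.
(* If the corner entry vanishes, some other row is nonzero in column 0; multiplication by [U 1] adds
   that row to the first one, and [U (-1)], itself upper triangular, undoes this. *)
pose U (r : R) : 'M[R]_(1 + n) := block_mx 1%:M (r *: delta_mx 0 k) 0 1%:M.
have UU : U (-1) *m U 1 = 1%:M.
  rewrite mulmx_block !mul1mx !mulmx1 !mul0mx !mulmx0 !addr0 !add0r.
  by rewrite scaleN1r scale1r subrr -scalar_mx_block.
have -> : M = (U (-1) *m (U 1 *m (M : 'M[R]_(1 + n))) : 'M[R]_n.+1).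
  by rewrite mulmxA UU mul1mx.
apply: scales_volumeM; first by apply: scales_volume_upper; rewrite ?oner_neq0.
apply: pivot.
  rewrite unitmx_mul; apply/andP; split; last exact: uM.
  by rewrite unitmxE det_ublock !det1 mulr1 unitr1.
have ME := submxK (M : 'M[R]_(1 + n)).
rewrite -[X in _ *m X]ME mulmx_block.
have -> : (0 : 'I_(1 + n)) = lshift n 0 by apply: val_inj.
rewrite block_mxEul mul1mx mxE.
have -> : ulsubmx (M : 'M[R]_(1 + n)) 0 0 = 0.
  by rewrite !mxE -[RHS]a0; congr (M _ _); apply: val_inj.
rewrite add0r scale1r mxE (bigD1 k)//= big1 ?addr0 => [|j jk]; last first.
  by rewrite !mxE (negbTE jk) andbF mul0r.
rewrite !mxE !eqxx mul1r; move: ck; congr (M _ _ != 0); apply: val_inj => //.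
Qed.

End linear_change_of_variables.

(** * Volume of a neighbourhood of a parallelepiped *)

Section parallelepiped.
Context {R : realType}.
Notation leb := (@lebesgue_measure R).

(** A convex function lies below its chord on [0, 1]. The induction runs on the exact slope 2^n -
    1. *)
Lemma expr_onepz_le (z : R) n : 0 <= z <= 1 -> (1 + z) ^+ n <= 1 + 2 ^+ n * z.
Proof.
move=> /andP[z0 z1]; have [k kE] : exists k, k = n by exists n.
suff : (1 + z) ^+ n <= 1 + (2 ^+ n - 1) * z by lra.
elim: n {kE} => [|n IH]; first by rewrite !expr0; lra.
rewrite exprSr; apply: (@le_trans _ _ ((1 + (2 ^+ n - 1) * z) * (1 + z))).
  by rewrite ler_wpM2r//; lra.
have h : 1 <= 2 ^+ n :> R by rewrite exprn_ege1// ler1n.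
rewrite exprSr -subr_ge0.
have -> : 1 + (2 ^+ n * 2 - 1) * z - (1 + (2 ^+ n - 1) * z) * (1 + z) =
  (2 ^+ n - 1) * (z * (1 - z)) by ring.
by rewrite !mulr_ge0//; lra.
Qed.

(* [parallelepiped_nbhd L del] is the closed sup-norm [del]-neighbourhood of
   -L([0,1]^n). *)
Definition parallelepiped_nbhd n (L : 'M[R]_n) (del : R) : set (n.-tuple R) :=
  [set x | exists u : 'I_n -> R, (forall j, 0 <= u j <= 1) /\
    forall i, `|tnth x i + \sum_j L i j * u j| <= del].

(** Asking for a measurable superset of small volume avoids any measurability claim about the
    neighbourhood itself. *)
Definition small_cover n (L : 'M[R]_n) (del v : R) :=
  exists2 S : set (n.-tuple (measurableTypeR R)), measurable S &
    parallelepiped_nbhd L del `<=` S /\ (lebesgue_tuple n S <= v%:E)%E.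

Let absum n (E : 'M[R]_n) := \sum_i \sum_j `|E i j|.

Let absum_ge0 n (E : 'M[R]_n) : 0 <= absum E.
Proof. by apply: sumr_ge0 => i _; apply: sumr_ge0. Qed.

Let mulmx_bound n (e : 'rV[R]_n) (E : 'M[R]_n) del j : 0 <= del ->
  (forall i, `|e 0 i| <= del) -> `|(e *m E) 0 j| <= del * absum E.
Proof.
move=> d0 he; rewrite mxE (le_trans (ler_norm_sum _ _ _))//.
rewrite /absum mulr_sumr ler_sum// => i _; rewrite normrM.
apply: (@le_trans _ _ (del * `|E i j|)); first by rewrite ler_wpM2r.
rewrite ler_wpM2l// (bigD1 j)//= lerDl; exact: sumr_ge0.
Qed.

Let box_measure n (E : 'M[R]_n) (B : 'I_n -> set (measurableTypeR R)) :
  E \in unitmx -> (forall j, measurable (B j)) ->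
  measurable (affine_tuple E 0 @^-1` [set t | forall i, B i (tnth t i)]) /\
  (lebesgue_tuple n (affine_tuple E 0 @^-1` [set t | forall i, B i (tnth t i)]) =
    `|\det E|^-1%:E * \prod_j leb (B j))%E.
Proof.
move=> uE mB.
have mbox : measurable [set t : n.-tuple (measurableTypeR R) | forall i, B i (tnth t i)].
  by rewrite measurable_tupleE; apply: sub_sigma_algebra; exists B.
split; first by apply: measurable_preimage => //; exact: measurable_affine_tuple.
rewrite -lebesgue_tuple_box// -(unitmx_scales_volume uE 0 mbox) muleA -EFinM mulVf ?mul1e//.
by rewrite normr_eq0; move: uE; rewrite unitmxE unitfE.
Qed.

Let nbhd_decomp n (L : 'M[R]_n) del (x : n.-tuple R) : parallelepiped_nbhd L del x ->
  exists u e : 'rV[R]_n, [/\ forall j, 0 <= u 0 j <= 1, forall i, `|e 0 i| <= del &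
    row_of x = e - u *m L^T].
Proof.
move=> [u [u01 ux]]; exists (\row_j u j), (row_of x + \row_j u j *m L^T); split.
- by move=> j; rewrite mxE.
- move=> i; have := ux i; congr (`| _ | <= _); rewrite !mxE; congr (_ + _).
  by apply: eq_bigr => j _; rewrite !mxE mulrC.
- by rewrite addrK.
Qed.

(** The inverse transpose of L maps the neighbourhood into the box with sides [-1 - del K, del K],
    where K bounds the effect of that inverse on a vector of sup norm 1. The box pulls back to
    volume |det L| (1 + 2 del K)^n. *)
Let small_cover_unit n (L : 'M[R]_n) (eps : R) : 0 < eps -> L \in unitmx ->
  exists2 del, 0 < del & small_cover L del (`|\det L| + eps).
Proof.
move=> e0 uL.
pose E := invmx L^T; have uLT : L^T \in unitmx by rewrite unitmx_tr.
have uE : E \in unitmx by rewrite unitmx_inv.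
have K0 := absum_ge0 E; set K := absum E in K0.
have D0 : 0 <= `|\det L| by [].
pose c := 2 ^+ n * `|\det L| + 1.
have c0 : 0 < c by rewrite ltr_wpDl// mulr_ge0// exprn_ge0.
(* [z] bounds the widening 2 * del * K of each side. By [expr_onepz_le] the volume exceeds |det L|
   by at most 2^n |det L| z, and the summand 1 keeps [c] positive. *)
pose z := Num.min 1 (eps / c).
have z0 : 0 < z by rewrite lt_min ltr01 divr_gt0.
have z1 : z <= 1 by rewrite ge_min lexx.
have zc : z * c <= eps by rewrite -ler_pdivlMr// ge_min lexx orbT.
pose del := z / (2 * (K + 1)).
have K1 : 0 < 2 * (K + 1) by lra.
have del0 : 0 < del by rewrite divr_gt0.
have zdel : 2 * (del * K) <= z.
  have -> : 2 * (del * K) = z * (K / (K + 1)).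
    by rewrite /del; field; rewrite gt_eqF//; lra.
  by rewrite ler_piMr ?(ltW z0)// ler_pdivrMr; lra.
exists del => //.
pose B (j : 'I_n) : set (measurableTypeR R) := `[- 1 - del * K, del * K]%classic.
have mB j : measurable (B j) by exact: measurable_itv.
have [mS SE] := box_measure uE mB.
exists (affine_tuple E 0 @^-1` [set t | forall i, B i (tnth t i)]) => //; split.
- move=> x /nbhd_decomp[u [e [u01 he xE]]] i.
  rewrite tnth_mktuple addr0 xE mulmxBl -mulmxA mulmxV// mulmx1 /B /= in_itv /=.
  have := mulmx_bound E i (ltW del0) he; rewrite -/K ler_norml !mxE.
  have := u01 i; lra.
- rewrite SE (eq_bigr (fun=> (1 + 2 * (del * K))%:E)); last first.
    move=> j _; rewrite /B lebesgue_measure_itv /= lte_fin.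
    have dK : 0 <= del * K by rewrite mulr_ge0// ltW.
    have -> : - 1 - del * K < del * K by lra.
    by rewrite -EFinD; congr (_%:E); ring.
  rewrite prodEFin prodr_const card_ord -EFinM lee_fin.
  have -> : `|\det E|^-1 = `|\det L|.
    by rewrite /E det_inv det_tr normfV invrK.
  have dK : 0 <= 2 * (del * K) by rewrite mulr_ge0// mulr_ge0// ltW.
  have h : (1 + 2 * (del * K)) ^+ n <= 1 + 2 ^+ n * (2 * (del * K)).
    by apply: expr_onepz_le; apply/andP; split => //; lra.
  apply: le_trans (ler_wpM2l D0 h) _.
  rewrite mulrDr mulr1 lerD2l (le_trans _ zc)// /c.
  rewrite mulrDr mulr1 -[leLHS]addr0 lerD// ?(ltW z0)//.
  have -> : `|\det L| * (2 ^+ n * (2 * (del * K))) = 2 * (del * K) * (2 ^+ n * `|\det L|).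
    by ring.
  by rewrite ler_wpM2r// mulr_ge0// exprn_ge0.
Qed.

(** For singular L, invertible coordinates exist in which the last coordinate vanishes on the image
    of L. There the neighbourhood lies in a box of thickness 2 del K in that direction and of size
    bounded independently of del <= 1 in the others, so its volume tends to 0 with del. *)
Let small_cover_sing n (L : 'M[R]_n) (eps : R) : 0 < eps -> L \notin unitmx ->
  exists2 del, 0 < del & small_cover L del (`|\det L| + eps).
Proof.
case: n L => [|n] L e0 uL.
  by move: uL; rewrite unitmxE det_mx00 unitr1.
have detL : \det L = 0 by apply/eqP; move: uL; rewrite unitmxE unitfE negbK.
have rL : (\rank L^T < n.+1)%N.
  rewrite mxrank_tr ltn_neqAle rank_leq_row andbT.
  by apply: contra uL => /eqP rk; rewrite -row_free_unit /row_free rk.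
pose E := invmx (row_ebase L^T).
have uE : E \in unitmx by rewrite unitmx_inv row_ebase_unit.
pose C := col_ebase L^T.
have LE : L^T *m E = C *m pid_mx (\rank L^T).
  transitivity (C *m pid_mx (\rank L^T) *m row_ebase L^T *m E).
    by rewrite mulmx_ebase.
  by rewrite -mulmxA /E mulmxV ?row_ebase_unit// mulmx1.
have lastE (u : 'rV[R]_n.+1) : (u *m L^T *m E) 0 ord_max = 0.
  rewrite -mulmxA LE mulmxA mxE big1// => i _; rewrite !mxE.
  case: eqP => [->|]; rewrite /= ?mulr0//.
  by rewrite ltnNge -ltnS rL /= mulr0.
have K0 := absum_ge0 E; set K := absum E in K0.
have K'0 := absum_ge0 (L^T *m E); set K' := absum _ in K'0.
pose D := K + K' + 1.
have Dp : 0 < D by rewrite /D; lra.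
pose c := `|\det E|^-1 * (2 * D) ^+ n * (2 * K) + 1.
have detE0 : 0 <= `|\det E|^-1 by rewrite invr_ge0.
have c0 : 0 < c.
  by rewrite ltr_wpDl// !mulr_ge0// ?exprn_ge0 ?mulr_ge0// ltW.
pose del := Num.min 1 (eps / c).
have del0 : 0 < del by rewrite lt_min ltr01 divr_gt0.
have del1 : del <= 1 by rewrite ge_min lexx.
have delc : del * c <= eps by rewrite -ler_pdivlMr// ge_min lexx orbT.
exists del => //.
pose B (j : 'I_n.+1) : set (measurableTypeR R) :=
  if j == ord_max then `[- (del * K), del * K]%classic else `[- D, D]%classic.
have mB j : measurable (B j) by rewrite /B; case: ifP => _; exact: measurable_itv.
have [mS SE] := box_measure uE mB.
exists (affine_tuple E 0 @^-1` [set t | forall i, B i (tnth t i)]) => //; split.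
- move=> x /nbhd_decomp[u [e [u01 he xE]]] i.
  rewrite tnth_mktuple addr0 xE mulmxBl.
  have he' := mulmx_bound E i (ltW del0) he.
  rewrite /B; case: ifPn => [/eqP ->|_] /=; rewrite in_itv /=.
    have -> : (e *m E - u *m L^T *m E) 0 ord_max = (e *m E) 0 ord_max.
      by rewrite [LHS]mxE [X in _ + X]mxE lastE subr0.
    by rewrite -ler_norml; exact: mulmx_bound (ltW del0) he.
  have hu := @mulmx_bound _ u (L^T *m E) 1 i ler01.
  have {}hu : `|(u *m (L^T *m E)) 0 i| <= K'.
    rewrite -[leRHS]mul1r; apply: hu => j; have /andP[u0 u1] := u01 j.
    by rewrite ger0_norm.
  rewrite -ler_norml -mulmxA mxE [X in _ + X]mxE (le_trans (ler_normB _ _))//.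
  rewrite /D -addrA lerD//; last by rewrite (le_trans hu)// lerDl.
  by rewrite (le_trans he')// ler_piMl.
- rewrite SE detL normr0 add0r (bigD1 ord_max)//=.
  have dK : 0 <= del * K by rewrite mulr_ge0// ltW.
  have lebB a : 0 <= a -> leb `[- a, a]%classic = (2 * a)%:E.
    move=> a0; rewrite lebesgue_measure_itv /= lte_fin; case: ltP => aa.
      by rewrite -EFinD; congr (_%:E); ring.
    by rewrite (_ : a = 0) ?mulr0//; lra.
  rewrite {1}/B eqxx lebB// (eq_bigr (fun=> (2 * D)%:E)); last first.
    by move=> j /negbTE jm; rewrite /B jm lebB// ltW.
  rewrite prodEFin prodr_const cardC1 card_ord /= -!EFinM lee_fin.
  apply: le_trans delc.
  have -> : `|\det E|^-1 * (2 * (del * K) * (2 * D) ^+ n) =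
    del * (`|\det E|^-1 * (2 * D) ^+ n * (2 * K)) by ring.
  by rewrite ler_wpM2l ?(ltW del0)// lerDl.
Qed.

Lemma small_cover_exists n (L : 'M[R]_n) (eps : R) : 0 < eps ->
  exists2 del, 0 < del & small_cover L del (`|\det L| + eps).
Proof.
move=> e0; have [uL|uL] := boolP (L \in unitmx); first exact: small_cover_unit.
exact: small_cover_sing.
Qed.

(** One width serves all matrices with entries bounded by M: a cover for L0 also covers narrower
    neighbourhoods for every L near L0, the determinant is continuous, and the set of bounded
    matrices is compact. The covering property is tested along the widths 1 / (k + 1). *)
Lemma uniform_small_cover n (M eps : R) : 0 < eps ->
  exists2 del, 0 < del & forall L : 'M[R]_n, (forall i j, `|L i j| <= M) ->
    small_cover L del (`|\det L| + eps).
Proof.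
move=> e0.
have cdet : continuous (fun v : 'rV[R]_(n * n) => \det (vec_mx v : 'M[R]_n) : R).
  rewrite /determinant; apply: continuous_big => [|s _]; first exact: add_continuous.
  have cprod : continuous (fun v : 'rV[R]_(n * n) => \prod_i (vec_mx v : 'M[R]_n) i (s i) : R).
    apply: continuous_big => [|i _]; first exact: mul_continuous.
    under eq_fun do rewrite mxE.
    exact: coord_continuous.
  move=> v.
  exact: (@cvgMl_tmp R _ (nbhs v) _ _ ((-1) ^+ s) _ (cprod v)).
pose K : set 'rV[R]_(n * n) := [set v | forall k, `[- M, M]%classic (v ord0 k)].
have cK : compact K.
  by apply: (@rV_compact _ _ (fun=> `[- M, M]%classic)) => k; exact: segment_compact.
have /compact_near_coveringP := cK.
move=> /(_ nat \oo%classic (fun k v => small_cover (vec_mx v : 'M[R]_n) k.+1%:R^-1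
   (`|\det (vec_mx v : 'M[R]_n)| + eps))).
case.
  move=> v0 _.
  have e2 : 0 < eps / 2 by rewrite divr_gt0.
  have [del del0 [S mS [subS lamS]]] := small_cover_exists (vec_mx v0 : 'M[R]_n) e2.
  (* Changing the entries of L by eta moves each coordinate of L u by at most n eta <= del / 2; the
     successor keeps the quotient meaningful for n = 0. *)
  pose eta := del / 2 / n.+1%:R.
  have eta0 : 0 < eta by rewrite !divr_gt0// ltr0n.
  have h1 : \forall v \near v0, forall k, `|v0 0 k - (v : 'rV[R]_(n * n)) 0 k| < eta.
    apply: (@filter_forall _ _ _ (nbhs v0)) => k.
    have := @coord_continuous R 1 (n * n) 0 k v0 => /cvgrPdist_lt /(_ _ eta0).
    exact.
  have h2 : \forall v \near v0, `|\det (vec_mx v0 : 'M[R]_n) - \det (vec_mx v : 'M[R]_n)| < eps / 2.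
    by have /cvgrPdist_lt/(_ _ e2) := cdet v0.
  have h3 : \forall k \near \oo, k.+1%:R^-1 <= del / 2 :> R.
    exists (Num.truncn (del / 2)^-1) => // k /= hk.
    have d2 : 0 < del / 2 by rewrite divr_gt0.
    rewrite -[leRHS]invrK lef_pV2 ?posrE ?invr_gt0// ?ltr0n//.
    by apply/ltW/(lt_le_trans (truncnS_gt _)); rewrite ler_nat ltnS.
  exists ([set v : 'rV[R]_(n * n) | (forall k, `|v0 0 k - v 0 k| < eta) /\
    `|\det (vec_mx v0 : 'M[R]_n) - \det (vec_mx v : 'M[R]_n)| < eps / 2],
    [set k | k.+1%:R^-1 <= del / 2 :> R]).
    by split => //=; apply: filterI.
  move=> [v k] /= [[hv hd] hk]; exists S => //; split; last first.
    rewrite (le_trans lamS)// lee_fin.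
    have := ler_dist_dist (\det (vec_mx v0 : 'M[R]_n)) (\det (vec_mx v : 'M[R]_n)).
    by move=> /(ler_normlW) ; lra.
  apply: subset_trans subS => x [u [u01 ux]]; exists u; split => // i.
  have -> : tnth x i + \sum_j (vec_mx v0 : 'M[R]_n) i j * u j =
    tnth x i + \sum_j (vec_mx v : 'M[R]_n) i j * u j +
    \sum_j ((vec_mx v0 : 'M[R]_n) i j - (vec_mx v : 'M[R]_n) i j) * u j.
    rewrite -addrA -big_split; congr (_ + _); apply: eq_bigr => j _ /=.
    by rewrite -mulrDl addrC subrK.
  rewrite (le_trans (ler_normD _ _))//.
  have -> : del = del / 2 + del / 2 by field.
  rewrite lerD ?(le_trans (ux i))// (le_trans (ler_norm_sum _ _ _))//.
  apply: (@le_trans _ _ (\sum_(j < n) eta)).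
    apply: ler_sum => j _; rewrite normrM !mxE -[leRHS]mulr1 ler_pM ?(ltW (hv _))//.
    by have /andP[u0 u1] := u01 j; rewrite ger0_norm.
  rewrite sumr_const card_ord -[_ *+ n]mulr_natr.
  apply: (@le_trans _ _ (eta * n.+1%:R)); last by rewrite /eta divfK// pnatr_eq0.
  by rewrite ler_wpM2l ?(ltW eta0)// ler_nat.
move=> k0 _ hk0; exists k0.+1%:R^-1; first by rewrite invr_gt0 ltr0n.
move=> L LM; have := hk0 k0 (leqnn _) (mxvec L).
rewrite mxvecK; apply => k /=.
case/mxvec_indexP: k => i j; rewrite mxvecE in_itv /= -ler_norml; exact: LM.
Qed.

End parallelepiped.

(** * The Gaussian system at a point *)

Lemma expR_taylor1 (R : realType) (t : R) : `|expR t - 1 - t| <= t ^+ 2 * expR `|t|.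
Proof.
have h1 := expR_ge1Dx t; have h2 := expR_ge1Dx (- t).
have et := expR_gt0 t.
have e1 : expR t - 1 <= t * expR t.
  have : (1 - t) * expR t <= expR (- t) * expR t by rewrite ler_wpM2r ?expR_ge0.
  by rewrite -expRD addNr expR0; lra.
rewrite ger0_norm; last by lra.
have [t0|t0] := leP 0 t.
  apply: (@le_trans _ _ (t * (expR t - 1))); first by rewrite mulrBr mulr1; lra.
  by rewrite (ger0_norm t0) expr2 -mulrA ler_wpM2l.
rewrite (ltr0_norm t0).
apply: (@le_trans _ _ (t ^+ 2)); last by rewrite ler_peMr ?sqr_ge0//; lra.
have : 0 <= (- t) * (expR t - 1 - t) by rewrite mulr_ge0; lra.
by rewrite expr2; nra.
Qed.

Section support.
Context {R : realType} {n : nat}.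
Variables (A : {fset 'rV[int]_n}) (C : 'M[R]_#|{: A}|).
Implicit Types (p x : n.-tuple R) (a b : A) (j k : 'I_n).

Let cov a : R := C (enum_rank a) (enum_rank a).

Definition exponent a j : R := (val a 0 j)%:~R.
Definition pairing a p : R := \sum_j exponent a j * tnth p j.
Definition kernel p : R := \sum_a cov a * expR (2 * pairing a p).
Definition weight p a : R := cov a * expR (2 * pairing a p) / kernel p.
Definition barycenter p j : R := \sum_a weight p a * exponent a j.

(* In the rescaled monomial basis [normalized_eval] is the coefficient vector of
   the standard normal variable f(exp p)/sqrt(kernel p), and [normalized_diff]
   that of its j-th logarithmic derivative. *)
Definition normalized_eval p a : R := expR (pairing a p) / Num.sqrt (kernel p).
Definition normalized_diff p j a : R :=
  normalized_eval p a * (exponent a j - barycenter p j).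
Definition weight_cov p j k : R :=
  \sum_a weight p a * ((exponent a j - barycenter p j) * (exponent a k - barycenter p k)).

Definition support_bound : R := \sum_a \sum_j `|exponent a j|.

Lemma exponent_le a j : `|exponent a j| <= support_bound.
Proof.
rewrite /support_bound (bigD1 a)//= (bigD1 j)//= -addrA lerDl addr_ge0// sumr_ge0// => b _.
exact: sumr_ge0.
Qed.

Lemma support_bound_ge0 : 0 <= support_bound.
Proof. by apply: sumr_ge0 => a _; apply: sumr_ge0. Qed.

Lemma pairingB a p x : pairing a x - pairing a p = \sum_j exponent a j * (tnth x j - tnth p j).
Proof. by rewrite -sumrB; apply: eq_bigr => j _; rewrite mulrBr. Qed.

Hypothesis A0 : A != fset0.
Hypothesis cov_gt0 : forall a, 0 < cov a.

Lemma kernel_gt0 p : 0 < kernel p.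
Proof.
have /fset0Pn[a aA] := A0; rewrite /kernel (bigD1 [` aA]%fset)//=.
by rewrite ltr_wpDr ?mulr_gt0 ?expR_gt0// sumr_ge0// => b _; rewrite mulr_ge0 ?expR_ge0// ltW.
Qed.
Let kernel_neq0 p : kernel p != 0. Proof. by rewrite gt_eqF// kernel_gt0. Qed.

Lemma weight_gt0 p a : 0 < weight p a.
Proof. by rewrite divr_gt0 ?kernel_gt0// mulr_gt0// expR_gt0. Qed.

Lemma sum_weight p : \sum_a weight p a = 1.
Proof. by rewrite /weight -mulr_suml -/(kernel p) mulfV. Qed.

Lemma barycenter_le p j : `|barycenter p j| <= support_bound.
Proof.
rewrite (le_trans (ler_norm_sum _ _ _))//.
apply: (@le_trans _ _ (\sum_a weight p a * support_bound)).
  apply: ler_sum => a _; rewrite normrM gtr0_norm ?weight_gt0//.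
  by rewrite ler_wpM2l ?exponent_le// ltW// weight_gt0.
by rewrite -mulr_suml sum_weight mul1r.
Qed.

Lemma sum_weight_centered p j : \sum_a weight p a * (exponent a j - barycenter p j) = 0.
Proof.
under eq_bigr do rewrite mulrBr.
by rewrite sumrB -mulr_suml sum_weight mul1r subrr.
Qed.

Lemma sqr_normalized_eval p a : normalized_eval p a ^+ 2 * cov a = weight p a.
Proof.
rewrite exprMn exprVn sqr_sqrtr ?(ltW (kernel_gt0 p))// -expRM_natl /weight; ring.
Qed.

Lemma normalized_eval_ge0 p a : 0 <= normalized_eval p a.
Proof. by rewrite divr_ge0 ?expR_ge0. Qed.

(** The square times the variance of the coefficient is a weight, hence at most 1. This makes all
    Taylor constants below independent of p. *)
Lemma normalized_eval_le p a : normalized_eval p a <= (Num.sqrt (cov a))^-1.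
Proof.
have cp := cov_gt0 a.
rewrite -(ler_pXn2r (n := 2))// ?nnegrE ?normalized_eval_ge0//.
rewrite exprVn sqr_sqrtr ?(ltW cp)// -(ler_pM2r cp) mulVf ?gt_eqF// sqr_normalized_eval.
rewrite -(sum_weight p) (bigD1 a)//= lerDl sumr_ge0// => b _.
exact/ltW/weight_gt0.
Qed.

Lemma form_cov_normalized_eval p : form_cov C (normalized_eval p) (normalized_eval p) = 1.
Proof.
by rewrite -(sum_weight p); apply: eq_bigr => a _; rewrite -expr2 sqr_normalized_eval.
Qed.

Lemma form_cov_normalized_evaldiff p j :
  form_cov C (normalized_eval p) (normalized_diff p j) = 0.
Proof.
rewrite -(sum_weight_centered p j); apply: eq_bigr => a _.
by rewrite -sqr_normalized_eval /normalized_diff /cov; ring.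
Qed.

Lemma form_cov_normalized_diff p j k :
  form_cov C (normalized_diff p j) (normalized_diff p k) = weight_cov p j k.
Proof.
apply: eq_bigr => a _.
by rewrite -sqr_normalized_eval /normalized_diff /cov; ring.
Qed.

(* Lagrange's identity; it makes the sign of the expected squared determinant
   visible term by term. *)
Lemma weight_cov_pairs p j k : weight_cov p j k = \sum_(ab : A * A)
  2^-1 * (weight p ab.1 * weight p ab.2) *
    ((exponent ab.1 j - exponent ab.2 j) * (exponent ab.1 k - exponent ab.2 k)).
Proof.
pose u a := exponent a j - barycenter p j; pose v a := exponent a k - barycenter p k.
rewrite -(pair_bigA _ (fun a b => 2^-1 * (weight p a * weight p b) *
    ((exponent a j - exponent b j) * (exponent a k - exponent b k)))) /=.
transitivity (\sum_a (2^-1 * (weight p a * (u a * v a)) + 2^-1 * (weight p a * weight_cov p j k))).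
  rewrite big_split /= -!mulr_sumr -mulr_suml sum_weight mul1r -/(weight_cov p j k).
  by field.
apply: eq_bigr => a _.
have -> : weight p a * (u a * v a) = \sum_b weight p b * (weight p a * (u a * v a)).
  by rewrite -mulr_suml sum_weight mul1r.
have hu : \sum_b weight p b * u b = 0 by exact: sum_weight_centered.
have hv : \sum_b weight p b * v b = 0 by exact: sum_weight_centered.
transitivity (\sum_b (2^-1 * (weight p b * (weight p a * (u a * v a))) +
   2^-1 * (weight p a * (weight p b * (u b * v b))) -
   2^-1 * weight p a * u a * (weight p b * v b) -
   2^-1 * weight p a * v a * (weight p b * u b))).
  rewrite !sumrB big_split /= -!mulr_sumr hu hv !mulr0 !subr0.
  by rewrite -/(weight_cov p j k).
by apply: eq_bigr => b _; rewrite /u /v; ring.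
Qed.

Let pairing_diff_le a p x h : (forall j, `|tnth x j - tnth p j| <= h) ->
  `|pairing a x - pairing a p| <= n%:R * support_bound * h.
Proof.
move=> hx; rewrite pairingB (le_trans (ler_norm_sum _ _ _))//.
apply: (@le_trans _ _ (\sum_(j < n) support_bound * h)).
  by apply: ler_sum => j _; rewrite normrM ler_pM// exponent_le.
by rewrite sumr_const card_ord -[leLHS]mulr_natl mulrA.
Qed.

(** A multiplicative Harnack-type estimate: each exponential, and hence the kernel, changes by at
    most a factor exp(2 n S h), with S the support bound, and the quotient by its square. *)
Lemma weight_slow p x h a : (forall j, `|tnth x j - tnth p j| <= h) ->
  weight p a <= expR (4 * n%:R * support_bound * h) * weight x a.
Proof.
move=> hx.
have H (q y : n.-tuple R) b : (forall j, `|tnth y j - tnth q j| <= h) ->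
    expR (2 * pairing b q) <= expR (2 * n%:R * support_bound * h) * expR (2 * pairing b y).
  move=> hy; rewrite -expRD ler_expR.
  have := pairing_diff_le b hy; rewrite ler_norml => /andP[]; lra.
have hx' j : `|tnth p j - tnth x j| <= h by rewrite distrC.
set E := expR (2 * n%:R * support_bound * h).
have -> : expR (4 * n%:R * support_bound * h) = E * E.
  by rewrite -expRD; congr expR; ring.
have kx : kernel x <= E * kernel p.
  rewrite mulr_sumr; apply: ler_sum => b _.
  by rewrite mulrCA ler_wpM2l ?(ltW (cov_gt0 b))//; exact: H.
have kp0 := kernel_gt0 p; have kx0 := kernel_gt0 x.
have E0 : 0 < E by exact: expR_gt0.
rewrite /weight ler_pdivrMr//.
have -> : E * E * (cov a * expR (2 * pairing a x) / kernel x) * kernel p =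
   cov a * ((E * expR (2 * pairing a x)) * ((E * kernel p) / kernel x)) by ring.
rewrite ler_wpM2l ?(ltW (cov_gt0 a))//.
apply: (@le_trans _ _ (E * expR (2 * pairing a x))); first exact: H.
by rewrite ler_peMr ?mulr_ge0 ?expR_ge0// ler_pdivlMr// mul1r.
Qed.

Lemma normalized_diff_le p j a :
  `|normalized_diff p j a| <= 2 * support_bound * (Num.sqrt (cov a))^-1.
Proof.
rewrite normrM mulrC ler_pM ?normr_ge0//.
  rewrite (le_trans (ler_normB _ _))// mulrDl mul1r lerD ?exponent_le//.
  exact: barycenter_le.
by rewrite ger0_norm ?normalized_eval_ge0// normalized_eval_le.
Qed.

(* Multiplying by exp(-m.(x-p)), m the barycenter, makes the second order
   remainder bounded independently of p. *)
Lemma normalized_taylor p x h (c : A -> R) (Rb : R) : 0 <= h <= 1 ->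
  (forall j, `|tnth x j - tnth p j| <= h) ->
  (forall a, `|c a| <= Rb) -> \sum_a c a * expR (pairing a x) = 0 ->
  `|\sum_a normalized_eval p a * c a +
    \sum_j (\sum_a normalized_diff p j a * c a) * (tnth x j - tnth p j)| <=
  (\sum_a Rb * (Num.sqrt (cov a))^-1) *
    ((2 * n%:R * support_bound) ^+ 2 * expR (2 * n%:R * support_bound)) * h ^+ 2.
Proof.
move=> /andP[h0 h1] hx hc c0.
pose B := 2 * n%:R * support_bound.
have B0 : 0 <= B by rewrite !mulr_ge0// support_bound_ge0.
pose m := \sum_j barycenter p j * (tnth x j - tnth p j).
pose s a := pairing a x - pairing a p - m.
have sE a : s a = \sum_j (exponent a j - barycenter p j) * (tnth x j - tnth p j).
  rewrite /s pairingB -sumrB; apply: eq_bigr => j _; ring.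
have sle a : `|s a| <= B * h.
  rewrite sE (le_trans (ler_norm_sum _ _ _))//.
  apply: (@le_trans _ _ (\sum_(j < n) 2 * support_bound * h)).
    apply: ler_sum => j _; rewrite normrM ler_pM//.
    rewrite (le_trans (ler_normB _ _))// mulrDl mul1r lerD ?exponent_le//.
    exact: barycenter_le.
  rewrite sumr_const card_ord -[_ *+ n]mulr_natl /B le_eqVlt; apply/orP; left; apply/eqP; ring.
(* The equation of a root at x, divided by [expR m * Num.sqrt (kernel p)]. *)
have e0 : \sum_a normalized_eval p a * c a * expR (s a) = 0.
  transitivity ((expR m)^-1 / Num.sqrt (kernel p) * \sum_a c a * expR (pairing a x)).
    rewrite mulr_sumr; apply: eq_bigr => a _.
    rewrite /s expRD expRN expRD expRN /normalized_eval.
    by field; rewrite !gt_eqF// ?expR_gt0// sqrtr_gt0 kernel_gt0.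
  by rewrite c0 mulr0.
have -> : \sum_a normalized_eval p a * c a +
    \sum_j (\sum_a normalized_diff p j a * c a) * (tnth x j - tnth p j) =
    - \sum_a normalized_eval p a * c a * (expR (s a) - 1 - s a).
  apply/eqP; rewrite -subr_eq0 opprK; apply/eqP.
  have -> : \sum_j (\sum_a normalized_diff p j a * c a) * (tnth x j - tnth p j) =
      \sum_a normalized_eval p a * c a * s a.
    under eq_bigr do rewrite mulr_suml.
    rewrite exchange_big; apply: eq_bigr => a _ /=; rewrite sE mulr_sumr.
    by apply: eq_bigr => j _; rewrite /normalized_diff; ring.
  rewrite -big_split -[RHS]e0 -big_split; apply: eq_bigr => a _ /=; ring.
rewrite normrN (le_trans (ler_norm_sum _ _ _))// !mulr_suml ler_sum// => a _.
rewrite normrM -[leRHS]mulrA.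
have Rb0 : 0 <= Rb by rewrite (le_trans _ (hc a)).
apply: ler_pM => //.
  by rewrite normrM mulrC ler_pM// ger0_norm ?normalized_eval_ge0// normalized_eval_le.
rewrite (le_trans (expR_taylor1 _))//.
apply: (@le_trans _ _ ((B * h) ^+ 2 * expR B)).
  rewrite ler_pM ?sqr_ge0 ?expR_ge0//.
    rewrite -[s a ^+ 2 <= _]subr_ge0 subr_sqr.
    by have := sle a; rewrite ler_norml => /andP[? ?]; rewrite mulr_ge0//; lra.
  by rewrite ler_expR (le_trans (sle a))// ler_piMr.
by rewrite exprMn -/B le_eqVlt; apply/orP; left; apply/eqP; ring.
Qed.

End support.

(** Distributivity with dependent choice functions, as each equation has its own support. *)
Lemma prod_sum_fprod (R : comPzSemiRingType) (I : finType) (T_ : I -> finType)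
    (F : forall i, T_ i -> R) :
  \prod_i \sum_(j : T_ i) F i j = \sum_(t : fprod T_) \prod_i F i (t i).
Proof.
pose G i := [ffun j => F i j].
transitivity (\prod_i \sum_(j : T_ i) G i j).
  by apply: eq_bigr => i _; apply: eq_bigr => j _; rewrite ffunE.
transitivity (\sum_(t : fprod T_) \prod_(i in I) G i (t i)); last first.
  by apply: eq_bigr => t _; apply: eq_bigr => i _; rewrite ffunE.
rewrite (big_fprod (times := *%R) _ _ G) /=.
under eq_bigr do rewrite (big_tag (fun i => G i)).
by rewrite bigA_distr_big_dep.
Qed.

(** * The expected squared Jacobian and its slow variation *)

Section jacobian.
Context {R : realType} {n : nat}.
Variables (A : 'I_n -> {fset 'rV[int]_n}) (C : forall i, 'M[R]_#|{: A i}|).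
Implicit Types p x : n.-tuple R.

(** The Leibniz expansion of E det(Lambda)^2 for independent rows with covariances [weight_cov].
    Equivalently, n! times the mixed discriminant of these covariance matrices, which is how it
    arises from the wedge product. *)
Definition sqr_det_mean p : R := \sum_(s : 'S_n) \sum_(t : 'S_n)
  (-1) ^+ s * (-1) ^+ t * \prod_i weight_cov (C i) p (s i) (t i).

Lemma sqr_det_perm (M : 'M[R]_n) : \det M ^+ 2 = \sum_(s : 'S_n) \sum_(t : 'S_n)
  (-1) ^+ s * (-1) ^+ t * \prod_i (M i (s i) * M i (t i)).
Proof.
rewrite expr2 mulr_suml; apply: eq_bigr => s _.
rewrite mulr_sumr; apply: eq_bigr => t _.
by rewrite big_split /= mulrACA.
Qed.

Hypothesis A0 : forall i, A i != fset0.
Hypothesis C_gt0 : forall i (a : A i), 0 < C i (enum_rank a) (enum_rank a).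

Let pairs (i : 'I_n) : finType := (A i * A i)%type.
Let pair_weight p i (ab : A i * A i) : R :=
  2^-1 * (weight (C i) p ab.1 * weight (C i) p ab.2).
Let pair_det (f : fprod pairs) : R :=
  \det (\matrix_(i, j) (exponent (f i).1 j - exponent (f i).2 j)).

(** Inserting Lagrange's identity in each factor and summing over the permutations first leaves
    squares of determinants of exponent differences with positive weights. Nonnegativity, slow
    variation and measurability are all read off from this form. *)
Let sqr_det_meanE p :
  sqr_det_mean p = \sum_(f : fprod pairs) (\prod_i pair_weight p (f i)) * pair_det f ^+ 2.
Proof.
under [RHS]eq_bigr do rewrite /pair_det sqr_det_perm mulr_sumr.
rewrite exchange_big; apply: eq_bigr => s _ /=.
under [RHS]eq_bigr do rewrite mulr_sumr.
rewrite exchange_big; apply: eq_bigr => t _ /=.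
under eq_bigr do rewrite weight_cov_pairs//.
rewrite prod_sum_fprod mulr_sumr; apply: eq_bigr => f _.
rewrite mulrCA -big_split; congr (_ * _); apply: eq_bigr => i _ /=.
by rewrite !mxE.
Qed.

Let pair_weight_ge0 p i (ab : A i * A i) : 0 <= pair_weight p ab.
Proof. by rewrite /pair_weight mulr_ge0 ?invr_ge0// mulr_ge0// ltW// weight_gt0. Qed.

Lemma sqr_det_mean_ge0 p : 0 <= sqr_det_mean p.
Proof.
rewrite sqr_det_meanE; apply: sumr_ge0 => f _.
apply: mulr_ge0; last exact: sqr_ge0.
by apply: prodr_ge0 => i _; exact: pair_weight_ge0.
Qed.

(** Each row contributes two weights to a term of [sqr_det_meanE], and each weight the rate 4 n S of
    [weight_slow]. *)
Definition slow_rate : R := \sum_i 8 * n%:R * support_bound (R := R) (A i).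

Lemma slow_rate_ge0 : 0 <= slow_rate.
Proof. by apply: sumr_ge0 => i _; rewrite !mulr_ge0// support_bound_ge0. Qed.

Lemma sqr_det_mean_slow p x h : (forall j, `|tnth x j - tnth p j| <= h) ->
  sqr_det_mean p <= expR (slow_rate * h) * sqr_det_mean x.
Proof.
move=> hx; rewrite !sqr_det_meanE mulr_sumr; apply: ler_sum => f _.
rewrite mulrA ler_wpM2r ?sqr_ge0//.
rewrite /slow_rate mulr_suml expR_sum -big_split /=.
apply: ler_prod => i _; rewrite pair_weight_ge0 /pair_weight/= [leRHS]mulrCA.
rewrite ler_wpM2l//.
pose E := expR (4 * n%:R * support_bound (R := R) (A i) * h).
have -> : expR (8 * n%:R * support_bound (R := R) (A i) * h) = E * E.
  by rewrite -expRD; congr expR; ring.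
have w0 q (a : A i) : 0 <= weight (C i) q a by exact/ltW/weight_gt0.
by rewrite [leRHS]mulrACA; apply: ler_pM => //; exact: weight_slow.
Qed.

Lemma measurable_sqr_det_mean :
  measurable_fun setT (sqr_det_mean : n.-tuple (measurableTypeR R) -> R).
Proof.
have mpair i (a : A i) : measurable_fun setT (pairing a : n.-tuple (measurableTypeR R) -> R).
  rewrite /pairing; apply: measurable_sum => j.
  by apply: measurable_funM => //; exact: measurable_tnth.
have mexp i (a : A i) : measurable_fun setT
    ((fun p => C i (enum_rank a) (enum_rank a) * expR (2 * pairing a p)) : n.-tuple
      (measurableTypeR R) -> R).
  apply: measurable_funM => //; apply: measurableT_comp => //.
  exact: measurable_funM.
have mw i (a : A i) : measurable_fun setT ((weight (C i))^~ a : n.-tuple (measurableTypeR R) -> R).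
  have -> : (weight (C i))^~ a = (fun p => (C i (enum_rank a) (enum_rank a) * expR
    (2 * pairing a p)) *
     expR (- ln (kernel (C i) p))).
    by apply/funext => p; rewrite expRN lnK// posrE kernel_gt0.
  apply: measurable_funM => //; apply: measurableT_comp => //.
  apply: measurableT_comp => //; apply: measurableT_comp => //.
  by apply: measurable_sum => b; exact: mexp.
have -> : sqr_det_mean = (fun p => \sum_(f : fprod pairs) (\prod_i pair_weight p
  (f i)) * pair_det f ^+ 2).
  by apply/funext => p; exact: sqr_det_meanE.
apply: measurable_sum => f; apply: measurable_funM => //.
apply: measurable_prod => i _; apply: measurable_funM => //.
exact: measurable_funM.
Qed.

End jacobian.

(** * Probability of a root in a small cube *)

Lemma normal_prob_le_lebesgue (R : realType) (V : set R) : measurable V ->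
  (normal_prob 0 1 V <= (normal_peak 1 : R)%:E * @lebesgue_measure R V)%E.
Proof.
move=> mV; rewrite /normal_prob.
apply: (@le_trans _ _ (\int[lebesgue_measure]_(x in V) (normal_peak 1 : R)%:E)%E); last first.
  by rewrite integral_cst.
apply: ge0_le_integral => //.
- by move=> x _; rewrite lee_fin normal_pdf_ge0.
- apply/measurable_EFinP; apply: measurable_funTS; exact: measurable_normal_pdf.
- by move=> x _; rewrite lee_fin normal_pdf_ub.
Qed.

Section generated.
Context {d} {T : measurableType d} {R : realType} (P : probability T R).

Lemma sigma_generated_linear_form (I : finType) (X : I -> {RV P >-> R}) t (V : set R) :
  measurable V -> sigma_generated X (linear_form X t @^-1` V).
Proof.
move=> mV.
pose G := [set E | exists a (V : set R), measurable V /\ E = X a @^-1` V].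
have mX a : measurable_fun setT (X a : g_sigma_algebraType G -> R).
  by move=> _ B mB; rewrite setTI; apply: sub_sigma_algebra; exists a, B.
have : measurable_fun setT (linear_form X t : g_sigma_algebraType G -> R).
  by apply: measurable_sum => a; apply: measurable_funM => //; exact: mX.
by move=> /(_ measurableT _ mV); rewrite setTI.
Qed.

Lemma sigma_generatedI (I : finType) (X : I -> {RV P >-> R}) E F :
  sigma_generated X E -> sigma_generated X F -> sigma_generated X (E `&` F).
Proof.
pose G := [set E | exists a (V : set R), measurable V /\ E = X a @^-1` V].
exact: (@measurableI _ (g_sigma_algebraType G)).
Qed.

Lemma sigma_generated_bigcap (I J : finType) (X : I -> {RV P >-> R}) (E : J -> set T) :
  (forall j, sigma_generated X (E j)) -> sigma_generated X (\bigcap_j E j).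
Proof.
pose G := [set E | exists a (V : set R), measurable V /\ E = X a @^-1` V].
by move=> h; apply: (@fin_bigcap_measurable _ (g_sigma_algebraType G)) => // j _; exact: h.
Qed.

Lemma independent_sigmaT n (S : 'I_n -> set (set T)) (E : 'I_n -> set T) :
  independent_sigma P S -> (forall i, S i (E i)) ->
  P (\bigcap_i E i) = (\prod_i P (E i))%E.
Proof.
move=> /(_ [set: 'I_n]%SET E) + hE => /(_ (fun i _ => hE i)) h.
have -> : \bigcap_i E i = \bigcap_(i in [set` [set: 'I_n]%SET]) E i.
  by apply/seteqP; split => w hw i _; apply: hw => //=; rewrite inE.
by rewrite h; apply: eq_bigl => i; rewrite inE.
Qed.

End generated.

Section local_estimate.
Context {R : realType} {n : nat}.
Variables (A : 'I_n -> {fset 'rV[int]_n}) (C : forall i, 'M[R]_#|{: A i}|).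
Context d (T : measurableType d) (P : probability T R).
Variable c : forall i, A i -> {RV P >-> R}.
Arguments c : clear implicits.
Hypothesis A0 : forall i, A i != fset0.
Hypothesis Cdiag : forall i, is_diag_mx (C i).
Hypothesis C_gt0 : forall i (a : A i), 0 < C i (enum_rank a) (enum_rank a).
Hypothesis hc : random_system C c.
Implicit Types p x : n.-tuple R.

Let gc i : gaussian_vector (c i) (fun=> 0) (C i). Proof. exact: hc.1. Qed.

(** [value] and [deriv] are xi_i and Lambda_ij of the overview. [derivs] flattens Lambda into a
    tuple, the type that carries the product sigma-algebra, and [mx_of] restores the matrix. *)
Let value p i w : R := linear_form (c i) (normalized_eval (C i) p) w.
Let deriv p i j w : R := linear_form (c i) (normalized_diff (C i) p j) w.
Let entry := #|{: 'I_n * 'I_n}|.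
Let derivs p w : entry.-tuple (measurableTypeR R) :=
  [tuple deriv p (enum_val k).1 (enum_val k).2 w | k < entry].
Let mx_of (z : entry.-tuple R) : 'M[R]_n := \matrix_(i, j) tnth z (enum_rank (i, j)).

Let mx_of_derivs p w i j : mx_of (derivs p w) i j = deriv p i j w.
Proof. by rewrite mxE tnth_mktuple enum_rankK. Qed.

Let mvalue p i : measurable_fun setT (value p i).
Proof. exact: measurable_linear_form. Qed.
Let mderiv p i j : measurable_fun setT (deriv p i j).
Proof. exact: measurable_linear_form. Qed.
Let mderivs p : measurable_fun setT (derivs p).
Proof. by apply/measurable_fun_tnthP => k; apply: eq_measurable_fun (mderiv p (enum_val k).1
  (enum_val k).2) => w _ /=; rewrite tnth_mktuple. Qed.

Let value_law p i V : measurable V -> P (value p i @^-1` V) = normal_prob 0 1 V.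
Proof.
apply: linear_form_std (gc i) (Cdiag i) _ _ _.
exact: form_cov_normalized_eval.
Qed.

(** Two sources of independence: different rows come from independent coefficient vectors, and
    within a row xi_i is uncorrelated with the Lambda_ij by the centring at the barycenter. *)
Let value_derivs_indep p : indep_with P (value p) (derivs p).
Proof.
apply: eq_indep_with_tuple => [i|k|B B' mB mB'] //.
pose D i j := deriv p i j @^-1` B' (enum_rank (i, j)).
have DE : \bigcap_k (deriv p (enum_val k).1 (enum_val k).2 @^-1` B' k) =
    \bigcap_i \bigcap_j D i j.
  apply/seteqP; split => w h.
    by move=> i _ j _; have := h (enum_rank (i, j)) Logic.I; rewrite enum_rankK.
  move=> k _; have := h (enum_val k).1 Logic.I (enum_val k).2 Logic.I.
  by rewrite /D -surjective_pairing enum_valK.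
have gD i : sigma_generated (c i) (\bigcap_j D i j).
  by apply: sigma_generated_bigcap => j; exact: sigma_generated_linear_form.
rewrite DE -bigcapI (independent_sigmaT hc.2); last first.
  move=> i; apply: sigma_generatedI (gD i).
  exact: (@sigma_generated_linear_form _ _ _ _ _ (c i) (normalized_eval (C i) p)).
rewrite (independent_sigmaT hc.2 gD) -big_split; apply: eq_bigr => i _ /=.
rewrite value_law//; apply: (gaussian_uncorrelated_indep (gc i) (Cdiag i)) => //.
- exact: form_cov_normalized_eval.
- by move=> j; exact: form_cov_normalized_evaldiff.
Qed.

Let deriv_prod_indep p (s t : 'S_n) :
  indep_with P (fun i w => deriv p i (s i) w * deriv p i (t i) w) (cst 1 : T -> R).
Proof.
move=> B D mB mD; have [D1|D1] := pselect (D 1).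
  have -> : (cst 1 : T -> R) @^-1` D = setT by apply/seteqP; split.
  rewrite setIT probability_setT mule1; apply: (independent_sigmaT hc.2) => i.
  pose G := [set E | exists a (V : set R), measurable V /\ E = c i a @^-1` V].
  have mG j : measurable_fun setT (deriv p i j : g_sigma_algebraType G -> R).
    by move=> _ V mV; rewrite setTI; exact: sigma_generated_linear_form.
  have : measurable_fun setT ((fun w => deriv p i (s i) w * deriv p i (t i) w) :
     g_sigma_algebraType G -> R) by exact: measurable_funM.
  by move=> /(_ measurableT _ (mB i)); rewrite setTI.
have -> : (cst 1 : T -> R) @^-1` D = set0 by apply/seteqP; split.
by rewrite setI0 measure0 mule0.
Qed.

(** In the Leibniz expansion of the squared determinant each row occurs in exactly two entries, so
    the independence of rows factors the expectation into entry covariances. *)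
Let sqr_det_integral p :
  P.-integrable setT (fun w => (\det (mx_of (derivs p w)) ^+ 2)%:E) /\
  (\int[P]_w (\det (mx_of (derivs p w)) ^+ 2)%:E = (sqr_det_mean C p)%:E)%E.
Proof.
have H (s t : 'S_n) :
    P.-integrable setT (fun w => (\prod_i (deriv p i (s i) w * deriv p i (t i) w))%:E) /\
    (\int[P]_w (\prod_i (deriv p i (s i) w * deriv p i (t i) w))%:E =
      (\prod_i weight_cov (C i) p (s i) (t i))%:E)%E.
  have m1 i : measurable_fun setT (fun w => deriv p i (s i) w * deriv p i (t i) w).
    exact: measurable_funM.
  have i1 i : P.-integrable setT (fun w => (deriv p i (s i) w * deriv p i (t i) w)%:E).
    exact: (linear_form_mul (gc i) (Cdiag i) _ _).1.
  have m2 : measurable_fun setT (cst 1 : T -> R) by exact: measurable_cst.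
  have i2 : P.-integrable setT (EFin \o (cst 1 : T -> R)).
    exact: finite_measure_integrable_cst.
  have [h1 h2] := integral_prod_indep m1 m2 (deriv_prod_indep p s t) i1 i2.
  split; first by under eq_fun do rewrite -[X in X%:E]mul1r.
  under eq_integral do rewrite -[X in X%:E]mul1r.
  have e1 : (\int[P]_w ((cst 1 : T -> R) w)%:E = 1)%E.
    transitivity (1%:E * P setT)%E; first exact: (integral_cst P measurableT 1%:E).
    by rewrite probability_setT mul1e.
  rewrite h2 e1 mul1e -prodEFin.
  apply: eq_bigr => i _.
  rewrite (linear_form_mul (gc i) (Cdiag i) _ _).2 form_cov_normalized_diff//.
have E w : ((\det (mx_of (derivs p w)) ^+ 2)%:E = \sum_(s : 'S_n) \sum_(t : 'S_n)
    ((-1) ^+ s * (-1) ^+ t)%:E * (\prod_i (deriv p i (s i) w * deriv p i (t i) w))%:E)%E.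
  rewrite sqr_det_perm -sumEFin; apply: eq_bigr => s _.
  rewrite -sumEFin; apply: eq_bigr => t _; rewrite -EFinM; congr (_ * _)%:E.
  by apply: eq_bigr => i _; rewrite !mx_of_derivs.
have iH (s t : 'S_n) : P.-integrable setT (fun w => ((-1) ^+ s * (-1) ^+ t)%:E *
    (\prod_i (deriv p i (s i) w * deriv p i (t i) w))%:E)%E.
  by apply: integrableZl => //; exact: (H s t).1.
have iH' (s : 'S_n) : P.-integrable setT (fun w => \sum_(t : 'S_n) ((-1) ^+ s * (-1) ^+ t)%:E *
    (\prod_i (deriv p i (s i) w * deriv p i (t i) w))%:E)%E by exact: integrable_sum.
under eq_fun do rewrite E.
split; first exact: integrable_sum.
rewrite integral_sum//= -sumEFin; apply: eq_bigr => s _.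
rewrite integral_sum//= -sumEFin; apply: eq_bigr => t _.
by rewrite integralZl ?(H s t).2//; exact: (H s t).1.
Qed.

Let t0_integral p (t : R) : 0 < t ->
  (\int[P]_w `|\det (mx_of (derivs p w))|%:E <=
    (2^-1 * (t + sqr_det_mean C p / t))%:E)%E.
Proof.
move=> t0.
have mdet : measurable_fun setT (fun w => \det (mx_of (derivs p w))).
  apply: measurable_sum => s; apply: measurable_funM => //.
  apply: measurable_prod => i _; under eq_fun do rewrite mx_of_derivs.
  exact: mderiv.
have [iD eD] := sqr_det_integral p.
have ge0D w : (0 <= (\det (mx_of (derivs p w)) ^+ 2)%:E)%E by rewrite lee_fin sqr_ge0.
have mD2 : measurable_fun setT (fun w => (\det (mx_of (derivs p w)) ^+ 2)%:E).
  by apply/measurable_EFinP; exact: measurable_funX.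
have ti0 : 0 <= 2^-1 * t^-1 by rewrite mulr_ge0// invr_ge0 ltW.
apply: (@le_trans _ _ (\int[P]_w ((2^-1 * t)%:E +
   (2^-1 * t^-1)%:E * (\det (mx_of (derivs p w)) ^+ 2)%:E))%E).
  apply: ge0_le_integral => //.
  - by apply/measurable_EFinP; exact: measurableT_comp.
  - by apply: emeasurable_funD => //; exact: measurable_funeM.
  - move=> w _; rewrite -EFinM -EFinD lee_fin; set D := \det _.
    have : 0 <= (`|D| - t) ^+ 2 / t by rewrite divr_ge0 ?sqr_ge0// ltW.
    have -> : (`|D| - t) ^+ 2 / t = `|D| ^+ 2 / t + t - 2 * `|D| by field; rewrite gt_eqF.
    rewrite real_normK ?num_real//; lra.
rewrite ge0_integralD//; last 3 first.
- by move=> w _; rewrite lee_fin mulr_ge0// ltW.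
- by move=> w _; rewrite mule_ge0.
- exact: measurable_funeM.
have -> : (\int[P]_(x in setT) (2^-1 * t)%:E = (2^-1 * t)%:E)%E.
  transitivity ((2^-1 * t)%:E * P setT)%E; first exact: (integral_cst P measurableT).
  by rewrite probability_setT mule1.
rewrite ge0_integralZl// eD -EFinM -EFinD lee_fin.
by rewrite le_eqVlt; apply/orP; left; apply/eqP; ring.
Qed.

Definition zero_set w : set (n.-tuple R) :=
  [set x | forall i, \sum_a c i a w * expR (pairing a x) = 0].

(** Truncation of the coefficients. It makes the Taylor remainder and the entries of Lambda bounded
    uniformly in the outcome, and is lifted in [zero_count_dominated]. *)
Definition coef_bounded (Rb : R) : set T := [set w | forall i a, `|c i a w| <= Rb].

Let taylor_const Rb i : R := (\sum_a Rb * (Num.sqrt (C i (enum_rank a) (enum_rank a)))^-1) *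
  ((2 * n%:R * support_bound (A i)) ^+ 2 * expR (2 * n%:R * support_bound (A i))).
Let deriv_const Rb i : R := \sum_(a : A i)
  2 * support_bound (A i) * (Num.sqrt (C i (enum_rank a) (enum_rank a)))^-1 * Rb.
Let taylor_bound Rb : R := \sum_i `|taylor_const Rb i|.
Let deriv_bound Rb : R := \sum_i `|deriv_const Rb i|.

Let sum_norm_ge (F : 'I_n -> R) i : F i <= \sum_i `|F i|.
Proof.
by rewrite (le_trans (ler_norm _))// (bigD1 i)//= lerDl sumr_ge0.
Qed.

Let deriv_le Rb p w : coef_bounded Rb w -> forall i j, `|deriv p i j w| <= deriv_bound Rb.
Proof.
move=> hw i j; apply: le_trans (sum_norm_ge _ i).
rewrite (le_trans (ler_norm_sum _ _ _))//; apply: ler_sum => a _.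
by rewrite normrM ler_pM//; exact: normalized_diff_le.
Qed.

(** The step h = 1 / (m + 1) is both the side of the cube and the mesh for the rescaled parameter u
    = s / h in [0, 1], which therefore has m + 2 nodes. The rounding error then has the same order h
    as the rescaled Taylor remainder. *)
Let grid_near (m : nat) (s : R) : 0 <= s <= m.+1%:R^-1 ->
  exists k : 'I_m.+2, `|s * m.+1%:R - k%:R / m.+1%:R| <= m.+1%:R^-1.
Proof.
move=> /andP[s0 s1].
have m0 : 0 < m.+1%:R :> R by rewrite ltr0n.
pose y := s * m.+1%:R * m.+1%:R.
have y0 : 0 <= y by rewrite !mulr_ge0.
have y1 : y <= m.+1%:R.
  by rewrite /y -[leRHS]mul1r ler_wpM2r// -ler_pdivlMr// mul1r.
have /andP[h1 h2] := truncn_itv y0.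
have hk : (Num.truncn y < m.+2)%N by rewrite ltnS -(ler_nat R) (le_trans h1).
exists (Ordinal hk) => /=.
have -> : s * m.+1%:R - (Num.truncn y)%:R / m.+1%:R = (y - (Num.truncn y)%:R) / m.+1%:R.
  by rewrite /y; field; rewrite gt_eqF.
rewrite normrM (gtr0_norm (x := _^-1)) ?invr_gt0// ler_piMl ?invr_ge0 ?ltW//.
rewrite ger0_norm ?subr_ge0//; move: h2; rewrite -natr1; lra.
Qed.

(* The parameter u of the cube runs over a finite grid only, so that this set is
   measurable. *)
Let detector Rb m (u : n.-tuple (measurableTypeR R) * entry.-tuple (measurableTypeR R)) : Prop :=
  (forall i j, `|mx_of u.2 i j| <= deriv_bound Rb) /\
  exists k : {ffun 'I_n -> 'I_m.+2}, forall i,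
    `|m.+1%:R * tnth u.1 i + \sum_j mx_of u.2 i j * ((k j)%:R / m.+1%:R)| <=
    (taylor_bound Rb + n%:R * deriv_bound Rb) / m.+1%:R.

Let mmx i j : measurable_fun setT
  (fun u : n.-tuple (measurableTypeR R) * entry.-tuple (measurableTypeR R) => mx_of u.2 i j : R).
Proof.
under eq_fun do rewrite mxE.
apply: (@measurableT_comp _ _ _ _ _ _ (fun z : entry.-tuple (measurableTypeR R) =>
  tnth z (enum_rank (i, j)))) => //.
exact: measurable_tnth.
Qed.

Let measurable_detector Rb m : measurable (detector Rb m).
Proof.
have mle (b : R) (f : n.-tuple (measurableTypeR R) * entry.-tuple (measurableTypeR R) -> R) :
    measurable_fun setT f -> measurable [set u | `|f u| <= b].
  move=> mf; rewrite (_ : [set _ | _] = (fun u => `|f u|) @^-1` `]-oo, b]%classic).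
    by apply: measurable_preimage => //; exact: measurableT_comp.
  by apply/seteqP; split => u /=; rewrite in_itv.
rewrite (_ : detector Rb m = (\bigcap_i \bigcap_j [set u | `|mx_of u.2 i j| <= deriv_bound Rb]) `&`
  \bigcup_(k : {ffun 'I_n -> 'I_m.+2}) \bigcap_i [set u |
    `|m.+1%:R * tnth u.1 i + \sum_j mx_of u.2 i j * ((k j)%:R / m.+1%:R)| <=
    (taylor_bound Rb + n%:R * deriv_bound Rb) / m.+1%:R]).
  apply: measurableI.
    apply: fin_bigcap_measurable => // i _; apply: fin_bigcap_measurable => // j _.
    exact: mle.
  apply: fin_bigcup_measurable => // k _; apply: fin_bigcap_measurable => // i _.
  apply: mle; apply: measurable_funD.
    apply: measurable_funM => //.
    apply: (@measurableT_comp _ _ _ _ _ _ (fun z : n.-tuple (measurableTypeR R) => tnth z i)) => //.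
    exact: measurable_tnth.
  by apply: measurable_sum => j; apply: measurable_funM.
apply/seteqP; split => u /=.
  by move=> [h1 [k hk]]; split => [i _ j _|]; [exact: h1|exists k => // i _; exact: hk].
by move=> [h1 [k _ hk]]; split => [i j|]; [exact: h1|exists k => i; exact: hk].
Qed.

(** After division by h, the second order remainder contributes [taylor_bound Rb] times h and the
    rounding of u contributes n * [deriv_bound Rb] times h, which is the threshold in [detector]. *)
Let detectorP Rb m p x w : coef_bounded Rb w -> zero_set w x ->
  (forall j, tnth p j <= tnth x j <= tnth p j + m.+1%:R^-1) ->
  detector Rb m ([tuple value p i w | i < n], derivs p w).
Proof.
move=> hw xw hx; split => [i j|] /=; first by rewrite mx_of_derivs; exact: deriv_le.
have hx' j : 0 <= tnth x j - tnth p j <= m.+1%:R^-1.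
  by have /andP[h1 h2] := hx j; rewrite subr_ge0 h1 lerBlDl.
have m0 : 0 < m.+1%:R :> R by rewrite ltr0n.
pose k j := projT1 (cid (grid_near (hx' j))).
have hk j : `|(tnth x j - tnth p j) * m.+1%:R - (k j)%:R / m.+1%:R| <= m.+1%:R^-1.
  exact: projT2 (cid (grid_near (hx' j))).
exists [ffun j => k j] => i; rewrite tnth_mktuple.
have -> : m.+1%:R * value p i w +
    \sum_j mx_of (derivs p w) i j * (([ffun j => k j] j)%:R / m.+1%:R) =
    m.+1%:R * (value p i w + \sum_j deriv p i j w * (tnth x j - tnth p j)) -
    \sum_j deriv p i j w * ((tnth x j - tnth p j) * m.+1%:R - (k j)%:R / m.+1%:R).
  rewrite mulrDr -addrA; congr (_ + _); rewrite mulr_sumr -sumrB.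
  by apply: eq_bigr => j _; rewrite ffunE mx_of_derivs; ring.
rewrite (le_trans (ler_normB _ _))// mulrDl lerD//.
  have h01 : 0 <= (m.+1%:R^-1 : R) <= 1.
    by rewrite invr_ge0 ltW//= invf_le1// ler1n.
  have hx'' j : `|tnth x j - tnth p j| <= m.+1%:R^-1.
    by have /andP[h1 h2] := hx' j; rewrite ger0_norm.
  have := normalized_taylor (A0 i) (@C_gt0 i) h01 hx'' (hw i) (xw i).
  rewrite -/(taylor_const Rb i) -/(value p i w) => ht.
  rewrite normrM gtr0_norm// mulrC -ler_pdivlMr// -mulrA -expr2 exprVn.
  rewrite -exprVn (le_trans ht)// ler_wpM2r ?exprn_ge0 ?invr_ge0 ?(ltW m0)//.
rewrite (le_trans (ler_norm_sum _ _ _))//.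
apply: (@le_trans _ _ (\sum_(j < n) deriv_bound Rb / m.+1%:R)).
  by apply: ler_sum => j _; rewrite normrM ler_pM//; exact: deriv_le.
by rewrite sumr_const card_ord -[_ *+ n]mulr_natl mulrA.
Qed.

(** Rescaled by m + 1, the section at Lambda lies in a neighbourhood of the parallelepiped whose
    width tends to 0; the rescaling accounts for the factor h^n. [m0] must not depend on z, which is
    why the uniform cover is needed. *)
Let detector_volume Rb (eps : R) : 0 < eps -> exists m0, forall m, (m0 <= m)%N ->
  forall z, (lebesgue_tuple n [set x | detector Rb m (x, z)] <=
    ((m.+1%:R^-1) ^+ n * (`|\det (mx_of z)| + eps))%:E)%E.
Proof.
move=> e0; have [del del0 hdel] := uniform_small_cover n (deriv_bound Rb) e0.
pose N := taylor_bound Rb + n%:R * deriv_bound Rb.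
exists (Num.truncn (`|N| / del)) => m hm z.
have m0 : 0 < m.+1%:R :> R by rewrite ltr0n.
have Nm : N / m.+1%:R <= del.
  rewrite ler_pdivrMr// mulrC -ler_pdivrMr//.
  have : `|N| / del < m.+1%:R by apply: (lt_le_trans (truncnS_gt _)); rewrite ler_nat.
  by move=> /ltW; apply: le_trans; rewrite ler_wpM2r ?invr_ge0 ?ler_norm// ltW.
have mdet : measurable [set x | detector Rb m (x, z)].
  rewrite (_ : [set x | _] = ysection (detector Rb m) z); first exact: measurable_ysection.
  by apply/seteqP; split => x; rewrite /ysection /= inE.
(* Matrices with large entries violate the first condition of [detector], so their section is
   empty. *)
have [hz|hz] := pselect (forall i j, `|mx_of z i j| <= deriv_bound Rb); last first.
  rewrite (_ : [set x | _] = set0) ?measure0 ?lee_fin ?mulr_ge0 ?exprn_ge0 ?invr_ge0//.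
    by rewrite addr_ge0// ltW.
  by apply/seteqP; split => x //= -[].
have [S mS [subS lamS]] := hdel _ hz.
have uM : (m.+1%:R%:M : 'M[R]_n) \in unitmx.
  by rewrite unitmxE det_scalar unitfE expf_neq0// gt_eqF.
have := unitmx_scales_volume uM 0 mS; rewrite det_scalar normrX (gtr0_norm m0).
move=> hS; apply: (@le_trans _ _ (lebesgue_tuple n (affine_tuple
  (m.+1%:R%:M : 'M[R]_n) 0 @^-1` S))).
  apply: le_measure; rewrite ?inE//.
    by apply: measurable_preimage => //; exact: measurable_affine_tuple.
  move=> x [/= _ [k hk]]; apply: subS; exists (fun j => (k j)%:R / m.+1%:R); split => [j|i].
    rewrite divr_ge0 ?(ltW m0)//= ler_pdivrMr// mul1r ler_nat -ltnS; exact: ltn_ord.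
  rewrite tnth_mktuple addr0 mul_mx_scalar !mxE; exact: le_trans (hk i) Nm.
have mn0 : 0 < m.+1%:R ^+ n :> R by rewrite exprn_gt0.
rewrite -(@lee_pmul2l _ (m.+1%:R ^+ n)%:E) ?lte_fin//.
rewrite hS (le_trans lamS)// -EFinM mulrA exprVn mulfV ?mul1r// gt_eqF//.
Qed.

(** The threshold [m0] does not depend on p, so one mesh serves all cells of a grid. *)
Lemma root_detection Rb (eps t : R) : 0 < eps -> 0 < t ->
  exists m0, forall m p, (m0 <= m)%N -> exists2 D, measurable D &
    (P D <= (normal_peak 1 ^+ n * (m.+1%:R^-1) ^+ n *
      (2^-1 * (t + sqr_det_mean C p / t) + eps))%:E)%E /\
    forall w x, coef_bounded Rb w -> zero_set w x ->
      (forall j, tnth p j <= tnth x j <= tnth p j + m.+1%:R^-1) -> D w.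
Proof.
move=> e0 t0; have [m0 hm0] := detector_volume Rb e0.
exists m0 => m p m0m.
pose D w := detector Rb m ([tuple value p i w | i < n], derivs p w).
have mV : measurable_fun setT (fun w => [tuple value p i w | i < n] : n.-tuple (measurableTypeR R)).
  by apply/measurable_fun_tnthP => i; apply: eq_measurable_fun (mvalue p i) => w _ /=;
    rewrite tnth_mktuple.
exists D.
  apply: (@measurable_preimage _ _ _ _ (fun w => ([tuple value p i w | i < n] :
    n.-tuple (measurableTypeR R), derivs p w)) (detector Rb m)) => //.
  exact: measurable_fun_pair.
split; last by move=> w x hw xw hx; exact: detectorP hx.
have peak0 : 0 <= normal_peak 1 :> R by exact: normal_peak_ge0.
have dens i V : measurable V -> (P (value p i @^-1` V) <=
  (normal_peak 1)%:E * @lebesgue_measure R V)%E.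
  by move=> mV'; rewrite value_law// normal_prob_le_lebesgue.
have bnd := tuple_density_bound peak0 (mvalue p) (@mderivs p) (@value_derivs_indep p) dens
  (measurable_detector Rb m).
apply: (le_trans bnd).
pose S : set (n.-tuple (measurableTypeR R) * T) := [set u | detector Rb m (u.1, derivs p u.2)].
have mS : measurable S.
  apply: (@measurable_preimage _ _ _ _ (fun u : n.-tuple (measurableTypeR R) * T =>
    (u.1, derivs p u.2))) => //.
  by apply: measurable_fun_pair => //; exact: measurableT_comp.
have fub : (\int[lebesgue_tuple n]_x P [set w | detector Rb m (x, derivs p w)] =
    \int[P]_w lebesgue_tuple n [set x | detector Rb m (x, derivs p w)])%E.
  transitivity ((lebesgue_tuple n \x P)%E S).
    by apply: eq_integral => x _; congr (P _); apply/seteqP; split => w; rewrite /xsection /= inE.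
  rewrite (@product_measure_unique _ _ _ _ _ (lebesgue_tuple n) P
    [the measure _ _ of (lebesgue_tuple n \x^ P)%E])//; last first.
    by move=> V W mV' mW; rewrite /= product_measure2E.
  by apply: eq_integral => w _; congr (lebesgue_tuple n _); apply/seteqP; split => x;
    rewrite /ysection /= inE.
rewrite fub -mulrA [X in (_ <= X)%E]EFinM lee_wpmul2l ?lee_fin ?exprn_ge0//.
have mdet : measurable_fun setT (fun w => \det (mx_of (derivs p w))).
  apply: measurable_sum => s; apply: measurable_funM => //.
  apply: measurable_prod => i _; under eq_fun do rewrite mx_of_derivs.
  exact: mderiv.
have mabs : measurable_fun setT (fun w => (`|\det (mx_of (derivs p w))|%:E)%E).
  by apply/measurable_EFinP; exact: measurableT_comp.
have h0 : 0 <= m.+1%:R^-1 ^+ n :> R by rewrite exprn_ge0// invr_ge0.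
apply: (@le_trans _ _ (\int[P]_w ((m.+1%:R^-1 ^+ n)%:E * (`|\det (mx_of (derivs p w))|%:E
  + eps%:E)))%E).
  apply: ge0_le_integral => //.
  - have := measurable_fun_ysection (lebesgue_tuple n) mS.
    apply: eq_measurable_fun => w _; congr (lebesgue_tuple n _).
    by apply/seteqP; split => x; rewrite /ysection /= inE.
  - by apply: measurable_funeM; apply: emeasurable_funD.
  - by move=> w _; rewrite -EFinD -EFinM; exact: hm0.
rewrite ge0_integralZl//; last 2 first.
- exact: emeasurable_funD.
- by move=> w _; rewrite adde_ge0// lee_fin ltW.
rewrite EFinM lee_wpmul2l ?lee_fin// ge0_integralD//; last by move=> w _; rewrite lee_fin ltW.
have -> : (\int[P]_(x in setT) eps%:E = eps%:E)%E.
  transitivity (eps%:E * P setT)%E; first exact: (integral_cst P measurableT).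
  by rewrite probability_setT mule1.
by rewrite EFinD; apply: leeD => //; exact: t0_integral.
Qed.

End local_estimate.

(** * Regularity and upper integrals *)

Lemma cvg_lt_ereal (R : realType) (u : nat -> \bar R) l a :
  u @ \oo --> l -> (l < a)%E -> exists N, (u N < a)%E.
Proof.
move=> ul la; apply: contrapT => h.
suff : (a <= l)%E by rewrite leNgt la.
rewrite -(cvg_lim _ ul)//; apply: lime_ge; first by apply/cvg_ex; exists l.
apply: nearW => k; rewrite leNgt; apply/negP => hk; apply: h; by exists k.
Qed.

Section box_open.
Context {R : realType} {n : nat}.
Notation space := (n.-tuple (measurableTypeR R)).

(** Openness for the sup norm written in coordinates and joined with measurability: what is needed
    to place small cells around points of O and to integrate over O. *)
Definition box_open (O : set space) := measurable O /\
  forall x, O x -> exists2 e : R, 0 < e & forall y : space,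
    (forall i, `|tnth y i - tnth x i| < e) -> O y.

Lemma box_openI O1 O2 : box_open O1 -> box_open O2 -> box_open (O1 `&` O2).
Proof.
move=> [m1 h1] [m2 h2]; split=> [|x [/h1[e1 p1 k1] /h2[e2 p2 k2]]]; first exact: measurableI.
exists (Num.min e1 e2) => [|y hy]; first by rewrite lt_min p1.
by split; [apply: k1|apply: k2] => i; rewrite (lt_le_trans (hy i))// ge_min lexx ?orbT.
Qed.

Lemma box_openT : box_open setT.
Proof. by split=> // x _; exists 1. Qed.

Lemma box_open_bigcup (O : nat -> set space) :
  (forall k, box_open (O k)) -> box_open (\bigcup_k O k).
Proof.
move=> h; split => [|x [k _ Okx]].
  by apply: bigcupT_measurable => k; case: (h k).
have [_ /(_ x Okx)[e e0 he]] := h k.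
by exists e => // y hy; exists k => //; exact: he.
Qed.

Lemma box_open_bigcap (O : nat -> set space) N :
  (forall k, box_open (O k)) -> box_open (\bigcap_(k < N) O k).
Proof.
move=> h; elim: N => [|N IH]; first by rewrite bigcap_mkord big_ord0; exact: box_openT.
rewrite bigcap_mkord big_ord_recr /= -bigcap_mkord; exact: box_openI.
Qed.

Let box_open_coord i (V : set R) : open V -> box_open [set x | V (tnth x i)].
Proof.
move=> oV; split.
  rewrite -[X in measurable X]setTI.
  exact: (@measurable_tnth _ _ _ i measurableT V (open_measurable oV)).
move=> x Vx; have := open_nbhs_nbhs (conj oV Vx).
move=> /nbhs_ballP[e e0 he]; exists e => // y hy; apply: he.
by rewrite /ball /= distrC; exact: hy.
Qed.

Variable mu : {measure set space -> \bar R}.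
Hypothesis muT : (mu setT < +oo)%E.

(** Stated symmetrically in B and its complement, so that stability under complements is immediate.
    The overlap of the two open sets contains O minus B, so its measure controls the excess. *)
Let regular : set (set space) := [set B | forall e : R, 0 < e ->
  exists O O', [/\ box_open O, box_open O', B `<=` O, ~` B `<=` O' & (mu (O `&` O') <= e%:E)%E]].

Let mu_le A B : measurable A -> measurable B -> A `<=` B -> (mu A <= mu B)%E.
Proof. by move=> mA mB AB; apply: le_measure; rewrite ?inE. Qed.

Let mu_fin A : measurable A -> (mu A < +oo)%E.
Proof. by move=> mA; apply: le_lt_trans muT; exact: mu_le. Qed.

Let regularC B : regular B -> regular (~` B).
Proof.
move=> h e /h[V [V' [q1 q2 h1 h2 hm]]]; exists V', V; split => //; first by rewrite setCK.
by rewrite setIC.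
Qed.

(** For a countable union the errors are e / 2 times a geometric series. The complement is covered
    by the infinite intersection of the O'_k, which need not be open; finiteness of the measure
    allows replacing it by a finite one. *)
Let regular_sigma : sigma_algebra setT regular.
Proof.
split.
- move=> e e0; exists set0, setT; split => //; try exact: box_openT.
  by rewrite set0I measure0 lee_fin ltW.
- by move=> B hB; rewrite setTD; exact: regularC.
- move=> F hF e e0.
  have e4 k : 0 < e / 2 / (2 ^ k.+1)%:R by rewrite !divr_gt0// ltr0n expn_gt0.
  pose W k := cid (hF k _ (e4 k)).
  pose O k := projT1 (W k); pose O' k := projT1 (cid (projT2 (W k))).
  have hO k : [/\ box_open (O k), box_open (O' k), F k `<=` O k, ~` F k `<=` O' k &
      (mu (O k `&` O' k) <= (e / 2 / (2 ^ k.+1)%:R)%:E)%E] by exact: projT2 (cid (projT2 (W k))).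
  have oO k : box_open (O k) by case: (hO k).
  have oO' k : box_open (O' k) by case: (hO k).
  have mO k : measurable (O k) by case: (oO k).
  have mO' k : measurable (O' k) by case: (oO' k).
  pose UO := \bigcup_k O k.
  have mUO : measurable UO by case: (box_open_bigcup oO).
  (* The overlaps with finitely many O'_k decrease to a set of measure at most e / 2, so continuity
     from above yields some N with overlap below e. *)
  pose G N := UO `&` \bigcap_(k < N) O' k.
  have mG N : measurable (G N).
    by apply: measurableI => //; case: (box_open_bigcap N oO').
  have GE : \bigcap_N G N = UO `&` \bigcap_k O' k.
    apply/seteqP; split => x h.
      by split; [have [] := h 0 Logic.I|move=> k _; have [_] := h k.+1 Logic.I; apply => /=].
    by move=> N _; case: h => h1 h2; split => // k _; exact: h2.
  have mGI : measurable (\bigcap_N G N) by exact: bigcapT_measurable.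
  have limG : (mu (\bigcap_N G N) <= (e / 2)%:E)%E.
    have sub : \bigcap_N G N `<=` \bigcup_k (O k `&` O' k).
      by rewrite GE => x [[k _ Ox] h]; exists k => //; split => //; exact: h.
    apply: le_trans (@measure_sigma_subadditive _ _ _ mu _ (fun k => O k `&` O' k)
      (fun k => measurableI _ _ (mO k) (mO' k)) mGI sub) _.
    apply: (@le_trans _ _ (\sum_(k <oo) (0 + (e / 2 / (2 ^ k.+1)%:R)%:E))%E).
      by apply: lee_nneseries => // k _; rewrite add0e; case: (hO k).
    apply: le_trans (epsilon_trick _ _ _) _ => //; first by rewrite divr_ge0// ltW.
    by rewrite eseries0// add0e.
  have cvG : mu \o G @ \oo --> mu (\bigcap_N G N).
    apply: nonincreasing_cvg_mu => //; first exact: mu_fin.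
    apply/nonincreasing_seqP => N; apply/subsetPset => x [h1 h2]; split => // k /= kN.
    by apply: h2 => /=; rewrite ltnS ltnW.
  have [N hN] : exists N, (mu (G N) < e%:E)%E.
    have lt1 : (mu (\bigcap_N G N) < e%:E)%E.
      by apply: le_lt_trans limG _; rewrite lte_fin ltr_pdivrMr//; lra.
    exact: cvg_lt_ereal cvG lt1.
  exists UO, (\bigcap_(k < N) O' k); split.
  - exact: box_open_bigcup.
  - exact: box_open_bigcap.
  - by apply: subset_bigcup => k _; case: (hO k).
  - move=> x hx k _; have [_ _ _ + _] := hO k; apply => Fx; apply: hx.
    by exists k.
  - exact: ltW.
Qed.

(** The closed complement is enlarged to a slightly larger open half-space; the overlap is a strip
    that shrinks to the empty set. *)
Let regular_ray i (c : R) : regular [set x | c < tnth x i].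
Proof.
move=> e e0.
pose G k := [set x : space | c < tnth x i < c + k.+1%:R^-1].
have oray : box_open [set x : space | c < tnth x i].
  by apply: (box_open_coord i (V := [set y | c < y])); exact: open_gt.
have oless k : box_open [set x : space | tnth x i < c + k.+1%:R^-1].
  apply: (box_open_coord i (V := [set y | y < c + k.+1%:R^-1])); exact: open_lt.
have GE k : G k = [set x : space | c < tnth x i] `&` [set x | tnth x i < c + k.+1%:R^-1].
  by apply/seteqP; split => x /=; [move=> /andP[]|move=> [h1 h2]; apply/andP].
have mG k : measurable (G k) by rewrite GE; apply: measurableI; [case: oray|case: (oless k)].
have G0 : \bigcap_k G k = set0.
  apply/seteqP; split => x //= h.
  have /andP[h0 _] := h 0 Logic.I.
  have d0 : 0 < tnth x i - c by rewrite subr_gt0.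
  have /andP[_] := h (Num.truncn (tnth x i - c)^-1) Logic.I.
  apply/negP; rewrite -leNgt -lerBrDl -[leRHS]invrK lef_pV2 ?posrE ?invr_gt0//.
  exact/ltW/truncnS_gt.
have cvG : mu \o G @ \oo --> mu (\bigcap_N G N).
  apply: nonincreasing_cvg_mu => //; [exact: mu_fin|by rewrite G0|].
  apply/nonincreasing_seqP => N; apply/subsetPset => x /andP[h1 h2]; apply/andP; split => //.
  by apply: lt_le_trans h2 _; rewrite lerD2l lef_pV2 ?posrE ?ltr0n// ler_nat.
have [N hN] : exists N, (mu (G N) < e%:E)%E.
  have lt1 : (mu (\bigcap_N G N) < e%:E)%E by rewrite G0 measure0 lte_fin.
  exact: cvg_lt_ereal cvG lt1.
exists [set x | c < tnth x i], [set x | tnth x i < c + N.+1%:R^-1]; split => //.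
  by move=> x /= /negP; rewrite -leNgt => h; rewrite ltr_pwDr// invr_gt0 ltr0n.
by rewrite -GE ltW.
Qed.

Lemma box_open_regular B (e : R) : measurable B -> 0 < e ->
  exists O, [/\ box_open O, B `<=` O & (mu (O `\` B) <= e%:E)%E].
Proof.
move=> mB e0.
(* The regular sets form a sigma-algebra containing the coordinate rays, so every measurable set is
   regular; this is phrased as measurability of the identity. *)
have mid : measurable_fun setT (id : g_sigma_algebraType regular -> space).
  apply/measurable_fun_tnthP => i.
  apply: (measurability _ (RGenOInfty.measurableE R)) => _ [_ [c ->] <-].
  rewrite setTI; apply: sub_sigma_algebra => /=.
  rewrite (_ : _ @^-1` _ = [set x | c < tnth x i]); first exact: regular_ray.
  by apply/seteqP; split => x /=; rewrite in_itv /= andbT.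
have rB : regular B.
  have := mid measurableT _ mB; rewrite setTI preimage_id.
  by rewrite /measurable /= sigma_algebra_id//; exact: regular_sigma.
have [V [V' [q1 [mV' _] BV BV' h]]] := rB e e0.
exists V; split => //; apply: le_trans h; apply: mu_le.
- by apply: measurableD => //; case: q1.
- by apply: measurableI => //; case: q1.
- by move=> x [Vx Bx]; split => //; exact: BV'.
Qed.

End box_open.

(** * Upper integrals and Fatou's lemma for them *)

Section upper_integral.
Context {d} {T : measurableType d} {R : realType} (P : {measure set T -> \bar R}).

(* The upper integral of [f] is at most [b]. *)
Definition dominated (f : T -> \bar R) (b : \bar R) := exists G : T -> \bar R,
  [/\ measurable_fun setT G, forall w, (0 <= G w)%E,
      forall w, (f w <= G w)%E & (\int[P]_w G w <= b)%E].

Lemma dominated_le f f' b b' : (forall w, (f w <= f' w)%E) -> (b' <= b)%E ->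
  dominated f' b' -> dominated f b.
Proof.
move=> ff' bb' [G [mG G0 fG GI]]; exists G; split => //.
- by move=> w; exact: le_trans (fG w).
- exact: le_trans bb'.
Qed.

Lemma le_limn_einf (u : nat -> \bar R) N l :
  (forall k, (N <= k)%N -> (l <= u k)%E) -> (l <= limn_einf u)%E.
Proof.
move=> h; rewrite limn_einf_lim; apply: lime_ge; first exact: is_cvg_einfs.
exists N => // k /= Nk; apply: le_ereal_inf_tmp => _ [m /= km <-].
exact/h/(leq_trans Nk).
Qed.

Lemma limn_einf_le (u : nat -> \bar R) N l :
  (forall k, (N <= k)%N -> (u k <= l)%E) -> (limn_einf u <= l)%E.
Proof.
move=> h; rewrite limn_einf_lim; apply: lime_le; first exact: is_cvg_einfs.
exists N => // k /= Nk; apply: le_trans (h k Nk).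
by apply: ereal_inf_lbound; exists k => /=.
Qed.

(** Fatou's lemma for upper integrals: measurable majorants of the g_k are chosen, and their lower
    limit is a measurable majorant of f. *)
Lemma dominated_limn_einf (f : T -> \bar R) (g : nat -> T -> \bar R) (b : nat -> \bar R) b' :
  (forall w, (f w <= limn_einf (g^~ w))%E) -> (forall k, dominated (g k) (b k)) ->
  (forall e : R, 0 < e -> exists N, forall k, (N <= k)%N -> (b k <= b' + e%:E)%E) ->
  dominated f b'.
Proof.
move=> fg gb bb'.
pose G k := projT1 (cid (gb k)).
have hG k : [/\ measurable_fun setT (G k), forall w, (0 <= G k w)%E,
    forall w, (g k w <= G k w)%E & (\int[P]_w G k w <= b k)%E] by exact: projT2 (cid (gb k)).
have mG k : measurable_fun setT (G k) by case: (hG k).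
have G0 k w : (0 <= G k w)%E by case: (hG k).
have einfs_mono w : (limn_einf (g^~ w) <= limn_einf (G^~ w))%E.
  rewrite !limn_einf_lim; apply: lee_lim; [exact: is_cvg_einfs|exact: is_cvg_einfs|].
  apply: nearW => k; apply: le_ereal_inf_tmp => _ [m /= km <-].
  have [_ _ h _] := hG m; apply: le_trans (h w); apply: ereal_inf_lbound.
  by exists m.
exists (fun w => limn_einf (G^~ w)); split.
- apply: (eq_measurable_fun (fun w => limn (einfs (G^~ w)))).
    by move=> w _; rewrite limn_einf_lim.
  apply: (@emeasurable_fun_cvg _ _ _ setT (fun k w => einfs (G^~ w) k)) => [k|w _].
    exact: measurable_fun_einfs.
  exact: is_cvg_einfs.
- by move=> w; apply: (@le_limn_einf _ 0).
- by move=> w; exact: le_trans (fg w) (einfs_mono w).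
- apply: (le_trans (fatou _ _ _ _)) => //.
  apply/lee_addgt0Pr => e e0; have [N hN] := bb' e e0.
  apply: (limn_einf_le (N := N)) => k Nk; apply: le_trans (hN k Nk).
  by case: (hG k).
Qed.

Lemma dominated_inf f b : (forall e : R, 0 < e -> dominated f (b + e%:E)%E) -> dominated f b.
Proof.
move=> h; apply: (dominated_limn_einf (g := fun _ => f) (b := fun k => (b + k.+1%:R^-1%:E)%E)).
- by move=> w; apply: (@le_limn_einf _ 0).
- by move=> k; apply: h; rewrite invr_gt0 ltr0n.
- move=> e e0; exists (Num.truncn e^-1) => k hk; rewrite leeD2l// lee_fin.
  rewrite -[leRHS]invrK lef_pV2 ?posrE ?invr_gt0 ?ltr0n//.
  by apply/ltW/(lt_le_trans (truncnS_gt _)); rewrite ler_nat ltnS.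
Qed.

(* No measurability is needed: the integral of a nonnegative function is the
   supremum over the simple functions below it. *)
Lemma ge0_le_integral_nonmeasurable (f g : T -> \bar R) :
  (forall w, (0 <= f w)%E) -> (forall w, (f w <= g w)%E) ->
  (\int[P]_w f w <= \int[P]_w g w)%E.
Proof.
move=> f0 fg; have g0 w : (0 <= g w)%E by exact: le_trans (fg w).
rewrite !ge0_integralTE//; apply: ereal_sup_le => _ [h hf <-].
by exists h => // w; exact: le_trans (fg w).
Qed.

Lemma le_integral_dominated f b : (forall w, (0 <= f w)%E) -> dominated f b ->
  (\int[P]_w f w <= b)%E.
Proof.
by move=> f0 [G [_ _ fG GI]]; apply: le_trans GI; exact: ge0_le_integral_nonmeasurable.
Qed.

End upper_integral.

Section counting.
Context {R : realType} (X : choiceType).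
Implicit Types S : set X.

(** A count, finite or infinite, is tested on duplicate-free finite lists only, so no argument below
    has to split on finiteness. *)
Lemma counting_le S (b : \bar R) :
  (forall s : seq X, uniq s -> (forall x, x \in s -> S x) -> ((size s)%:R%:E <= b)%E) ->
  (counting S <= b)%E.
Proof.
move=> h; rewrite /counting; case: asboolP => fS.
  apply: h => [|x]; first exact: fset_uniq.
  by rewrite in_fset_set// inE.
have : forall k : nat, (k%:R%:E <= b)%E.
  move=> k; have [D DS Dk] := infinite_set_fset k fS.
  apply: le_trans (h D _ _); rewrite ?fset_uniq//.
    by rewrite lee_fin ler_nat.
move=> {}h; rewrite leye_eq; apply/eqP/eq_infty => t; apply: le_trans (h (Num.truncn t).+1).
by rewrite lee_fin ltW// truncnS_gt.
Qed.

Lemma le_counting S (s : seq X) : uniq s -> (forall x, x \in s -> S x) ->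
  ((size s)%:R%:E <= counting S :> \bar R)%E.
Proof.
move=> us sS; rewrite /counting; case: asboolP => fS; last exact: leey.
rewrite lee_fin ler_nat; apply: uniq_leq_size => // x xs.
by rewrite in_fset_set// inE; exact: sS.
Qed.

Lemma counting_le_limn_einf S (u : nat -> \bar R) :
  (forall s : seq X, uniq s -> (forall x, x \in s -> S x) ->
    exists N, forall k, (N <= k)%N -> ((size s)%:R%:E <= u k)%E) ->
  (counting S <= limn_einf u)%E.
Proof.
move=> h; apply: counting_le => s us sS; have [N hN] := h s us sS.
exact: le_limn_einf hN.
Qed.

Lemma counting_subset S S' : S `<=` S' -> (counting S <= counting S' :> \bar R)%E.
Proof.
by move=> SS'; apply: counting_le => s us sS; apply: le_counting => // x /sS; exact: SS'.
Qed.

End counting.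

(** * Counting roots on grids *)

Lemma seq_uniform_pos (R : realDomainType) (X : eqType) (s : seq X) (Q : X -> R -> Prop) :
  (forall x e e', Q x e -> e' <= e -> Q x e') ->
  (forall x, x \in s -> exists2 e : R, 0 < e & Q x e) ->
  exists2 e : R, 0 < e & forall x, x \in s -> Q x e.
Proof.
move=> Qmono; elim: s => [|x s IH] h; first by exists 1.
have [e e0 Qe] := IH (fun y ys => h y (mem_behead (s := x :: s) ys)).
have [e' e'0 Qe'] := h x (mem_head x s).
exists (Num.min e e') => [|y]; first by rewrite lt_min e0.
rewrite inE => /predU1P[->|ys]; first by apply: Qmono Qe' _; rewrite ge_min lexx orbT.
by apply: Qmono (Qe y ys) _; rewrite ge_min lexx.
Qed.

Lemma dist_lt_itv (R : realDomainType) (a l x y : R) :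
  a <= x < a + l -> a <= y < a + l -> `|x - y| < l.
Proof. by move=> /andP[? ?] /andP[? ?]; rewrite ltr_norml; apply/andP; split; lra. Qed.

Section grid.
Context {R : realType} {n : nat}.
Notation space := (n.-tuple (measurableTypeR R)).

Definition centered_cube (r : nat) : set space :=
  [set x | forall j, - r%:R <= tnth x j < r%:R].

Definition grid_size r m := (2 * r * m.+1)%N.

Definition grid_corner r m (f : {ffun 'I_n -> 'I_(grid_size r m)}) : n.-tuple R :=
  [tuple (f j)%:R / m.+1%:R - r%:R | j < n].

(** Half-open cells partition the half-open cube: a point has exactly one cell, and no boundary has
    to be discarded. *)
Definition grid_cell r m (f : {ffun 'I_n -> 'I_(grid_size r m)}) : set space :=
  [set x | forall j, tnth (grid_corner f) j <= tnth x j < tnth (grid_corner f) j + m.+1%:R^-1].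

Let box_half_open (a b : 'I_n -> R) (l : R) : (forall j, b j - a j = l) -> 0 <= l ->
  measurable [set x : space | forall j, a j <= tnth x j < b j] /\
  lebesgue_tuple n [set x | forall j, a j <= tnth x j < b j] = (l ^+ n)%:E.
Proof.
move=> ab l0; pose B j : set (measurableTypeR R) := `[a j, b j[%classic.
have -> : [set x : space | forall j, a j <= tnth x j < b j] =
    [set x : space | forall j, B j (tnth x j)].
  by apply/seteqP; split => x /= h j; have := h j; rewrite /B /= in_itv.
have mB j : measurable (B j) by exact: measurable_itv.
split; first by rewrite measurable_tupleE; apply: sub_sigma_algebra; exists B.
rewrite lebesgue_tuple_box// (eq_bigr (fun=> l%:E)).
  by rewrite prodEFin prodr_const card_ord.
move=> j _; rewrite /B lebesgue_measure_itv /= lte_fin -(ab j).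
by case: ltP => h; rewrite -?EFinB//; congr _%:E; have := ab j; lra.
Qed.

Lemma measurable_centered_cube r : measurable (centered_cube r).
Proof.
have r0 : 0 <= (r%:R + r%:R : R) by rewrite addr_ge0.
have h (j : 'I_n) : r%:R - - r%:R = r%:R + r%:R :> R by rewrite opprK.
exact: (box_half_open h r0).1.
Qed.

Lemma lebesgue_centered_cube r : lebesgue_tuple n (centered_cube r) =
  ((2 * r%:R) ^+ n)%:E :> \bar R.
Proof.
have r0 : 0 <= (2 * r%:R : R) by rewrite mulr_ge0.
have h (j : 'I_n) : r%:R - - r%:R = 2 * r%:R :> R by ring.
exact: (box_half_open h r0).2.
Qed.

Lemma measurable_grid_cell r m f : measurable (@grid_cell r m f).
Proof.
have h0 : 0 <= (m.+1%:R^-1 : R) by [].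
have h j : tnth (grid_corner f) j + m.+1%:R^-1 - tnth (grid_corner f) j = m.+1%:R^-1 by ring.
exact: (box_half_open h h0).1.
Qed.

Lemma lebesgue_grid_cell r m f : lebesgue_tuple n (@grid_cell r m f) = (m.+1%:R^-1 ^+ n)%:E.
Proof.
have h0 : 0 <= (m.+1%:R^-1 : R) by [].
have h j : tnth (grid_corner f) j + m.+1%:R^-1 - tnth (grid_corner f) j = m.+1%:R^-1 by ring.
exact: (box_half_open h h0).2.
Qed.

Let grid_cell_itv r m f x : @grid_cell r m f x -> forall j,
  (f j)%:R <= (tnth x j + r%:R) * m.+1%:R < (f j).+1%:R.
Proof.
move=> h j; have := h j; rewrite tnth_mktuple.
have m0 : 0 < m.+1%:R :> R by rewrite ltr0n.
move=> /andP[h1 h2]; apply/andP; split.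
  by rewrite -ler_pdivrMr// -lerBlDr.
have fS : (f j).+1%:R = (f j)%:R + 1 :> R by rewrite natr1.
by rewrite -ltr_pdivlMr// fS mulrDl mul1r; move: h2; set u := m.+1%:R^-1; lra.
Qed.

Lemma grid_cell_inj r m f f' x : @grid_cell r m f x -> @grid_cell r m f' x -> f = f'.
Proof.
move=> /grid_cell_itv h /grid_cell_itv h'; apply/ffunP => j; apply: val_inj.
by rewrite /= -(truncn_def (h j)) (truncn_def (h' j)).
Qed.

Lemma grid_cell_exists r m x : centered_cube r x -> exists f, @grid_cell r m f x.
Proof.
move=> Kx; have m0 : 0 < m.+1%:R :> R by rewrite ltr0n.
pose y j := (tnth x j + r%:R) * m.+1%:R.
have y0 j : 0 <= y j by have /andP[h _] := Kx j; rewrite mulr_ge0//; move: h; lra.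
have hy j := truncn_itv (y0 j).
have ylt j : (Num.truncn (y j) < grid_size r m)%N.
  have /andP[h1 _] := hy j; rewrite -(ltr_nat R) (le_lt_trans h1)//.
  rewrite /grid_size !natrM ltr_pM2r//; have /andP[_] := Kx j; lra.
exists [ffun j => Ordinal (ylt j)] => j; rewrite tnth_mktuple ffunE /=.
have /andP[h1 h2] := hy j; apply/andP; split.
  by rewrite lerBlDr ler_pdivrMr.
have : tnth x j + r%:R < (Num.truncn (y j)).+1%:R / m.+1%:R by rewrite ltr_pdivlMr.
have -> : (Num.truncn (y j)).+1%:R = (Num.truncn (y j))%:R + 1 :> R by rewrite natr1.
by rewrite mulrDl mul1r; set u := m.+1%:R^-1; lra.
Qed.

Lemma grid_cell_sub r m f : @grid_cell r m f `<=` centered_cube r.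
Proof.
move=> x /grid_cell_itv h j; have m0 : 0 < m.+1%:R :> R by rewrite ltr0n.
have /andP[h1 h2] := h j; apply/andP; split.
  have : 0 <= tnth x j + r%:R by rewrite -(pmulr_lge0 _ m0) (le_trans _ h1).
  lra.
have : (tnth x j + r%:R) * m.+1%:R < (2 * r%:R) * m.+1%:R.
  by rewrite (lt_le_trans h2)// -!natrM ler_nat.
by rewrite ltr_pM2r//; lra.
Qed.

End grid.

Lemma counting_le_cubes {R : realType} {n : nat} (S : set (n.-tuple (measurableTypeR R))) :
  (counting S <= limn_einf (fun r => counting (S `&` centered_cube r)) :> \bar R)%E.
Proof.
apply: counting_le_limn_einf => s us sS.
have [N hN] : exists N, forall x, x \in s -> centered_cube N x.
  elim: s {us sS} => [|x s [N hN]]; first by exists 0%N.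
  pose b := (\max_j (Num.truncn `|tnth x j|).+1)%N.
  have mono a a' (y : n.-tuple (measurableTypeR R)) :
      (a <= a')%N -> centered_cube a y -> centered_cube a' y.
    move=> aa h j; have /andP[h1 h2] := h j; have : a%:R <= a'%:R :> R by rewrite ler_nat.
    by move=> h3; apply/andP; split; lra.
  exists (maxn N b) => y; rewrite inE => /predU1P[->|/hN]; last exact/mono/leq_maxl.
  apply: (mono b); first exact: leq_maxr.
  move=> j; have h : `|tnth x j| < b%:R.
    apply: (lt_le_trans (truncnS_gt _)); rewrite ler_nat.
    exact: (leq_bigmax_cond (F := fun j => (Num.truncn `|tnth x j|).+1)).
  by move: h; rewrite ltr_norml => /andP[/ltW -> ->].
exists N => k Nk; apply: le_counting => // x xs; split; first exact: sS.
move=> j; have /andP[h1 h2] := hN x xs j.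
have : N%:R <= k%:R :> R by rewrite ler_nat.
by move=> h3; apply/andP; split; lra.
Qed.

(** * From detection in cells to the expected number of points *)

Section expected_count.
Context {R : realType} {n : nat} {d} {T : measurableType d} (P : {measure set T -> \bar R}).
Notation space := (n.-tuple (measurableTypeR R)).
Notation vol := (@lebesgue_tuple R n).
Variables (Z : T -> set space) (phi : space -> R) (rate : R).
Hypothesis mphi : measurable_fun setT phi.
Hypothesis phi0 : forall x, 0 <= phi x.
Hypothesis phi_slow : forall (p x : space) h, (forall j, `|tnth x j - tnth p j| <= h) ->
  phi p <= expR (rate * h) * phi x.
Hypothesis detect : forall eps : R, 0 < eps -> exists m0, forall m (p : space), (m0 <= m)%N ->
  exists2 D, measurable D &
    (P D <= (m.+1%:R^-1 ^+ n * (phi p + eps))%:E)%E /\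
    forall w x, Z w x -> (forall j, tnth p j <= tnth x j <= tnth p j + m.+1%:R^-1) -> D w.

Let phi_bound r : exists2 M : R, 0 < M & forall x, centered_cube r x -> phi x <= M.
Proof.
pose z : space := [tuple 0 | _ < n].
exists (expR (rate * r%:R) * phi z + 1).
  by rewrite ltr_wpDl// mulr_ge0 ?expR_ge0.
move=> x Kx; rewrite (@le_trans _ _ (expR (rate * r%:R) * phi z))//; last by rewrite lerDl.
apply: phi_slow => j; rewrite tnth_mktuple sub0r normrN ler_norml.
by have /andP[h1 h2] := Kx j; rewrite h1 ltW.
Qed.

Let mphiE D : measurable_fun D (EFin \o phi).
Proof. by apply/measurable_EFinP; apply: measurable_funTS. Qed.

Let int_phi_fin D r : measurable D -> D `<=` centered_cube r ->
  (\int[vol]_(x in D) (phi x)%:E < +oo)%E.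
Proof.
move=> mD DK; have [M M0 hM] := phi_bound r.
apply: (@le_lt_trans _ _ (\int[vol]_(x in D) M%:E)%E).
  apply: ge0_le_integral => //.
  - by move=> x _; rewrite lee_fin.
  - by move=> x /DK/hM; rewrite lee_fin.
rewrite integral_cst// lte_mul_pinfty// ?lee_fin ?(ltW M0)//.
apply: (@le_lt_trans _ _ (vol (centered_cube r))).
  by apply: le_measure; rewrite ?inE//; exact: measurable_centered_cube.
by rewrite lebesgue_centered_cube ltry.
Qed.

(** On a cell the value of phi at the corner is at most expR(rate h) times its value anywhere in the
    cell. The Riemann sum is thus bounded by an integral over the disjoint cells, all of which lie
    in O and in the cube. *)
Let cell_sum r m eps (O : set space) : measurable O -> 0 < eps ->
  (\sum_(f : {ffun 'I_n -> 'I_(grid_size r m)} | `[< grid_cell f `<=` O >])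
     (m.+1%:R^-1 ^+ n * (phi (grid_corner f) + eps))%:E <=
   (expR (rate * m.+1%:R^-1))%:E * \int[vol]_(x in O `&` centered_cube r) (phi x)%:E +
   (eps * (2 * r%:R) ^+ n)%:E)%E.
Proof.
move=> mO e0.
pose E := expR (rate * m.+1%:R^-1).
have E0 : 0 <= E by exact: expR_ge0.
pose psi x := ((E * phi x)%:E + eps%:E)%E.
have mK := @measurable_centered_cube R n r.
have mOK : measurable (O `&` centered_cube r) by exact: measurableI.
have psi0 x : (0 <= psi x)%E by rewrite /psi -EFinD lee_fin addr_ge0 ?mulr_ge0// ltW.
have mpsi D : measurable_fun D psi.
  by apply/measurable_EFinP; apply: measurable_funD => //; apply: measurable_funM => //;
    exact: measurable_funTS.
pose s := [seq f <- enum {: {ffun 'I_n -> 'I_(grid_size r m)}} | `[< grid_cell f `<=` O >]].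
have us : uniq s by rewrite filter_uniq// enum_uniq.
have ms f : (f \in s) = `[< @grid_cell R n r m f `<=` O >] by rewrite mem_filter mem_enum andbT.
have tF : trivIset [set` s] (@grid_cell R n r m).
  apply/trivIsetP => f f' _ _ ff'; apply/seteqP; split => x // -[h h'].
  by move/eqP : ff'; apply; exact: grid_cell_inj h h'.
have mcell := @measurable_grid_cell R n r m.
apply: (@le_trans _ _ (\sum_(f <- s) \int[vol]_(x in grid_cell f) psi x)%E).
  rewrite (eq_bigl (fun f => f \in s)); last by move=> f; rewrite ms.
  rewrite -big_uniq//=; apply: lee_sum => f _.
  apply: (@le_trans _ _ (\int[vol]_(x in grid_cell f) (phi (grid_corner f) + eps)%:E)%E).
    rewrite (_ : (\int[vol]_(x in _) _)%E =
        ((phi (grid_corner f) + eps)%:E * (m.+1%:R^-1 ^+ n)%:E)%E).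
      by rewrite -EFinM mulrC.
    by rewrite -(lebesgue_grid_cell f); exact: (integral_cst _ (mcell f)).
  apply: ge0_le_integral => //.
  - by move=> x _; rewrite lee_fin addr_ge0// ltW.
  - move=> x hx; rewrite /psi -EFinD lee_fin lerD2r; apply: phi_slow => j.
    have /andP[h1 h2] := hx j; rewrite ger0_norm ?subr_ge0//.
    by rewrite lerBlDl ltW.
have -> : (\sum_(f <- s) \int[vol]_(x in grid_cell f) psi x =
    \int[vol]_(x in \big[setU/set0]_(f <- s) grid_cell f) psi x)%E.
  by rewrite ge0_integral_bigsetU.
apply: (@le_trans _ _ (\int[vol]_(x in O `&` centered_cube r) psi x)%E).
  apply: ge0_subset_integral => //.
    by apply: bigsetU_measurable.
  move=> x; rewrite -bigcup_seq => -[f /=]; rewrite ms => /asboolP fO fx.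
  by split; [exact: fO|exact: grid_cell_sub fx].
rewrite ge0_integralD//; last 3 first.
- by move=> x _; rewrite lee_fin mulr_ge0.
- by apply/measurable_EFinP; apply: measurable_funM => //; exact: measurable_funTS.
- by move=> x _; rewrite lee_fin ltW.
apply: leeD.
  under eq_integral do rewrite EFinM.
  by rewrite ge0_integralZl// => x _; rewrite lee_fin.
rewrite integral_cst// EFinM lee_wpmul2l ?lee_fin ?(ltW e0)//.
by rewrite -lebesgue_centered_cube; apply: le_measure; rewrite ?inE.
Qed.

Let separated (s : seq space) : uniq s ->
  exists2 e : R, 0 < e & forall x y, x \in s -> y \in s ->
    (forall j, `|tnth x j - tnth y j| < e) -> x = y.
Proof.
move=> us.
have [|[x y] _|e e0 he] := @seq_uniform_pos R _ [seq (x, y) | x <- s, y <- s]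
    (fun u e => (forall j, `|tnth u.1 j - tnth u.2 j| < e) -> u.1 = u.2).
- by move=> u e e' h e'e h'; apply: h => j; exact: lt_le_trans (h' j) e'e.
- have [->|xy] := eqVneq x y; first by exists 1.
  have [j xyj] : exists j, tnth x j != tnth y j.
    apply/existsP; apply: contraNT xy; rewrite negb_exists => /forallP h.
    by apply/eqP/eq_from_tnth => j; apply/eqP; have := h j; rewrite negbK.
  exists `|tnth x j - tnth y j|; first by rewrite normr_gt0 subr_eq0.
  by move=> /(_ j); rewrite ltxx.
- exists e => // x y xs ys h; apply: (he (x, y)) h.
  by apply/allpairsP; exists (x, y).
Qed.

(* Each point of a finite set of roots eventually lies in a cell of its own,
   contained in the open set [O]; Fatou's lemma then bounds the count. *)
Let count_box_open r (O : set space) : box_open O ->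
  dominated P (fun w => counting [set x | [/\ Z w x, O x & centered_cube r x]])
    (\int[vol]_(x in O `&` centered_cube r) (phi x)%:E).
Proof.
move=> [mO hO].
have mK := @measurable_centered_cube R n r.
have mOK : measurable (O `&` centered_cube r) by exact: measurableI.
set I := (\int[vol]_(x in _) _)%E.
have I0 : (0 <= I)%E by apply: integral_ge0 => x _; rewrite lee_fin.
have Ifin : (I \is a fin_num)%E.
  by rewrite ge0_fin_numE//; apply: int_phi_fin => // x [].
apply: dominated_inf => eta eta0.
pose V : R := (2 * r%:R) ^+ n.
have V0 : 0 <= V by rewrite exprn_ge0// mulr_ge0.
have V1 : 0 < V + 1 by lra.
(* The admissible error eta is split in two: [eps] times the volume V of the cube takes one half. *)
pose eps := eta / 2 / (V + 1).
have eps0 : 0 < eps by rewrite !divr_gt0.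
have [m0 hm0] := detect eps0.
(* The other half is for the factor expR(rate h): once rate h <= y, it raises the integral I by at
   most eta / 2. *)
pose y := ln (1 + eta / 2 / (fine I + 1)).
have I1 : 0 < fine I + 1 by rewrite ltr_wpDl// fine_ge0.
have y0 : 0 < y by rewrite ln_gt0// ltrDl !divr_gt0.
pose m1 := Num.truncn (rate / y).
have hm1 m : (m1 <= m)%N -> expR (rate * m.+1%:R^-1) <= 1 + eta / 2 / (fine I + 1).
  move=> hm; have -> : 1 + eta / 2 / (fine I + 1) = expR y.
    by rewrite lnK// posrE addr_gt0// !divr_gt0.
  rewrite ler_expR ler_pdivrMr ?ltr0n// mulrC -ler_pdivrMr//.
  by apply/ltW/(lt_le_trans (truncnS_gt _)); rewrite ler_nat ltnS.
pose N := maxn m0 m1.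
have hD k (p : space) := hm0 (N + k)%N p (leq_trans (leq_maxl _ _) (leq_addr _ _)).
pose D k p := projT1 (cid2 (hD k p)).
have mD k p : measurable (D k p) by rewrite /D; case: cid2.
have PD k p : (P (D k p) <= ((N + k).+1%:R^-1 ^+ n * (phi p + eps))%:E)%E /\
    forall w x, Z w x -> (forall j, tnth p j <= tnth x j <= tnth p j + (N + k).+1%:R^-1) -> D k p w.
  by rewrite /D; case: cid2.
pose cells k := {ffun 'I_n -> 'I_(grid_size r (N + k))}.
pose inO k (f : cells k) := `[< grid_cell f `<=` O >].
pose g k w : \bar R := (\sum_(f : cells k | inO k f) (\1_(D k (grid_corner f)) w : R)%:E)%E.
have ind0 k (f : cells k) w : (0 <= (\1_(D k (grid_corner f)) w : R)%:E)%E by [].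
have mind k (f : cells k) : measurable_fun setT (fun w => (\1_(D k (grid_corner f)) w : R)%:E).
  by apply/measurable_EFinP; exact: measurable_indic.
apply: (dominated_limn_einf (g := g) (b := fun=> (I + eta%:E)%E)); last first.
- by move=> e e0; exists 0%N => k _; rewrite leeDl// lee_fin ltW.
- move=> k; exists (g k); split => //.
  + rewrite /g; under eq_fun do rewrite big_mkcond.
    by apply: emeasurable_sum => f; case: (inO k f).
  + by move=> w; apply: sume_ge0.
  + have -> : (\int[P]_w g k w = \sum_(f : cells k | inO k f) P (D k (grid_corner f)))%E.
      under eq_integral do rewrite /g big_mkcond.
      rewrite ge0_integral_sum//=.
      * rewrite [RHS]big_mkcond; apply: eq_bigr => f _; case: (inO k f); last exact: integral0.
        by rewrite integral_indic// setIT.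
      * by move=> f; case: (inO k f).
      * by move=> f w _; case: (inO k f).
    apply: (@le_trans _ _ (\sum_(f : cells k | inO k f)
       ((N + k).+1%:R^-1 ^+ n * (phi (grid_corner f) + eps))%:E)%E).
      by apply: lee_sum => f _; case: (PD k (grid_corner f)).
    apply: le_trans (cell_sum r (N + k) mO eps0) _.
    rewrite -/I -(fineK Ifin) -EFinM -!EFinD lee_fin.
    have hE := hm1 (N + k)%N (leq_trans (leq_maxr _ _) (leq_addr _ _)).
    have fI0 : 0 <= fine I by exact: fine_ge0.
    have b1 : expR (rate / (N + k).+1%:R) * fine I <= fine I + eta / 2.
      apply: le_trans (ler_wpM2r fI0 hE) _.
      rewrite mulrDl mul1r lerD2l -[_ / _ / _ * _]mulrA ler_piMr ?divr_ge0 ?(ltW eta0)//.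
      by rewrite mulrC ler_pdivrMr// mul1r; lra.
    have b2 : eps * V <= eta / 2.
      rewrite /eps -[_ / _ / _ * _]mulrA ler_piMr ?divr_ge0 ?(ltW eta0)//.
      by rewrite mulrC ler_pdivrMr// mul1r; lra.
    by rewrite -/V; lra.
move=> w; apply: counting_le_limn_einf => s us sS.
have [e1 e10 sep] := separated us.
have [|x xs|e2 e20 inside] := @seq_uniform_pos R _ s
    (fun x e => forall y : space, (forall j, `|tnth y j - tnth x j| < e) -> O y).
- by move=> x e e' h e'e z hz; apply: h => j; exact: lt_le_trans (hz j) e'e.
- by apply: hO; case: (sS x xs).
(* Cells with side below [e1] separate the chosen roots, and cells with side below [e2] around them
   stay inside O. *)
pose e := Num.min e1 e2.
have e0 : 0 < e by rewrite lt_min e10.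
exists (Num.truncn e^-1) => k hk.
have he : (N + k).+1%:R^-1 < e.
  rewrite -[ltRHS]invrK ltf_pV2 ?posrE ?invr_gt0// ?ltr0n//.
  by apply: (lt_le_trans (truncnS_gt _)); rewrite ler_nat ltnS (leq_trans hk)// leq_addl.
have hcell x : x \in s -> exists f : cells k, grid_cell f x.
  by move=> xs; apply: grid_cell_exists; case: (sS x xs).
have [s0|[x0 x0s]] : s = [::] \/ exists x, x \in s.
- by case: (s) => [|x s']; [left|right; exists x; exact: mem_head].
- by rewrite s0; apply: sume_ge0.
have [f0 _] := hcell x0 x0s.
pose cell (x : space) : cells k :=
  if pselect (exists f : cells k, grid_cell f x) is left h then projT1 (cid h) else f0.
have cellP x : x \in s -> grid_cell (cell x) x.
  by move=> /hcell h; rewrite /cell; case: pselect => // h'; exact: projT2 (cid h').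
have ucell : uniq [seq cell x | x <- s].
  rewrite map_inj_in_uniq// => x z xs zs xz; apply: sep => // j.
  have := cellP z zs j; have := cellP x xs j; rewrite xz.
  move=> h1 h2; rewrite (lt_le_trans _ (_ : e <= e1)) ?ge_min ?lexx//.
  by apply: lt_trans he; exact: dist_lt_itv h1 h2.
have cellO x : x \in s -> inO k (cell x) /\ D k (grid_corner (cell x)) w.
  move=> xs; have hx := cellP x xs; split.
    apply/asboolP => z hz; apply: (inside x xs) => j.
    rewrite (lt_le_trans _ (_ : e <= e2)) ?ge_min ?lexx ?orbT//.
    by apply: lt_trans he; exact: dist_lt_itv (hz j) (hx j).
  have [_ hPD] := PD k (grid_corner (cell x)); have [Zx _ _] := sS x xs.
  apply: hPD Zx _.
  by move=> j; have /andP[-> /ltW ->] := hx j.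
rewrite -(size_map cell) -sum1_size natr_sum -sumEFin big_uniq//= big_mkcond.
rewrite /g [leRHS]big_mkcond /=; apply: lee_sum => f _.
case: ifPn => [/mapP[x xs ->]|_]; last by case: ifP.
by have [-> h] := cellO x xs; rewrite indicE mem_set.
Qed.

(** Outer regularity is applied to the volume restricted to the cube, a finite measure. On the
    excess set phi is at most M, so an excess volume of eta / M costs at most eta. *)
Let count_bounded r (B : set space) : measurable B ->
  dominated P (fun w => counting (Z w `&` B `&` centered_cube r))
    (\int[vol]_(x in B `&` centered_cube r) (phi x)%:E).
Proof.
move=> mB; have mK := @measurable_centered_cube R n r.
have [M M0 hM] := phi_bound r.
have muT : (mrestr vol mK setT < +oo)%E.
  by rewrite /mrestr setTI lebesgue_centered_cube ltry.
apply: dominated_inf => eta eta0.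
have eM : 0 < eta / M by rewrite divr_gt0.
have [V [oV BV muV]] := box_open_regular muT mB eM.
have [mV _] := oV.
apply: dominated_le (count_box_open r oV) => [w|].
  by apply: counting_subset => x [[Zx Bx] Kx]; split => //; exact: BV.
have mBK : measurable (B `&` centered_cube r) by exact: measurableI.
have mVB : measurable ((V `\` B) `&` centered_cube r) by apply: measurableI => //;
  exact: measurableD.
rewrite (_ : V `&` centered_cube r = (B `&` centered_cube r) `|`
  ((V `\` B) `&` centered_cube r)); last first.
  by rewrite -setIUl setDUK.
rewrite ge0_integral_setU//; last 2 first.
- by move=> x _; rewrite lee_fin.
- rewrite disj_set2E; apply/eqP/seteqP; split => x //=.
  by move=> [[Bx _] [[_ nBx] _]].
rewrite leeD2l//; apply: (@le_trans _ _ (\int[vol]_(x in (V `\` B) `&` centered_cube r) M%:E)%E).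
  apply: ge0_le_integral => //.
  - by move=> x _; rewrite lee_fin.
  - by move=> x [_ /hM]; rewrite lee_fin.
rewrite integral_cst//.
apply: (@le_trans _ _ (M%:E * (eta / M)%:E)%E); first by rewrite lee_wpmul2l ?lee_fin ?(ltW M0).
by rewrite -EFinM mulrC divfK// gt_eqF.
Qed.

Lemma expected_count_le (B : set space) : measurable B ->
  dominated P (fun w => counting (Z w `&` B)) (\int[vol]_(x in B) (phi x)%:E).
Proof.
move=> mB.
apply: (dominated_limn_einf (fun w => counting_le_cubes _) (fun r => count_bounded r mB)).
move=> e e0; exists 0%N => r _; apply: (@le_trans _ _ (\int[vol]_(x in B) (phi x)%:E)%E).
  apply: ge0_subset_integral => //; first by apply: measurableI => //;
    exact: measurable_centered_cube.
  by move=> x _; rewrite lee_fin.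
by rewrite leeDl// lee_fin ltW.
Qed.

End expected_count.

Section zero_count.
Context {R : realType} {n : nat}.
Variables (A : 'I_n -> {fset 'rV[int]_n}) (C : forall i, 'M[R]_#|{: A i}|).
Context d (T : measurableType d) (P : probability T R).
Variable c : forall i, A i -> {RV P >-> R}.
Arguments c : clear implicits.
Hypothesis A0 : forall i, A i != fset0.
Hypothesis Cdiag : forall i, is_diag_mx (C i).
Hypothesis C_gt0 : forall i (a : A i), 0 < C i (enum_rank a) (enum_rank a).
Hypothesis hc : random_system C c.

Lemma zero_count_dominated (t : R) (B : set (n.-tuple (measurableTypeR R))) :
  0 < t -> measurable B ->
  dominated P (fun w => counting (zero_set c w `&` B))
    (\int[lebesgue_tuple n]_(x in B)
      (normal_peak 1 ^+ n * (2^-1 * (t + sqr_det_mean C x / t)))%:E)%E.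
Proof.
move=> t0 mB.
pose e := sqr_det_mean C.
pose phi (x : n.-tuple (measurableTypeR R)) : R := normal_peak 1 ^+ n * (2^-1 * (t + e x / t)).
have e0 x : 0 <= e x by exact: sqr_det_mean_ge0.
have pk0 : 0 < normal_peak 1 ^+ n :> R by rewrite exprn_gt0// normal_peak_gt0.
have phi0 x : 0 <= phi x.
  by rewrite mulr_ge0 ?(ltW pk0)// mulr_ge0// addr_ge0 ?divr_ge0 ?(ltW t0).
have mphi : measurable_fun setT phi.
  apply: measurable_funM => //; apply: measurable_funM => //; apply: measurable_funD => //.
  by apply: measurable_funM => //; exact: measurable_sqr_det_mean.
have r0 : 0 <= slow_rate A :> R by exact: slow_rate_ge0.
have slow (p x : n.-tuple (measurableTypeR R)) (h : R) :
    (forall j, `|tnth x j - tnth p j| <= h) -> phi p <= expR (slow_rate A * h) * phi x.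
  move=> hx; rewrite mulrCA ler_wpM2l ?(ltW pk0)// mulrCA ler_wpM2l// mulrDr.
  (* For n = 0 the condition on h is vacuous and h may be negative, but then the rate is an empty
     sum. *)
  have rh : 0 <= slow_rate A * h :> R.
    case: (posnP n) => [n0|n0].
      by rewrite /slow_rate big1 ?mul0r// => i; have := ltn_ord i; rewrite {2}n0.
    by rewrite mulr_ge0// (le_trans _ (hx (Ordinal n0))).
  apply: lerD; first by rewrite ler_peMl ?(ltW t0)// -expR0 ler_expR.
  rewrite mulrA ler_wpM2r ?invr_ge0 ?(ltW t0)//; exact: sqr_det_mean_slow.
(* Roots for outcomes whose coefficients are bounded by k; the bound on their expected number does
   not involve k. *)
pose Z k w : set (n.-tuple (measurableTypeR R)) :=
  [set x | coef_bounded c k%:R w /\ zero_set c w x].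
have detect k (eps : R) : 0 < eps -> exists m0, forall m (p : n.-tuple (measurableTypeR R)),
  (m0 <= m)%N ->
    exists2 D, measurable D & (P D <= (m.+1%:R^-1 ^+ n * (phi p + eps))%:E)%E /\
    forall w x, Z k w x -> (forall j, tnth p j <= tnth x j <= tnth p j + m.+1%:R^-1) -> D w.
  move=> eps0; have eps'0 : 0 < eps / normal_peak 1 ^+ n by rewrite divr_gt0.
  have [m0 hm0] := root_detection A0 Cdiag C_gt0 hc k%:R eps'0 t0.
  exists m0 => m p /(hm0 _ p)[D mD [PD hD]]; exists D => //; split.
    apply: le_trans PD _; rewrite lee_fin le_eqVlt; apply/orP; left; apply/eqP.
    by rewrite /phi -/e; move: pk0; set pk := normal_peak 1 ^+ n => pk0; field; rewrite !gt_eqF.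
  by move=> w x [hw xw] hx; exact: hD hw xw hx.
apply: (dominated_limn_einf (g := fun k w => counting (Z k w `&` B))
    (b := fun=> (\int[lebesgue_tuple n]_(x in B) (phi x)%:E)%E)); last first.
- by move=> eta eta0; exists 0%N => k _; rewrite leeDl// lee_fin ltW.
- move=> k; exact: expected_count_le mphi phi0 slow (detect k) B mB.
  (* For a fixed outcome the truncation is inactive once k exceeds all of its finitely many
     coefficients, so the lower limit is at least the full count. *)
  move=> w; pose N := \max_(u : {i : 'I_n & A i}) (Num.truncn `|c (tag u) (tagged u) w|).+1.
  apply: (le_limn_einf (N := N)) => k Nk; apply: counting_subset => x [xw Bx]; split => //.
  split => // i a; rewrite (@le_trans _ _ N%:R)// ?ler_nat//.
  apply/ltW/(lt_le_trans (truncnS_gt _)); rewrite ler_nat.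
  exact: (leq_bigmax_cond (F := fun u : {i : 'I_n & A i} =>
    (Num.truncn `|c (tag u) (tagged u) w|).+1) (existT _ i a)).
Qed.

End zero_count.

(** * The Hessian of the kernel *)

Section hessian_log_kernel.
Context {R : realType} {n : nat}.

(** Reduces a directional derivative to a derivative in one real variable at 0, where the rules for
    [is_derive] apply. *)
Let derive_line (f : 'rV[R]_n -> R) x v df :
  is_derive (0 : R) (1 : R) (fun h : R => f (h *: v + x)) df -> 'D_v f x = df.
Proof.
move=> H; rewrite -(@derive_val _ _ _ _ _ _ _ H) -derive1E /derive1 /derive.
set F := (fun h : R => _); set G := (fun h : R => _); suff -> : F = G by [].
by apply/funext => h; rewrite /F /G /= addr0 scale0r add0r.
Qed.

Let is_derive_big (I : finType) (f : I -> R -> R) (x : R) (df : I -> R) :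
  (forall i, is_derive x (1 : R) (f i) (df i)) ->
  is_derive x (1 : R) (fun y => \sum_i f i y) (\sum_i df i).
Proof.
move=> h.
have sumE (F : I -> R) : \sum_i F i = \sum_(k < #|I|) F (enum_val k).
  by rewrite -(big_enum_val (A := I) (fun i => F i)); apply: eq_bigl.
have -> : (fun y => \sum_i f i y) = \sum_(k < #|I|) f (enum_val k).
  by apply/funext => y; rewrite fct_sumE sumE.
by rewrite sumE; apply: is_derive_sum => k; exact: h.
Qed.

Variables (A : {fset 'rV[int]_n}) (C : 'M[R]_#|{: A}|).
Hypothesis A0 : A != fset0.
Hypothesis C_gt0 : forall a : A, 0 < C (enum_rank a) (enum_rank a).

Let lp (a : A) (x : 'rV[R]_n) : R := \sum_j exponent a j * x 0 j.

Let lpD a (h : R) v x : lp a (h *: v + x) = h * lp a v + lp a x.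
Proof.
by rewrite /lp mulr_sumr -big_split; apply: eq_bigr => j _ /=; rewrite !mxE; ring.
Qed.

Let lp_delta a j : lp a (delta_mx 0 j) = exponent a j.
Proof.
rewrite /lp (bigD1 j)//= big1 ?addr0 => [|k kj]; first by rewrite mxE !eqxx mulr1.
by rewrite mxE eqxx (negbTE kj) mulr0.
Qed.

Let lp_row a (p : n.-tuple R) : lp a (row_of p) = pairing a p.
Proof. by apply: eq_bigr => j _; rewrite mxE. Qed.

Let moment (u : A -> R) x : R :=
  \sum_a u a * (C (enum_rank a) (enum_rank a) * expR (2 * lp a x)).

Let moment_line u x v : is_derive (0 : R) (1 : R) (fun h : R => moment u (h *: v + x))
  (2 * moment (fun a => u a * lp a v) x).
Proof.
rewrite /moment mulr_sumr; apply: is_derive_big => a.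
have -> : (fun h : R => u a * (C (enum_rank a) (enum_rank a) * expR (2 * lp a (h *: v + x)))) =
    (u a * C (enum_rank a) (enum_rank a) * expR (2 * lp a x)) \*: (expR \o (2 * lp a v \*: id)).
  apply/funext => h; rewrite /= lpD mulrDr expRD /GRing.scale /=.
  have -> : 2 * (h * lp a v) = 2 * lp a v * h by ring.
  by ring.
apply: is_derive_eq.
by rewrite /= /GRing.scale /= mulr0 expR0; ring.
Qed.

Let kernel1 x := moment (fun=> 1) x.

Let kernel1_gt0 x : 0 < kernel1 x.
Proof.
have /fset0Pn[a aA] := A0; rewrite /kernel1 /moment (bigD1 [` aA]%fset)//=.
rewrite mul1r ltr_wpDr ?mulr_gt0 ?expR_gt0// sumr_ge0// => b _.
by rewrite mul1r mulr_ge0 ?expR_ge0// ltW.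
Qed.

Let log_kernelE : log_kernel C = fun x => 2^-1 * ln (kernel1 x).
Proof.
apply/funext => x; rewrite /log_kernel; congr (_ * ln _).
by apply: eq_bigr => a _; rewrite mul1r.
Qed.

Let derive_log_kernel x j : 'D_(delta_mx 0 j) (log_kernel C) x =
  moment (fun a => exponent a j) x / kernel1 x.
Proof.
rewrite log_kernelE; apply: derive_line.
have d1 := moment_line (fun=> 1) x (delta_mx 0 j).
have d2 : is_derive (kernel1 (0 *: delta_mx 0 j + x)) (1 : R) (@ln R)
    (kernel1 (0 *: delta_mx 0 j + x))^-1 by exact: is_derive1_ln.
have d3 := is_derive1_comp d2 d1.
have d4 := is_deriveZ (2^-1) d3.
apply: is_derive_eq d4 _.
rewrite scale0r add0r /GRing.scale /= mulrCA mulrA.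
rewrite (_ : moment (fun a => 1 * _) x = moment (fun a => exponent a j) x); last first.
  by apply: eq_bigr => a _; rewrite mul1r lp_delta.
by field; rewrite gt_eqF.
Qed.

(** As for the logarithm of a partition function, the gradient is the mean of the exponents and the
    Hessian their covariance. The factor 1/2 in the definition cancels one of the two factors 2
    produced by the exponent 2 a.p; the other one remains. *)
Lemma hessian_log_kernel (p : n.-tuple R) i j :
  hessian (log_kernel C) (row_of p) i j = 2 * weight_cov C p i j.
Proof.
rewrite mxE; apply: derive_line.
set x := row_of p; set v := delta_mx 0 i.
have d1 := moment_line (fun a => exponent a j) x v.
have d2 := moment_line (fun=> 1) x v.
have nz : kernel1 (0 *: v + x) != 0 by rewrite gt_eqF.
have d3 := is_deriveV nz d2.
have d4 := is_deriveM d1 d3.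
have -> : (fun h : R => 'D_(delta_mx 0 j) (log_kernel C) (h *: v + x)) =
   (fun h => moment (fun a => exponent a j) (h *: v + x)) * (fun h => (kernel1 (h *: v + x))^-1).
  by apply/funext => h; rewrite derive_log_kernel.
apply: is_derive_eq d4 _.
have kE : kernel1 x = kernel C p.
  by apply: eq_bigr => a _; rewrite mul1r lp_row.
have mE (u : A -> R) : moment u x = kernel C p * \sum_a weight C p a * u a.
  rewrite mulr_sumr; apply: eq_bigr => a _; rewrite lp_row /weight.
  by field; rewrite gt_eqF// kernel_gt0.
rewrite scale0r add0r /GRing.scale /= -/(kernel1 x) kE.
rewrite (_ : moment (fun a => 1 * _) x = kernel C p * barycenter C p i); last first.
  by rewrite mE; congr (_ * _); apply: eq_bigr => a _; rewrite mul1r lp_delta.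
rewrite !mE -/(barycenter C p j).
have -> : \sum_a weight C p a * (exponent a j * lp a v) =
    weight_cov C p i j + barycenter C p i * barycenter C p j.
  transitivity (\sum_a (weight C p a * ((exponent a i - barycenter C p i) *
    (exponent a j - barycenter C p j)) +
      barycenter C p j * (weight C p a * exponent a i) +
      barycenter C p i * (weight C p a * exponent a j) -
      barycenter C p i * barycenter C p j * weight C p a)).
    by apply: eq_bigr => a _; rewrite lp_delta; ring.
  rewrite sumrB !big_split /= -!mulr_sumr sum_weight//.
  by rewrite -/(weight_cov C p i j) -!/(barycenter C p _); ring.
by field; rewrite gt_eqF// kernel_gt0.
Qed.

End hessian_log_kernel.

(** * Wedge products of 2-forms on the positive frame *)

Section bigwedge_pairs.
Context {R : realType} {V : Type}.

Lemma pair_pos_subproof n (i : 'I_n) (b : bool) : (i * 2 + b < n * 2)%N.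
Proof.
apply: (@leq_trans (2 + i * 2)); first by rewrite [leqRHS]addnC ltn_add2l; case: b.
by rewrite -mulSn leq_mul2r ltn_ord.
 Qed.

Definition pair_pos n (i : 'I_n) (b : bool) : 'I_(n * 2) := Ordinal (pair_pos_subproof i b).

(** Antisymmetrisation of a bilinear function. Each [omega] has this shape, and it keeps the wedge
    computation free of coordinates. *)
Definition alternation (b : V -> V -> R) : altform R V 2 := fun v =>
  b (v ord0) (v (lift ord0 ord0)) - b (v (lift ord0 ord0)) (v ord0).

(** The normalising factorials disappear: for each permutation of the last n * 2 vectors the outer
    sum can be reindexed to the same value, giving (n * 2)!, and the two terms of the first
    alternation contribute equally, giving 2!. *)
Lemma bigwedge_alternation n (b : 'I_n -> V -> V -> R) (v : 'I_(n * 2) -> V) :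
  bigwedge (fun i => alternation (b i)) v =
  \sum_(s : 'S_(n * 2)) (-1) ^+ s *
    \prod_i b i (v (s (pair_pos i false))) (v (s (pair_pos i true))).
Proof.
elim: n b v => [|n IH] b v.
  rewrite (big_pred1 (1%g : 'S_(0 * 2))) => [|s]; first by rewrite odd_perm1 big_ord0 mulr1.
  by rewrite /=; apply/esym/eqP/permP; case.
pose p0 : 'I_(2 + n * 2) := ord0; pose p1 : 'I_(2 + n * 2) := lift ord0 ord0.
have -> : bigwedge (fun i => alternation (b i)) v = (2`! * (n * 2)`!)%:R^-1 *
    \sum_(s : 'S_(2 + n * 2)) (-1) ^+ s * alternation (b ord0) (fun i => v (s (lshift (n * 2) i))) *
     bigwedge (fun i => alternation (b (lift ord0 i))) (fun j => v (s (rshift 2 j))) by [].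
pose G (s : 'S_(2 + n * 2)) := \prod_i b (lift ord0 i)
  (v (s (rshift 2 (pair_pos i false)))) (v (s (rshift 2 (pair_pos i true)))).
(* Extends t by the identity on the first two positions, with the same sign. *)
pose lift2 (t : 'S_(n * 2)) : 'S_(2 + n * 2) := lift_perm ord0 ord0 (lift_perm ord0 ord0 t).
have lift2r t r : lift2 t (rshift 2 r) = rshift 2 (t r).
  have E r' : rshift 2 r' = lift ord0 (lift ord0 r') :> 'I_(2 + n * 2) by exact: val_inj.
  by rewrite !E /lift2 !lift_perm_lift.
have lift2_0 t : lift2 t p0 = p0 by rewrite /lift2 lift_perm_id.
have lift2_1 t : lift2 t p1 = p1 by rewrite /lift2 /p1 lift_perm_lift lift_perm_id.
have lift2_odd t : lift2 t = t :> bool by rewrite /lift2 !odd_lift_perm.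
have l0 : lshift (n * 2) (ord0 : 'I_2) = p0 by exact: val_inj.
have l1 : lshift (n * 2) (lift ord0 ord0 : 'I_2) = p1 by exact: val_inj.
pose al s := b ord0 (v (s p0)) (v (s p1)) - b ord0 (v (s p1)) (v (s p0)).
transitivity ((2`! * (n * 2)`!)%:R^-1 *
    (\sum_(t : 'S_(n * 2)) \sum_(s : 'S_(2 + n * 2)) (-1) ^+ s * (al s * G s))).
  congr (_ * _); rewrite [RHS]exchange_big /=.
  transitivity (\sum_(s : 'S_(2 + n * 2)) \sum_(t : 'S_(n * 2))
      (-1) ^+ (lift2 t * s)%g * (al (lift2 t * s)%g * G (lift2 t * s)%g)).
    apply: eq_bigr => s _; rewrite IH mulr_sumr; apply: eq_bigr => t _.
    rewrite /alternation l0 l1 -/(al s).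
    have -> : al (lift2 t * s)%g = al s by rewrite /al !permM lift2_0 lift2_1.
    have -> : G (lift2 t * s)%g = \prod_i b (lift ord0 i)
        (v (s (rshift 2 (t (pair_pos i false))))) (v (s (rshift 2 (t (pair_pos i true))))).
      by apply: eq_bigr => i _; rewrite !permM !lift2r.
    rewrite odd_permM signr_addb lift2_odd -!mulrA [RHS]mulrCA; congr (_ * _).
    by rewrite mulrCA.
  rewrite exchange_big [RHS]exchange_big /=; apply: eq_bigr => t _.
  by rewrite [RHS](reindex_inj (mulgI (lift2 t))).
set S := \sum_(s : 'S_(2 + n * 2)) _.
have -> : \sum_(t : 'S_(n * 2)) S = (n * 2)`!%:R * S.
  by rewrite sumr_const card_Sn mulr_natl.
rewrite natrM invfM -mulrA mulKf; last by rewrite pnatr_eq0 -lt0n fact_gt0.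
rewrite {}/S.
pose F (s : 'S_(2 + n * 2)) : R := (-1) ^+ s * (b ord0 (v (s p0)) (v (s p1)) * G s).
have -> : \sum_(s : 'S_(2 + n * 2)) (-1) ^+ s * (al s * G s) = (\sum_s F s) + \sum_s F s.
  transitivity (\sum_s F s - \sum_(s : 'S_(2 + n * 2)) (-1) ^+ s * (b ord0 (v (s p1)) (v
    (s p0)) * G s)).
    by rewrite -sumrB; apply: eq_bigr => s _; rewrite /al /F mulrBl mulrBr.
  (* Exchanging the first two positions reverses the sign and turns the negative term of the
     alternation into the positive one. *)
  congr (_ + _); rewrite (reindex_inj (mulgI (tperm p0 p1))) -sumrN; apply: eq_bigr => s _.
  rewrite odd_permM odd_tperm signr_addb /= !permM tpermL tpermR /F.
  have -> : G (tperm p0 p1 * s)%g = G s.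
    by apply: eq_bigr => i _; rewrite !permM !tpermD.
  by rewrite expr1 mulN1r mulNr opprK.
rewrite -mulr2n -[X in _ * X]mulr_natl mulKf ?pnatr_eq0//.
apply: eq_bigr => s _; rewrite /F big_ord_recl; congr (_ * (_ * _)).
- congr (b ord0 (v (s _)) (v (s _))); exact: val_inj.
- by apply: eq_bigr => i _; congr (b _ (v (s _)) (v (s _))); apply: val_inj.
Qed.

End bigwedge_pairs.

Lemma det_cast_ord (R : comPzRingType) m n (e : m = n) (Q : 'M[R]_n) :
  \det (\matrix_(i < m, j < m) Q (cast_ord e i) (cast_ord e j)) = \det Q.
Proof. by case: n / e Q => Q; congr (\det _); apply/matrixP => i j; rewrite mxE !cast_ord_id. Qed.

(* The permutation 2i |-> i, 2i+1 |-> n+i. *)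
Fixpoint interleave n : 'S_(n * 2) :=
  match n with
  | 0 => 1%g
  | m.+1 => @lift_perm (m * 2).+1 ord0 ord0 (@lift_perm (m * 2) ord0 (inord m) (interleave m))
  end.

Lemma interleaveE n (i : 'I_n) b :
  interleave n (pair_pos i b) = (if b then n + i else i)%N :> nat.
Proof.
elim: n i b => [|m IH] i b; first by case: i.
have m2 : (m < (m * 2).+1)%N by rewrite ltnS muln2 -addnn leq_addr.
case: (unliftP ord0 i) => [i'|] ->.
  have -> : pair_pos (lift ord0 i') b = lift ord0 (lift ord0 (pair_pos i' b)) :> 'I_(m * 2).+2.
    exact: val_inj.
  rewrite /= !lift_perm_lift /= /bump /= inordK// IH; case: (b) => /=.
    by rewrite leq_addr add1n !addSn addnS.
  by rewrite leqNgt ltn_ord.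
case: b.
  have -> : pair_pos (ord0 : 'I_m.+1) true = lift ord0 ord0 :> 'I_(m * 2).+2 by exact: val_inj.
  by rewrite /= lift_perm_lift lift_perm_id /= /bump /= inordK// addn0 add1n.
have -> : pair_pos (ord0 : 'I_m.+1) false = ord0 :> 'I_(m * 2).+2 by exact: val_inj.
by rewrite /= lift_perm_id.
Qed.

(** In the induction, the second position is sent beyond m others, which contributes m to the
    parity; the sum is n (n - 1) / 2. This is the origin of the sign in front of the wedge
    product. *)
Lemma odd_interleave n : interleave n = odd (n * (n - 1))./2 :> bool.
Proof.
elim: n => [|m IH]; first by rewrite odd_perm1.
have m2 : (m < (m * 2).+1)%N by rewrite ltnS muln2 -addnn leq_addr.
rewrite /= !odd_lift_perm /= inordK// IH !subn1 -!bin2 binS bin1 oddD.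
by rewrite addbC.
Qed.

Section pos_frame.
Context {R : realType} {n : nat}.
Implicit Types k : 'I_(n * 2).

Let half k := fintype.split (cast_ord (muln2_addnn n) k).

Let frame_p k a : (pos_frame (R := R) k).1 0 a = (half k == inl a)%:R.
Proof.
rewrite /pos_frame -/(half k); case: (half k) => i /=; rewrite mxE//=.
by rewrite eq_sym.
Qed.

Let frame_q k b : (pos_frame (R := R) k).2 0 b = (half k == inr b)%:R.
Proof.
rewrite /pos_frame -/(half k); case: (half k) => i /=; rewrite mxE//=.
by rewrite eq_sym.
Qed.

Let enc (u : 'I_n + 'I_n) : 'I_(n * 2) := cast_ord (esym (muln2_addnn n)) (unsplit u).

Let interleave_enc (i : 'I_n) (b : bool) :
  interleave n (pair_pos i b) = enc (if b then inr i else inl i).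
Proof. by apply: val_inj; rewrite /= interleaveE; case: b. Qed.

Let prod_enc (F : 'I_(n * 2) -> R) :
  \prod_k F k = \prod_i (F (enc (inl i)) * F (enc (inr i))).
Proof.
rewrite (reindex (cast_ord (esym (muln2_addnn n)))) /=.
  by rewrite big_split_ord big_split.
by exists (cast_ord (muln2_addnn n)) => k _; [exact: cast_ordKV|exact: cast_ordK].
Qed.

(** After reindexing by [interleave], the sum is the determinant of the matrix that pairs the chosen
    dp and dq with the frame. It is block diagonal, since dp vanishes on the q-directions and dq on
    the p-directions. *)
Let sum_perm_frame (f : 'I_n -> 'I_n * 'I_n) :
  \sum_(s : 'S_(n * 2)) (-1) ^+ s * \prod_i
    ((pos_frame (R := R) (s (pair_pos i false))).1 0 (f i).1 *
     (pos_frame (R := R) (s (pair_pos i true))).2 0 (f i).2) =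
  (-1) ^+ interleave n * ((\sum_(s : 'S_n) (-1) ^+ s * \prod_i ((f i).1 == s i)%:R) *
    (\sum_(t : 'S_n) (-1) ^+ t * \prod_i ((f i).2 == t i)%:R)).
Proof.
pose g := interleave n.
pose N k' k : R := match half k' with
  | inl i => (half k == inl (f i).1)%:R | inr i => (half k == inr (f i).2)%:R end.
pose D1 : 'M[R]_n := \matrix_(i, a) ((f i).1 == a)%:R.
pose D2 : 'M[R]_n := \matrix_(i, a) ((f i).2 == a)%:R.
have -> : \sum_(s : 'S_n) (-1) ^+ s * \prod_i ((f i).1 == s i)%:R = \det D1.
  by apply: eq_bigr => s _; congr (_ * _); apply: eq_bigr => i _; rewrite mxE.
have -> : \sum_(s : 'S_n) (-1) ^+ s * \prod_i ((f i).2 == s i)%:R = \det D2.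
  by apply: eq_bigr => s _; congr (_ * _); apply: eq_bigr => i _; rewrite mxE.
rewrite -(det_ublock D1 0 D2) -(det_cast_ord (muln2_addnn n)) mulr_sumr.
rewrite (reindex_inj (mulgI g)); apply: eq_bigr => s _.
rewrite odd_permM signr_addb -mulrA; congr (_ * (_ * _)).
rewrite prod_enc; apply: eq_bigr => i _; rewrite !permM !interleave_enc !mxE.
rewrite frame_p frame_q /enc !cast_ordKV /= /half.
rewrite !(unsplitK (inl _)) !(unsplitK (inr _)) /=.
set u := fintype.split (cast_ord _ (s _)); set v := fintype.split (cast_ord _ (s _)).
rewrite ![in RHS]mxE -/u -/v.
have ll (a b : 'I_n) : (inl a == inl b :> 'I_n + 'I_n) = (b == a) by rewrite eq_sym.
have rr (a b : 'I_n) : (inr a == inr b :> 'I_n + 'I_n) = (b == a) by rewrite eq_sym.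
have lr (a b : 'I_n) : (inl a == inr b :> 'I_n + 'I_n) = false by [].
have rl (a b : 'I_n) : (inr a == inl b :> 'I_n + 'I_n) = false by [].
by case: u => a; case: v => b; rewrite ?ll ?rr ?lr ?rl !mxE ?mulr0 ?mul0r.
Qed.

(** Each factor is expanded over a pair of indices f i; the two determinants of the selected basis
    covectors retain only pairs that come from two permutations. *)
Lemma bigwedge_pos_frame (X : 'I_n -> 'M[R]_n) :
  bigwedge (fun i => alternation (fun u v : tangent =>
    \sum_a \sum_b X i a b * (u.1 0 a * v.2 0 b))) (pos_frame (R := R)) =
  (-1) ^+ (n * (n - 1))./2 * \sum_(s : 'S_n) \sum_(t : 'S_n)
    (-1) ^+ s * (-1) ^+ t * \prod_i X i (s i) (t i).
Proof.
rewrite bigwedge_alternation.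
have E (s : 'S_(n * 2)) : \prod_i \sum_a \sum_b X i a b *
    ((pos_frame (R := R) (s (pair_pos i false))).1 0 a *
     (pos_frame (R := R) (s (pair_pos i true))).2 0 b) =
  \sum_(f : {ffun 'I_n -> 'I_n * 'I_n}) (\prod_i X i (f i).1 (f i).2) * \prod_i
    ((pos_frame (R := R) (s (pair_pos i false))).1 0 (f i).1 *
     (pos_frame (R := R) (s (pair_pos i true))).2 0 (f i).2).
  under eq_bigr do rewrite pair_bigA /=.
  by rewrite bigA_distr_bigA /=; apply: eq_bigr => f _; rewrite big_split.
under eq_bigr do rewrite E mulr_sumr.
rewrite exchange_big /=.
transitivity (\sum_(f : {ffun 'I_n -> 'I_n * 'I_n}) (\prod_i X i (f i).1 (f i).2) *
  ((-1) ^+ interleave n * ((\sum_(s : 'S_n) (-1) ^+ s * \prod_i ((f i).1 == s i)%:R) *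
    (\sum_(t : 'S_n) (-1) ^+ t * \prod_i ((f i).2 == t i)%:R)))).
  apply: eq_bigr => f _; rewrite -sum_perm_frame mulr_sumr; apply: eq_bigr => s _.
  by rewrite mulrCA.
under eq_bigr do rewrite mulrCA.
rewrite -mulr_sumr odd_interleave signr_odd; congr (_ * _).
transitivity (\sum_(f : {ffun 'I_n -> 'I_n * 'I_n}) \sum_(s : 'S_n) \sum_(t : 'S_n)
  (-1) ^+ s * (-1) ^+ t * \prod_i (X i (f i).1 (f i).2 * (((f i).1 == s i)%:R *
    ((f i).2 == t i)%:R))).
  apply: eq_bigr => f _; rewrite mulr_suml mulr_sumr; apply: eq_bigr => s _.
  rewrite mulr_sumr mulr_sumr; apply: eq_bigr => t _.
  rewrite !big_split /=; set x := \prod_i X i _ _; set y := \prod_i _; set z := \prod_i _.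
  by rewrite (mulrACA _ y) mulrCA.
rewrite exchange_big; apply: eq_bigr => s _.
rewrite exchange_big; apply: eq_bigr => t _.
rewrite -mulr_sumr; congr (_ * _).
rewrite -(bigA_distr_bigA (fun i (ab : 'I_n * 'I_n) =>
  X i ab.1 ab.2 * ((ab.1 == s i)%:R * (ab.2 == t i)%:R))) /=.
apply: eq_bigr => i _; rewrite (bigD1 (s i, t i))//= !eqxx !mulr1 big1 ?addr0// => -[a b] /=.
by rewrite xpair_eqE negb_and => /orP[] /negbTE ->; rewrite ?mul0r !mulr0.
Qed.

End pos_frame.

(** * Comparison with the completed measure *)

Section completion.
Import HBNNSimple.
Context {d} {T : measurableType d} {R : realType} (mu : {measure set T -> \bar R}).

(** Both integrals are suprema over simple functions below f, and a simple function for the original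
    sigma-algebra is one for the completion with the same integral. No measurability of f enters. *)
Lemma le_integral_completion (f : T -> \bar R) : (forall x, (0 <= f x)%E) ->
  (\int[mu]_x f x <= \int[@completed_measure_extension _ _ _ mu]_x f x)%E.
Proof.
move=> f0; rewrite [leLHS]ge0_integralTE// [leRHS]ge0_integralTE//.
apply: ereal_sup_le => _ [h hf <-].
pose h1 : caratheodory_type (mu^*)%mu -> R := fun x => h x.
have mh : measurable_fun setT h1.
  move=> _ V mV; rewrite setTI; apply: caratheodory_measurable_mu_ext.
  by rewrite -[X in measurable X]setTI; exact: (measurable_funP h).
have fh : finite_set (range h1) by exact: (fimfunP h).
have h0 x : 0 <= h1 x by rewrite /h1.
pose h' : {nnsfun caratheodory_type (mu^*)%mu >-> R} := HB.pack h1
  (isMeasurableFun.Build _ _ _ _ _ mh) (FiniteImage.Build _ _ _ fh) (isNonNegFun.Build _ _ _ h0).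
exists h' => //=; apply: eq_fsbigr => x _; congr (_ * _)%E.
rewrite /completed_measure_extension measurable_mu_extE//.
Qed.

(** The intersection of the covers with excess at most 1 / (k + 1). *)
Lemma mu_ext_hull X : ((mu^*)%mu X < +oo)%E ->
  exists H, [/\ measurable H, X `<=` H & (mu H <= (mu^*)%mu X)%E].
Proof.
move=> Xoo; have Xfin : (mu^*)%mu X \is a fin_num by rewrite ge0_fin_numE ?mu_ext_ge0.
have e0 (k : nat) : 0 < k.+1%:R^-1 :> R by [].
have W k := lb_ereal_inf_adherent (e0 k) Xfin.
have [F hF] : exists F : nat -> nat -> set T, forall k, measurable_cover X (F k) /\
    (\sum_(i <oo) mu (F k i) <= (mu^*)%mu X + (k.+1%:R^-1)%:E)%E.
  have W' k : exists F : nat -> set T, measurable_cover X F /\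
      (\sum_(i <oo) mu (F i) <= (mu^*)%mu X + (k.+1%:R^-1)%:E)%E.
    by have [_ [F XF <-] /ltW] := W k; exists F.
  exists (fun k => projT1 (cid (W' k))) => k; exact: projT2 (cid (W' k)).
have mF k i : measurable (F k i) by have [[]] := hF k.
exists (\bigcap_k \bigcup_i F k i); split.
- by apply: bigcapT_measurable => k; exact: bigcupT_measurable.
- by move=> x Xx k _; have [[_ +] _] := hF k; exact.
apply/lee_addgt0Pr => e e_gt0.
have [k hk] : exists k : nat, k.+1%:R^-1 <= e.
  exists (Num.truncn e^-1); rewrite -[leRHS]invrK lef_pV2 ?posrE ?invr_gt0//.
  exact/ltW/truncnS_gt.
have [_ hS] := hF k; apply: (@le_trans _ _ (\sum_(i <oo) mu (F k i))%E); last first.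
  by apply: le_trans hS _; rewrite leeD2l// lee_fin.
apply: measure_sigma_subadditive => //.
  by apply: bigcapT_measurable => j; exact: bigcupT_measurable.
by move=> x h; exact: h.
Qed.

Hypothesis sfmu : sigma_finite setT mu.

(** On a piece F of finite measure, take hulls H of F inside U and H' of F outside U. Then F minus
    H' lies in U, the trace of H on F contains the part of U in F, and Carathéodory's condition for
    U leaves no measure for their difference. *)
Lemma caratheodory_sandwich (U : set T) : ((mu^*)%mu).-cara.-measurable U ->
  exists B B' : set T, [/\ measurable B, measurable B', B `<=` U, U `<=` B' & mu (B' `\` B) = 0].
Proof.
move=> mU; have [F TF Foo] := sfmu.
have mF r : measurable (F r) by case: (Foo r).
have finF r : (mu (F r) < +oo)%E by case: (Foo r).
have sub r X : X `<=` F r -> ((mu^*)%mu X <= mu (F r))%E.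
  by move=> XF; rewrite -(measurable_mu_extE mu (mF r)); exact: le_mu_ext.
have H r : exists B B' : set T, [/\ measurable B, measurable B', B `<=` U, F r `&` U `<=` B' &
    mu (B' `\` B) = 0].
  have [H [mH XH muH]] := mu_ext_hull (le_lt_trans (sub r (F r `&` U) (@subIsetl _ _ _)) (finF r)).
  have [H' [mH' XH' muH']] := mu_ext_hull (le_lt_trans (sub r (F r `&` ~` U) (@subIsetl _ _ _))
    (finF r)).
  have mB : measurable (F r `\` H') by exact: measurableD.
  have mB' : measurable (H `&` F r) by exact: measurableI.
  have BU : F r `\` H' `<=` U.
    by move=> x [Fx nH]; apply: contrapT => nU; apply: nH; exact: XH'.
  have BB' : F r `\` H' `<=` H `&` F r.
    by move=> x hx; have Ux := BU x hx; case: hx => Fx _; split => //; exact: XH.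
  exists (F r `\` H'), (H `&` F r); split => //.
    by move=> x [Fx Ux]; split => //; exact: XH.
  have Ffin : mu (F r) \is a fin_num by rewrite ge0_fin_numE.
  apply/eqP; rewrite -measure_le0.
  suff : (mu (F r) + mu ((H `&` F r) `\` (F r `\` H')) <= mu (F r) + 0)%E by rewrite leeD2lE.
  (* Carathéodory's condition, tested on [F r], splits its measure into the outer measures that
     bound the two hulls. *)
  rewrite adde0 [leRHS](_ : _ = ((mu^*)%mu (F r `&` U) + (mu^*)%mu (F r `&` ~` U))%E); last first.
    by rewrite -(measurable_mu_extE mu (mF r)); exact: mU.
  rewrite {1}(measureDI mu (mF r) mH') -addeA [(mu (F r `&` H') + _)%E]addeC addeA.
  apply: leeD; last by apply: le_trans muH'; apply: le_measure; rewrite ?inE//; exact: measurableI.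
  rewrite -[X in (mu X + _)%E](setIidr BB') addeC -measureDI//.
  apply: le_trans muH; apply: le_measure; rewrite ?inE//.
pose B r := projT1 (cid (H r)); pose B' r := projT1 (cid (projT2 (cid (H r)))).
have hB' r : [/\ measurable (B r), measurable (B' r), B r `<=` U, F r `&` U `<=` B' r &
  mu (B' r `\` B r) = 0] by exact: projT2 (cid (projT2 (cid (H r)))).
have mB r : measurable (B r) by case: (hB' r).
have mB' r : measurable (B' r) by case: (hB' r).
have mUB : measurable (\bigcup_r B r) by exact: bigcupT_measurable.
have mUB' : measurable (\bigcup_r B' r) by exact: bigcupT_measurable.
exists (\bigcup_r B r), (\bigcup_r B' r); split => //.
- by move=> x [r _ Bx]; have [_ _ + _ _] := hB' r; exact.
- move=> x Ux; have [r _ Fx] : (\bigcup_r F r) x by rewrite -TF.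
  by exists r => //; have [_ _ _ + _] := hB' r; exact.
apply/eqP; rewrite -measure_le0.
apply: le_trans (@measure_sigma_subadditive _ _ _ mu _ (fun r => B' r `\` B r) _ _ _) _.
- by move=> r; exact: measurableD.
- exact: measurableD.
- move=> x [[r _ B'x] nB]; exists r => //; split => // Bx; apply: nB; by exists r.
by rewrite eseries0// => r _ _; case: (hB' r).
Qed.

Lemma integral_null_diff (B B' : set T) (f : T -> \bar R) : measurable B -> measurable B' ->
  B `<=` B' -> mu (B' `\` B) = 0 -> measurable_fun setT f -> (forall x, (0 <= f x)%E) ->
  (\int[mu]_(x in B') f x = \int[mu]_(x in B) f x)%E.
Proof.
move=> mB mB' BB' null mf f0.
rewrite -{1}(setDUK BB') ge0_integral_setU//; last 3 first.
- exact: measurableD.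
- exact: measurable_funTS.
- by rewrite disj_set2E setDIK.
by rewrite (null_set_integral _ _ null) ?adde0//; [exact: measurableD|exact: measurable_funTS].
Qed.

End completion.

(** * Conclusion *)

Lemma posdefmx_diag_gt0 (R : realType) m (M : 'M[R]_m) k : posdefmx M -> 0 < M k k.
Proof.
move=> [_ /(_ (delta_mx 0 k))].
have nz : delta_mx 0 k != 0 :> 'rV[R]_m.
  apply/negP => /eqP/rowP/(_ k); rewrite !mxE !eqxx => /eqP; exact/negP/oner_neq0.
by move=> /(_ nz); rewrite -rowE trmx_delta -colE !mxE.
Qed.

Lemma wedge_oneforms (R : realType) V (al be : altform R V 1) (v : 'I_2 -> V) :
  wedge al be v = al (fun=> v ord0) * be (fun=> v (lift ord0 ord0)) -
    al (fun=> v (lift ord0 ord0)) * be (fun=> v ord0).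
Proof.
pose M : 'M[R]_2 := \matrix_(r, k) (if r == ord0 then al (fun=> v k) else be (fun=> v k)).
transitivity (\det M).
  rewrite /wedge (_ : (1`! * 1`! = 1)%N)// invr1 mul1r; apply: eq_bigr => s _.
  rewrite big_ord_recl big_ord1 !mxE /= mulrA; congr (_ * al _ * be _); apply/funext => i.
    by congr (v (s _)); apply: val_inj; rewrite /= (ord1 i).
  by congr (v (s _)); apply: val_inj; rewrite /= (ord1 i).
rewrite (expand_det_row _ ord0) big_ord_recl big_ord1 /cofactor !det_mx11 !mxE /=.
rewrite expr0 mul1r /bump /= expr1 mulN1r mulrN; congr (_ * be _ - _ * be _);
  by apply/funext => i; congr v; exact: val_inj.
Qed.

Section form_value.
Context {R : realType} {n : nat}.
Variables (A : 'I_n -> {fset 'rV[int]_n}) (C : forall i, 'M[R]_#|{: A i}|).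
Hypothesis A0 : forall i, A i != fset0.
Hypothesis C_gt0 : forall i (a : A i), 0 < C i (enum_rank a) (enum_rank a).

(** The factor 1/2 of [omega] cancels the 2 of the Hessian, leaving the weight covariances, and the
    sign of the interleaving squares to 1. *)
Lemma bigwedge_omega (z : n.-tuple R * n.-tuple R) :
  (-1) ^+ (n * (n - 1))./2 * bigwedge (fun i => omega (C i) z) (@pos_frame R n) =
  sqr_det_mean C z.1.
Proof.
have -> : (fun i => omega (C i) z) = (fun i => alternation (fun u v : tangent =>
    \sum_a \sum_b 2^-1 * hessian (log_kernel (C i)) (row_of z.1) a b * (u.1 0 a * v.2 0 b))).
  apply/funext => i; apply/funext => v; rewrite /omega /alternation mulr_sumr -sumrB.
  apply: eq_bigr => a _; rewrite mulr_sumr -sumrB; apply: eq_bigr => b _.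
  by rewrite wedge_oneforms /dp /dq; ring.
pose X i := \matrix_(a, b) weight_cov (C i) z.1 a b.
have -> : (fun i => alternation (fun u v : tangent =>
    \sum_a \sum_b 2^-1 * hessian (log_kernel (C i)) (row_of z.1) a b * (u.1 0 a * v.2 0 b))) =
   (fun i => alternation (fun u v : tangent => \sum_a \sum_b X i a b * (u.1 0 a * v.2 0 b))).
  apply/funext => i; congr alternation; apply/funext => u; apply/funext => v.
  apply: eq_bigr => a _; apply: eq_bigr => b _; congr (_ * _).
  by rewrite hessian_log_kernel ?mxE//; field.
rewrite bigwedge_pos_frame mulrA -expr2 sqrr_sign mul1r.
apply: eq_bigr => s _; apply: eq_bigr => t _; congr (_ * _).
by apply: eq_bigr => i _; rewrite mxE.
Qed.

Lemma lebesgue_torus_box : measurable (@torus_box R n : set (n.-tuple (measurableTypeR R))) /\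
  lebesgue_tuple n (@torus_box R n) = ((2 * pi) ^+ n)%:E.
Proof.
pose B (j : 'I_n) : set (measurableTypeR R) := `[0, 2 * pi[%classic.
have mB j : measurable (B j) by exact: measurable_itv.
have -> : @torus_box R n = [set x : n.-tuple (measurableTypeR R) | forall j, B j (tnth x j)].
  by apply/seteqP; split => x /= h j; have := h j; rewrite /B /= in_itv.
split; first by rewrite measurable_tupleE; apply: sub_sigma_algebra; exists B.
rewrite lebesgue_tuple_box// (eq_bigr (fun=> (2 * pi)%:E)).
  by rewrite prodEFin prodr_const card_ord.
move=> j _; rewrite /B lebesgue_measure_itv /= lte_fin mulr_gt0 ?pi_gt0//.
by rewrite sube0.
Qed.

(** The coefficient does not depend on q, so integrating over the torus box gives (2 pi)^n. The form
    integral occurs on the larger side of the theorem, so a lower bound by a measurable subset of U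
    is what is wanted, and monotonicity of nonnegative integrals supplies it. *)
Lemma form_integral_ge (U : set (n.-tuple R)) (B : set (n.-tuple (measurableTypeR R))) :
  measurable B -> B `<=` U ->
  (((2 * pi) ^+ n)%:E * \int[lebesgue_tuple n]_(x in B) (sqr_det_mean C x)%:E <=
   form_integral (U `*` torus_box)
      (fun z v => ((-1) ^+ (n * (n - 1))./2 * bigwedge (fun i => omega (C i) z) v)%R))%E.
Proof.
move=> mB BU; have [mbox boxE] := lebesgue_torus_box.
pose e := sqr_det_mean C.
have e0 x : 0 <= e x by exact: sqr_det_mean_ge0.
have me : measurable_fun setT (e : n.-tuple (measurableTypeR R)
  -> R) by exact: measurable_sqr_det_mean.
pose g (z : n.-tuple (measurableTypeR R) * n.-tuple (measurableTypeR R)) : \bar R :=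
  ((e z.1 * \1_B z.1)%:E * (\1_torus_box z.2)%:E)%E.
have g0 z : (0 <= g z)%E by rewrite /g -EFinM lee_fin !mulr_ge0.
have meB : measurable_fun setT (fun x : n.-tuple (measurableTypeR R) => e x * \1_B x).
  by apply: measurable_funM => //; exact: measurable_indic.
have mg : measurable_fun setT g.
  apply/measurable_EFinP; apply: measurable_funM.
    by apply: (measurableT_comp meB).
  apply: (@measurableT_comp _ _ _ _ _ _ (\1_torus_box : n.-tuple (measurableTypeR R) -> R)) => //.
apply: (@le_trans _ _ (\int[lebesgue_tuple n \x lebesgue_tuple n]_z g z)%E).
  rewrite fubini_tonelli1// /fubini_F le_eqVlt; apply/orP; left; apply/eqP.
  transitivity (\int[lebesgue_tuple n]_x (((2 * pi) ^+ n)%:E * (e x * \1_B x)%:E))%E.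
    rewrite ge0_integralZl//; last 3 first.
    - exact/measurable_EFinP.
    - by move=> x _; rewrite lee_fin mulr_ge0.
    - by rewrite lee_fin exprn_ge0// mulr_ge0// pi_ge0.
    congr (_ * _)%E; rewrite [LHS]integral_mkcond; apply: eq_integral => x _.
    by rewrite patchE indicE; case: ifP => _; rewrite ?mulr1 ?mulr0.
  apply: eq_integral => x _; rewrite /g /= ge0_integralZl//; last 2 first.
  - by apply/measurable_EFinP; exact: measurable_indic.
  - by rewrite lee_fin mulr_ge0.
  by rewrite integral_indic// setIT muleC; congr (_ * _)%E; exact/esym.
apply: (@le_trans _ _ (\int[@lebesgue_vol2 R n]_z g z)%E); first exact: le_integral_completion.
rewrite /form_integral [leRHS]integral_mkcond.
apply: ge0_le_integral_nonmeasurable => // -[x y].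
rewrite patchE /g; case: ifPn => [|nin] /=.
  move=> _; rewrite -EFinM lee_fin [leRHS](bigwedge_omega (x, y)) /= -/(e x).
  by rewrite !indicE; case: (_ \in _); case: (_ \in _); rewrite ?mulr1 ?mulr0.
rewrite -EFinM lee_fin !indicE; case: (boolP (x \in B)) => xB; last by rewrite mulr0 mul0r.
case: (boolP (y \in torus_box)) => yb; last by rewrite mulr0.
move: nin; rewrite notin_setE => /(_ _)[]; split => /=; last by rewrite -in_setE.
by apply: BU; rewrite -in_setE.
Qed.

End form_value.

Lemma expR_intM (R : realType) (z : int) (x : R) : expR (z%:~R * x) = expR x ^ z.
Proof.
case: z => k; first by rewrite -pmulrn expRM_natl.
by rewrite NegzE rmorphN /= mulNr expRN -pmulrn expRM_natl.
Qed.

Section roots.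
Context {R : realType} {n : nat}.
Variables (A : 'I_n -> {fset 'rV[int]_n}) (C : forall i, 'M[R]_#|{: A i}|).
Context d (T : measurableType d) (P : probability T R).
Variable c : forall i, A i -> {RV P >-> R}.
Arguments c : clear implicits.

Lemma counting_roots_le w (U : set (n.-tuple R)) (B : set (n.-tuple (measurableTypeR R))) :
  U `<=` B -> (counting (roots_in c w (@exp_tuple R n @` U)) <=
    counting (zero_set c w `&` B : set (n.-tuple (measurableTypeR R))) :> \bar R)%E.
Proof.
move=> UB; apply: counting_le => s us sS.
pose lnt (x : n.-tuple R) : n.-tuple (measurableTypeR R) := [tuple ln (tnth x i) | i < n].
have lntK (p : n.-tuple R) : lnt (exp_tuple p) = p.
  by apply: eq_from_tnth => i; rewrite !tnth_mktuple expRK.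
have hs x : x \in s -> exists p, [/\ U p, x = exp_tuple p & zero_set c w p].
  move=> /sS[[p Up <-] h]; exists p; split => // i; rewrite -[RHS](h i).
  apply: eq_bigr => a _; congr (_ * _); rewrite /pairing expR_sum.
  by apply: eq_bigr => j _; rewrite tnth_mktuple expR_intM.
rewrite -(size_map lnt); apply: le_counting.
  rewrite map_inj_in_uniq// => x y /hs[p [_ -> _]] /hs[q [_ -> _]].
  by rewrite !lntK => ->.
move=> _ /mapP[x /hs[p [Up -> zp]] ->]; rewrite lntK; split => //; exact: UB.
Qed.

Hypothesis A0 : forall i, A i != fset0.
Hypothesis Cdiag : forall i, is_diag_mx (C i).
Hypothesis C_gt0 : forall i (a : A i), 0 < C i (enum_rank a) (enum_rank a).
Hypothesis hc : random_system C c.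
Implicit Types B : set (n.-tuple (measurableTypeR R)).

Let e (x : n.-tuple (measurableTypeR R)) := sqr_det_mean C x.
Let vol := @lebesgue_tuple R n.
Let pk : R := normal_peak 1 ^+ n.
Let pk0 : 0 < pk. Proof. by rewrite exprn_gt0// normal_peak_gt0. Qed.
Let e0 x : 0 <= e x. Proof. exact: sqr_det_mean_ge0. Qed.
Let me : measurable_fun setT e. Proof. exact: measurable_sqr_det_mean. Qed.

(* The optimal t is the quotient of the two square roots; a small perturbation
   keeps it positive when one of them vanishes. *)
Let optimise_le (l i eta : R) : 0 <= l -> 0 <= i -> 0 < eta -> exists2 t : R, 0 < t &
  pk * (2^-1 * (t * l + i / t)) <= pk * Num.sqrt l * Num.sqrt i + eta.
Proof.
move=> l0 i0 eta0; set sl := Num.sqrt l; set si := Num.sqrt i.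
have sl0 : 0 <= sl by exact: sqrtr_ge0.
have si0 : 0 <= si by exact: sqrtr_ge0.
have slE : l = sl ^+ 2 by rewrite sqr_sqrtr.
have siE : i = si ^+ 2 by rewrite sqr_sqrtr.
have D0 : 0 < pk * (sl + si + 1) by rewrite mulr_gt0//; lra.
pose u := eta / (pk * (sl + si + 1)).
have u0 : 0 < u by rewrite divr_gt0.
have slu : 0 < sl + u by lra.
have siu : 0 < si + u by lra.
exists ((si + u) / (sl + u)); first by rewrite divr_gt0.
have b1 : (si + u) / (sl + u) * l <= (si + u) * sl.
  rewrite -mulrA ler_wpM2l ?(ltW siu)// mulrC ler_pdivrMr// slE expr2 ler_wpM2l//.
  by rewrite lerDl ltW.
have b2 : i / ((si + u) / (sl + u)) <= si * (sl + u).
  rewrite invfM invrK mulrA ler_wpM2r ?(ltW slu)// ler_pdivrMr// siE expr2 ler_wpM2l//.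
  by rewrite lerDl ltW.
apply: (@le_trans _ _ (pk * (sl * si + u * (sl + si)))).
  rewrite ler_wpM2l ?(ltW pk0)//.
  have : 0 <= u * (sl + si) by rewrite mulr_ge0 ?addr_ge0// ltW.
  move: b1 b2; rewrite !mulrDr !mulrDl; set x := _ * l; set y := i / _.
  by rewrite (mulrC si sl); lra.
rewrite mulrDr -[_ * sl * si]mulrA lerD2l.
have -> : eta = u * (pk * (sl + si + 1)) by rewrite /u divfK// gt_eqF.
rewrite mulrCA ler_wpM2l ?(ltW u0)// ler_wpM2l ?(ltW pk0)//; lra.
Qed.

Let count_finite B : measurable B -> (vol B < +oo)%E ->
  (\int[vol]_(x in B) (e x)%:E < +oo)%E ->
  dominated P (fun w => counting (zero_set c w `&` B))
    (pk * Num.sqrt (fine (vol B)) * Num.sqrt (fine (\int[vol]_(x in B) (e x)%:E)))%:E.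
Proof.
move=> mB volB intB; set I := (\int[vol]_(x in B) _)%E.
have I0 : (0 <= I)%E by apply: integral_ge0 => x _; rewrite lee_fin.
have If : I \is a fin_num by rewrite ge0_fin_numE.
have Vf : vol B \is a fin_num by rewrite ge0_fin_numE.
apply: dominated_inf => eta eta0.
have [t t0 ht] := optimise_le (fine_ge0 (measure_ge0 vol B)) (fine_ge0 I0) eta0.
apply: dominated_le (zero_count_dominated A0 Cdiag C_gt0 hc t0 mB) => //.
have pt0 : 0 <= pk * (2^-1 * t) by rewrite mulr_ge0 ?(ltW pk0)// mulr_ge0// ltW.
have pti0 : 0 <= pk * (2^-1 * t^-1).
  by rewrite mulr_ge0 ?(ltW pk0)// mulr_ge0// invr_ge0 ltW.
have meB : measurable_fun B (EFin \o e) by apply/measurable_EFinP; exact: measurable_funTS.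
rewrite (_ : (\int[lebesgue_tuple n]_(x in B) _)%E =
    \int[vol]_(x in B) ((pk * (2^-1 * t))%:E + (pk * (2^-1 * t^-1))%:E * (e x)%:E))%E; last first.
  apply: eq_integral => x _; rewrite -EFinM -EFinD; congr _%:E.
  by rewrite -/pk -/(e x); ring.
rewrite ge0_integralD//; last 2 first.
- by move=> x _; rewrite mule_ge0// lee_fin.
- exact: measurable_funeM.
rewrite integral_cst// ge0_integralZl//; last by move=> x _; rewrite lee_fin.
rewrite -[X in (_ * X + _)%E](fineK Vf) -[X in (_ + _ * X)%E](fineK If) -!EFinM -!EFinD lee_fin.
rewrite (le_trans _ ht)// le_eqVlt; apply/orP; left; apply/eqP.
by ring.
Qed.

Let dominated_pinfty (f : T -> \bar R) : dominated P f +oo.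
Proof. by exists (cst +oo%E); split => // [w|w|]; rewrite ?leey. Qed.

(** Extends [count_finite] to infinite volumes and integrals. If both quantities are nonzero and one
    is infinite the bound is infinite; the delicate case is a product of 0 and infinity, which
    equals 0. *)
Lemma zero_count_le B : measurable B -> dominated P (fun w => counting (zero_set c w `&` B))
  (pk%:E * sqrte (vol B) * sqrte (\int[vol]_(x in B) (e x)%:E)).
Proof.
move=> mB; set I := (\int[vol]_(x in B) _)%E.
have I0 : (0 <= I)%E by apply: integral_ge0 => x _; rewrite lee_fin.
have V0 : (0 <= vol B)%E by exact: measure_ge0.
have meB : measurable_fun B (EFin \o e) by apply/measurable_EFinP; exact: measurable_funTS.
have sqrte_gt0 (x : \bar R) : (0 < x)%E -> (0 < sqrte x)%E.
  by case: x => [r| |]//=; rewrite !lte_fin sqrtr_gt0.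
have [VB|VB] := eqVneq (vol B) 0%E.
  have IE : I = 0%E by exact: null_set_integral.
  rewrite VB IE sqrte0 mule0.
  have := count_finite mB; rewrite -/I IE VB /= !sqrtr0 mulr0.
  by apply; exact: ltry.
have Vgt0 : (0 < vol B)%E by rewrite lt0e VB.
have pV : (0 < pk%:E * sqrte (vol B))%E by rewrite mule_gt0 ?lte_fin ?sqrte_gt0.
(* The volume may be infinite here although the bound is 0. On each cube it is finite and the
   integral still vanishes; the counts on cubes then yield the full count. *)
have [IE|Ine] := eqVneq I 0%E.
  rewrite IE sqrte0 mule0.
  apply: (dominated_limn_einf (fun w => counting_le_cubes _) (b := fun=> 0%E)) => [r|eta eta0].
    have mK := @measurable_centered_cube R n r.
    have mBK : measurable (B `&` centered_cube r) by exact: measurableI.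
    have IK : (\int[vol]_(x in B `&` centered_cube r) (e x)%:E = 0)%E.
      apply/eqP; rewrite eq_le; apply/andP; split; last first.
        by apply: integral_ge0 => x _; rewrite lee_fin.
      rewrite -IE; apply: ge0_subset_integral => // x _; by rewrite lee_fin.
    have := count_finite mBK; rewrite IK /= sqrtr0 mulr0 => h.
    under eq_fun do rewrite -setIA.
    apply: h => //.
    apply: (@le_lt_trans _ _ (vol (centered_cube r))).
      by apply: le_measure; rewrite ?inE.
    by rewrite /vol lebesgue_centered_cube ltry.
  by exists 0%N => k _; rewrite add0e lee_fin ltW.
have Igt0 : (0 < I)%E by rewrite lt0e Ine.
have [Voo|Voo] := eqVneq (vol B) +oo%E.
  rewrite Voo /= gt0_muley ?lte_fin// gt0_mulye ?sqrte_gt0//.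
have [Ioo|Ioo] := eqVneq I +oo%E.
  rewrite Ioo /= gt0_muley//.
have VB' : (vol B < +oo)%E by rewrite ltey.
have IB' : (I < +oo)%E by rewrite ltey.
have := count_finite mB VB' IB'; rewrite -/I.
have Vf : vol B \is a fin_num by rewrite ge0_fin_numE.
have If : I \is a fin_num by rewrite ge0_fin_numE.
by rewrite -{2}(fineK Vf) -{2}(fineK If) /= -!EFinM.
Qed.

End roots.

(** Writes (2 pi)^(-n/2) as the constant of the theorem times the square root of the volume of the
    torus, which then joins the integral of e under the root. *)
Lemma normal_peak_torus (R : realType) n : (normal_peak 1 ^+ n : R) =
  (4 * pi ^+ 2) `^ (- (n%:R / 2)) * Num.sqrt ((2 * pi) ^+ n).
Proof.
have p0 : 0 < 2 * pi :> R by rewrite mulr_gt0// pi_gt0.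
pose S : R := Num.sqrt (2 * pi).
have S0 : 0 < S by rewrite sqrtr_gt0.
have SE : 2 * pi = S ^+ 2 by rewrite sqr_sqrtr// ltW.
have -> : normal_peak 1 = S^-1.
  by rewrite /normal_peak /S; congr (Num.sqrt _)^-1; rewrite expr1n mul1r mulr2n; ring.
have -> : Num.sqrt ((2 * pi) ^+ n) = S ^+ n.
  by rewrite SE exprAC sqrtr_sqr ger0_norm// exprn_ge0// ltW.
have -> : 4 * pi ^+ 2 = S `^ 4.
  have -> : 4 * pi ^+ 2 = (2 * pi) ^+ 2 :> R by rewrite exprMn; ring.
  by rewrite SE -exprM powR_mulrn// ltW.
rewrite -powRrM (_ : 4 * - (n%:R / 2) = - (n + n)%:R); last by rewrite natrD; field.
by rewrite powRN powR_mulrn ?(ltW S0)// exprD invfM -mulrA mulVf ?mulr1 ?exprVn// expf_neq0//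
  gt_eqF.
Qed.

Theorem theorem3 (R : realType) (n : nat)
    (A : 'I_n -> {fset 'rV[int]_n}) (hA : forall i, A i != fset0)
    (C : forall i, 'M[R]_#|{: A i}|)
    (hCdiag : forall i, is_diag_mx (C i)) (hCpos : forall i, posdefmx (C i))
    (U : set (n.-tuple R)) (hU : lebesgue_measurable U)
    (d : measure_display) (T : measurableType d) (P : probability T R)
    (c : forall i, A i -> {RV P >-> R}) (hc : random_system C c) :
  (average_roots c (exp_tuple @` U) <=
    ((4 * pi ^+ 2) `^ (- (n%:R / 2)))%:E *
    sqrte (lebesgue_vol n U) *
    sqrte (form_integral (U `*` torus_box)
      (fun z v => (-1) ^+ (n * (n - 1))./2 *
                  bigwedge (fun i => omega (C i) z) v)%R))%E.
Proof.
have C_gt0 i (a : A i) : 0 < C i (enum_rank a) (enum_rank a) by exact: posdefmx_diag_gt0.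
(* The outer set B' dominates the root count and the inner set B bounds the right-hand side from
   below; they differ by a null set. *)
have [B [B' [mB mB' BU UB' null]]] :=
  caratheodory_sandwich (sigma_finiteT (lebesgue_tuple n)) hU.
have BB' : B `<=` B' by exact: subset_trans UB'.
have e0 x : 0 <= sqr_det_mean C x by exact: sqr_det_mean_ge0.
have volE : lebesgue_tuple n B' = lebesgue_tuple n B.
  by rewrite (measureDI _ mB' mB) [X in (X + _)%E]null add0e (setIidr BB').
have intE : (\int[lebesgue_tuple n]_(x in B') (sqr_det_mean C x)%:E =
    \int[lebesgue_tuple n]_(x in B) (sqr_det_mean C x)%:E)%E.
  apply: integral_null_diff => //.
  by apply/measurable_EFinP; exact: measurable_sqr_det_mean.
apply: (@le_trans _ _ ((normal_peak 1 ^+ n)%:E * sqrte (lebesgue_tuple n B') *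
    sqrte (\int[lebesgue_tuple n]_(x in B') (sqr_det_mean C x)%:E))%E).
  apply: le_integral_dominated => [w|]; first exact: (@le_counting _ _ _ [::]).
  apply: dominated_le (zero_count_le hA hCdiag C_gt0 hc mB') => // w.
  exact: counting_roots_le.
rewrite volE intE normal_peak_torus EFinM -[(_ * (Num.sqrt _)%:E)%E]/(_ * sqrte
  ((2 * pi) ^+ n)%:E)%E.
have I0 : (0 <= \int[lebesgue_tuple n]_(x in B) (sqr_det_mean C x)%:E)%E.
  by apply: integral_ge0 => x _; rewrite lee_fin.
have p0 : (0 <= ((2 * pi) ^+ n)%:E :> \bar R)%E by rewrite lee_fin exprn_ge0// mulr_ge0// pi_ge0.
(* Brings the torus volume under the second square root, so that the two square roots can be
   compared factor by factor. *)
rewrite -muleA -muleA [X in (_ * X)%E]muleCA -sqrteM// -muleA.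
apply: lee_wpmul2l; first by rewrite lee_fin powR_ge0.
apply: lee_pmul; rewrite ?sqrte_ge0//.
  rewrite lee_sqrt ?measure_ge0//.
  rewrite -(measurable_mu_extE (lebesgue_tuple n) mB); exact: le_mu_ext.
rewrite lee_sqrt; last first.
  apply: le_trans (form_integral_ge hA C_gt0 mB BU); exact: mule_ge0.
exact: form_integral_ge.
Qed.
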